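(* Let $m>0$ and consider the Schwarzschild spacetime $r>2m$ in coordinates $(\mathbf y,x,v)$, $\mathbf y\in\mathbb S^2$, $0<x<\frac1{2m}$, $v\in\mathbb R$, with metric $$g_{\mathrm{Sch}}=-(1-2mx)\,dv^2+2x^{-2}\,dv\,dx+x^{-2}\sigma,$$ where $x=r^{-1}$, $v=t-r-2m\log(\frac r{2m}-1)$ and $\sigma$ is the standard metric of $\mathbb S^2$. Let $f$ be a smooth function on $\mathbb S^2$, let $0<\tau_1<\tau_2<\infty$, and for $\tau>0$ let $$P(\mathbf y,x,\tau)=f(\mathbf y)+x\,\phi(\tau,\mathbf y)+\tfrac12x^2\,\psi(\tau,\mathbf y),$$ $$\phi=-\tfrac12\left(\tau^2+|\widetilde\nabla f|^2\right),\qquad \psi=\tfrac12\left(\tau^2\widetilde\Delta f+\langle\widetilde\nabla|\widetilde\nabla f|^2,\widetilde\nabla f\rangle\right),$$ where $\widetilde\nabla,\widetilde\Delta$, norms and inner products are those of the standard $\mathbb S^2$. For $x_0>0$ let $\Phi:\mathbb S^2\times(0,x_0)\times(\tau_1,\tau_2)\to$ Schwarzschild, $\Phi(\mathbf y,x,\tau)=(\mathbf y,x,-P(\mathbf y,x,\tau))$ in $(\mathbf y,x,v)$ coordinates, let $N$ be its image, and regard $\tau$ as a function on $N$ via $\Phi$. Then there exists $x_0>0$ such that the following are true, where $|||\cdot|||$ is the norm with respect to the reference Riemannian metric of $\tau$: (i) $|||\overline\nabla\mathbf T|||_{1,N}$ is finite; (ii) $\alpha$, $\alpha^{-1}$ and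 $|||\overline\nabla\alpha|||$ are uniformly bounded on $N$; (iii) $|||\overline\nabla\log r|||$ is uniformly bounded on $N$; (iv) the second fundamental form $A$ of the level sets $\tau=$ constant and its covariant derivatives are uniformly bounded; (v) $|||\overline{\mathrm{Rm}}|||_{k,N}$ is finite for all $k\ge0$; (vi) the mean curvature of the level set $\tau=$ constant satisfies $H=\frac1\tau+O(x^2)$, and $d(p)\left|H(p)-\frac1\tau\right|\to0$ as $p\to\infty$ on $\tau=$ constant, where $d(p)$ is the intrinsic distance from a fixed point on the level surface.
   Context: For $x_0>0$ small enough $\Phi$ is a diffeomorphism onto its image $N$ and the gradient $\overline\nabla\tau$ (with respect to $g_{\mathrm{Sch}}$) is a past directed timelike vector field on $N$ (time orientation: $\partial/\partial t$ is future directed). $\overline\nabla$, $\overline{\mathrm{Rm}}$ are the Levi-Civita connection and curvature tensor of $g_{\mathrm{Sch}}$. The lapse function $\alpha>0$ of $\tau$ is given by $\alpha^{-2}=-\langle\overline\nabla\tau,\overline\nabla\tau\rangle$, and $\mathbf T=-\alpha\overline\nabla\tau$. The reference Riemannian metric with respect to $\tau$ is $g_{\mathrm{Sch}}+2\omega\otimes\omega$, with $\omega$ the one-form dual to $\mathbf T$, and $|||B|||_{k,N}=\sup_{0\le l\le k}\sup_N|||\overline\nabla^lB|||$. The level sets of $\tau$ are spacelike with future unit normal $\mathbf T$; $A(X,Y)=\langle\overline\nabla_X\mathbf T,Y\rangle$, norms and covariant derivatives of $A$ are with respect to the induced metric, and the mean curvature is normalized as $H=\frac13\operatorname{tr}A$.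 ''$p\to\infty$'' on a level set means $x\to0$. *)

(* Defs.v *)
From HB Require Import structures.
From mathcomp Require Import all_boot all_order all_algebra.
From mathcomp Require Import all_classical all_reals all_analysis.
Import Order.TTheory GRing.Theory Num.Theory.
Import numFieldNormedType.Exports.

Set Implicit Arguments.
Unset Strict Implicit.
Unset Printing Implicit Defensive.

Local Open Scope classical_set_scope.
Local Open Scope ring_scope.

(* Manifolds are handled through an explicit atlas: S^2 is covered by the two
   stereographic charts (indexed by a boolean c), and the other coordinates are
   global.  A tensor field is given by its components in each chart, and the
   tensor calculus below is the usual component calculus on a coordinate patch
   of R^n.  Scalars built from tensors (norms, traces) do not depend on the
   chart, so that a supremum over the manifold is a supremum over both charts. *)

Section TensorCalculus.
Context {R : realType} {n : nat}.
Implicit Types (F : 'rV[R]_n -> R) (x : 'rV[R]_n) (G : 'rV[R]_n -> 'M[R]_n).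

Definition pd (i : 'I_n) F x : R := 'D_(delta_mx 0 i) F x.

(* C^oo on an open set: all iterated partial derivatives are differentiable. *)
Definition smooth_on (U : set 'rV[R]_n) F : Prop :=
  forall (s : seq 'I_n) x, U x -> differentiable (foldr pd F s) x.

Definition smooth_map_on k (U : set 'rV[R]_n) (F : 'rV[R]_n -> 'rV[R]_k) :
  Prop := forall i, smooth_on U (fun x => F x 0 i).

Definition ip (g : 'M[R]_n) (v w : 'rV[R]_n) : R := (v *m g *m w^T) 0 0.

Definition grad G F x : 'rV[R]_n := (\row_i pd i F x) *m invmx (G x).

(* Gamma^k_{ij} of the Levi-Civita connection of G *)
Definition christoffel G (k i j : 'I_n) x : R :=
  2^-1 * \sum_l invmx (G x) k l *
    (pd i (fun z => G z j l) x + pd j (fun z => G z i l) x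
     - pd l (fun z => G z i j) x).

(* Components B^{I}_{J} of a tensor field with p upper and q lower indices *)
Definition tensor (p q : nat) : Type :=
  'rV[R]_n -> {ffun 'I_p -> 'I_n} -> {ffun 'I_q -> 'I_n} -> R.

Definition of_vector (V : 'rV[R]_n -> 'rV[R]_n) : tensor 1 0 :=
  fun x I _ => V x 0 (I 0).

Definition of_bilinear (B : 'rV[R]_n -> 'M[R]_n) : tensor 0 2 :=
  fun x _ J => B x (J 0) (J 1).

Definition upd p (I : {ffun 'I_p -> 'I_n}) (a : 'I_p) (l : 'I_n) :
  {ffun 'I_p -> 'I_n} := [ffun b => if b == a then l else I b].

(* Covariant derivative; the index of differentiation is the first lower one. *)
Definition cov G p q (B : tensor p q) : tensor p q.+1 := fun x I J =>
  let j := J ord0 in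
  let K := [ffun b : 'I_q => J (lift ord0 b)] in
  pd j (fun z => B z I K) x
  + \sum_(a < p) \sum_l christoffel G (I a) j l x * B x (upd I a l) K
  - \sum_(b < q) \sum_l christoffel G l j (K b) x * B x I (upd K b l).

Fixpoint icov G p q (B : tensor p q) (l : nat) : tensor p (l + q) :=
  if l is l'.+1 return tensor p (l + q) then cov G (@icov G p q B l') else B.

(* Pointwise norm of a tensor with respect to a Riemannian metric E *)
Definition tnorm (E : 'rV[R]_n -> 'M[R]_n) p q (B : tensor p q) x : R :=
  Num.sqrt (\sum_(I : {ffun 'I_p -> 'I_n}) \sum_(I' : {ffun 'I_p -> 'I_n})
    \sum_(J : {ffun 'I_q -> 'I_n}) \sum_(J' : {ffun 'I_q -> 'I_n})
      (\prod_(a < p) E x (I a) (I' a)) *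
      (\prod_(b < q) invmx (E x) (J b) (J' b)) * (B x I J * B x I' J')).

(* R^l_{kij} dx^k(Z) dx^i(X) dx^j(Y) d_l = Rm(X, Y) Z, with lower indices
   stored in the order k, i, j *)
Definition riemann G : tensor 1 3 := fun x I J =>
  let l := I 0 in
  let k := J (inord 0) in let i := J (inord 1) in let j := J (inord 2) in
  pd i (christoffel G l j k) x - pd j (christoffel G l i k) x
  + \sum_s (christoffel G l i s x * christoffel G s j k x
            - christoffel G l j s x * christoffel G s i k x).

(* div grad, the divergence being the trace of the covariant derivative *)
Definition laplacian G F x : R :=
  \sum_i cov G (of_vector (grad G F)) x [ffun => i] [ffun => i].

End TensorCalculus.

Arguments tensor : clear implicits.
Arguments icov {R n} G {p q} B l _ _ _.

Definition pullback {R : realType} {n k : nat} (F : 'rV[R]_n -> 'rV[R]_k)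
  (B : 'rV[R]_k -> 'M[R]_k) (w : 'rV[R]_n) : 'M[R]_n :=
  'J F w *m B (F w) *m ('J F w)^T.

Section Sphere.
Context {R : realType}.
Implicit Types (u : 'rV[R]_2) (y : 'rV[R]_(2 + 1)) (c : bool).

Definition on_sphere y : Prop := \sum_i y 0 i ^+ 2 = 1.

Definition sqnorm u : R := \sum_i u 0 i ^+ 2.

(* Inverse of the stereographic projection from the pole (0, 0, (-1)^c) *)
Definition stereo c u : 'rV[R]_(2 + 1) :=
  (1 + sqnorm u)^-1 *: row_mx (2 *: u) ((-1) ^+ c * (sqnorm u - 1))%:M.

Definition stereo_proj c y : 'rV[R]_2 :=
  (1 - (-1) ^+ c * rsubmx y 0 0)^-1 *: lsubmx y.

(* A chart around y, whose pole of projection lies in the other hemisphere *)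
Definition chart_at y : bool := 0 <= rsubmx y 0 0.

Definition sphere_metric c : 'rV[R]_2 -> 'M[R]_2 :=
  pullback (stereo c) (fun=> 1%:M).

(* Only the values of f on the sphere are relevant. *)
Definition smooth_on_sphere (f : 'rV[R]_(2 + 1) -> R) : Prop :=
  forall c, smooth_on setT (f \o stereo c).

End Sphere.

Section Schwarzschild.
Context {R : realType}.
Implicit Types (u : 'rV[R]_2) (q z : 'rV[R]_(2 + 2)) (w : 'rV[R]_(2 + 1)).
Implicit Types (c : bool).

(* Points (u, x, v) of a chart of the spacetime, or (u, x, tau) of a chart of
   the domain of Phi; points (u, x) of a chart of a level set *)
Definition pt (u : 'rV[R]_2) (x v : R) : 'rV[R]_(2 + 2) :=
  row_mx u (row_mx (x%:M : 'M[R]_1) (v%:M : 'M[R]_1)).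
Definition ang q : 'rV[R]_2 := lsubmx q.
Definition xco q : R := rsubmx q 0 0.
Definition last_co q : R := rsubmx q 0 1.
Definition lang w : 'rV[R]_2 := lsubmx w.
Definition lxco w : R := rsubmx w 0 0.

Variable m : R.

(* On the region 0 < xco q < (2 m)^-1 *)
Definition gSch c q : 'M[R]_(2 + 2) :=
  block_mx ((xco q) ^- 2 *: sphere_metric c (ang q)) 0
           0 (\matrix_(i < 2, j < 2)
                if (i == 0) && (j == 0) then 0
                else if (i == 1) && (j == 1) then - (1 - 2 * m * xco q)
                else (xco q) ^- 2).

(* The coordinate vector field d/dt of the coordinates (y, r, t), which is
   d/dv in the coordinates (y, x, v) *)
Definition d_t : 'rV[R]_(2 + 2) := pt 0 0 1.

Variable f : 'rV[R]_(2 + 1) -> R.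

Definition fchart c : 'rV[R]_2 -> R := f \o stereo c.

Definition gradf c : 'rV[R]_2 -> 'rV[R]_2 := grad (sphere_metric c) (fchart c).

Definition sqgradf c u : R := ip (sphere_metric c u) (gradf c u) (gradf c u).

Definition phi c (t : R) u : R := - 2^-1 * (t ^+ 2 + sqgradf c u).

Definition psi c (t : R) u : R :=
  2^-1 * (t ^+ 2 * laplacian (sphere_metric c) (fchart c) u
          + ip (sphere_metric c u) (grad (sphere_metric c) (sqgradf c) u)
               (gradf c u)).

Definition Pfun c u (x t : R) : R :=
  fchart c u + x * phi c t u + 2^-1 * x ^+ 2 * psi c t u.

Definition Phi c z : 'rV[R]_(2 + 2) :=
  pt (ang z) (xco z) (- Pfun c (ang z) (xco z) (last_co z)).

Variables tau1 tau2 x0 : R.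

Definition Dom : set 'rV[R]_(2 + 2) :=
  [set z | 0 < xco z < x0 /\ tau1 < last_co z < tau2].

Definition N c : set 'rV[R]_(2 + 2) := Phi c @` Dom.

Definition Phi_inv c : 'rV[R]_(2 + 2) -> 'rV[R]_(2 + 2) :=
  'pinv_(fun=> 0) Dom (Phi c).

Definition tau c q : R := last_co (Phi_inv c q).

Definition Phi_diffeo : Prop := forall c,
  [/\ {in Dom &, injective (Phi c)}, open (N c),
      smooth_map_on Dom (Phi c) & smooth_map_on (N c) (Phi_inv c)].

Definition grad_tau c q : 'rV[R]_(2 + 2) := grad (gSch c) (tau c) q.

Definition past_directed_timelike c q (V : 'rV[R]_(2 + 2)) : Prop :=
  ip (gSch c q) V V < 0 /\ 0 < ip (gSch c q) V d_t.

Definition lapse c q : R :=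
  (Num.sqrt (- ip (gSch c q) (grad_tau c q) (grad_tau c q)))^-1.

Definition Tvec c q : 'rV[R]_(2 + 2) := - lapse c q *: grad_tau c q.

Definition omega c q : 'rV[R]_(2 + 2) := Tvec c q *m gSch c q.

Definition gRef c q : 'M[R]_(2 + 2) :=
  gSch c q + 2 *: ((omega c q)^T *m omega c q).

Definition grad_vec (F : bool -> 'rV[R]_(2 + 2) -> R) c :
  tensor R (2 + 2) 1 0 := of_vector (grad (gSch c) (F c)).

(* ||| B |||_{k,N} *)
Definition CNnorm (p q k : nat) (B : bool -> tensor R (2 + 2) p q) : \bar R :=
  ereal_sup [set e | exists l c z,
    [/\ (l <= k)%N, N c z & e = (tnorm (gRef c) (icov (gSch c) (B c) l) z)%:E]].

Definition nablaT c : tensor R (2 + 2) 1 1 :=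
  cov (gSch c) (of_vector (Tvec c)).

Definition log_r (c : bool) q : R := ln (xco q)^-1.

(* {tau = t} is parametrized by (y, x) with 0 < x < x0. *)
Definition level c (t : R) w : 'rV[R]_(2 + 2) := Phi c (pt (lang w) (lxco w) t).

Definition on_level w : Prop := 0 < lxco w < x0.

Definition hmet c (t : R) w : 'M[R]_(2 + 1) :=
  pullback (level c t) (gSch c) w.

(* The bilinear form (X, Y) |-> <nabla_X T, Y> on the spacetime *)
Definition nablaT_form c q : 'M[R]_(2 + 2) :=
  \matrix_(i, j) \sum_k nablaT c q [ffun => k] [ffun => i] * gSch c q k j.

Definition Amat c (t : R) w : 'M[R]_(2 + 1) :=
  pullback (level c t) (nablaT_form c) w.

Definition sff c (t : R) : tensor R (2 + 1) 0 2 := of_bilinear (Amat c t).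

Definition Hmean c (t : R) w : R :=
  3^-1 * \tr (invmx (hmet c t w) *m Amat c t w).

(* Intrinsic distance on {tau = t}.  A curve s |-> (y s, x s) is only
   constrained for s in [0, 1]; its speed is computed in a chart around y s.
   C^1 and piecewise C^1 curves give the same infimum of lengths. *)
Definition C1_curve (y : R -> 'rV[R]_(2 + 1)) (x : R -> R) : Prop :=
  [/\ forall s, derivable y s 1, continuous (derive1 y),
      forall s, derivable x s 1, continuous (derive1 x) &
      forall s, 0 <= s <= 1 -> on_sphere (y s) /\ 0 < x s < x0].

Definition speed (t : R) (y : R -> 'rV[R]_(2 + 1)) (x : R -> R) (s : R) : R :=
  let c := chart_at (y s) in
  let w r : 'rV[R]_(2 + 1) := row_mx (stereo_proj c (y r)) ((x r)%:M : 'M[R]_1) in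
  Num.sqrt (ip (hmet c t (w s)) (derive1 w s) (derive1 w s)).

Definition curve_length (t : R) (y : R -> 'rV[R]_(2 + 1)) (x : R -> R) :
  \bar R := (\int[lebesgue_measure]_(s in `[0%R, 1%R]) (speed t y x s)%:E)%E.

Definition level_dist (t : R) (p p' : 'rV[R]_(2 + 1) * R) : \bar R :=
  ereal_inf [set L | exists y x,
    [/\ C1_curve y x, (y 0, x 0) = p, (y 1, x 1) = p'
      & L = curve_length t y x]].

End Schwarzschild.

(* Main.v *)
Require Import Defs.
From HB Require Import structures.
From mathcomp Require Import all_boot all_order all_algebra.
From mathcomp Require Import all_classical all_reals all_analysis.
From mathcomp Require Import ring lra.
Import Order.TTheory GRing.Theory Num.Theory.
Import numFieldNormedType.Exports.

Set Implicit Arguments.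
Unset Strict Implicit.
Unset Printing Implicit Defensive.

Local Open Scope classical_set_scope.
Local Open Scope ring_scope.

(** Why the proposition holds.  Near infinity, [x -> 0], the Schwarzschild metric
    is [x^-2] times a metric that is smooth up to [x = 0].  Instead of
    rescaling the metric, everything is expressed in the vector fields
    [e_a = x D_a] ([D_a] the gradient on the unit sphere of the ambient coordinate
    [y_a]) and [x d/dx], [x d/dv].  They are linearly dependent, as three fields
    span the tangent planes of the sphere, but they are global, and one has
    [\sum_A e_A (x) th^A = id] for the covectors [th^a = d y_a / x], [dx / x],
    [dv / x].  A function is called admissible when all its iterated derivatives
    along the fields [e_A] are bounded.  In this frame the Gram matrices of the
    metric and of its inverse are admissible, and the brackets [[e_A, e_B]] are
    combinations of the frame with admissible coefficients.  The Koszul formula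
    then makes the connection coefficients admissible ([adm_conn]), so that
    covariant differentiation preserves tensors with admissible components
    ([adm_icov]), and so does the curvature tensor ([adm_riemann]).  As the norm of a
    tensor with respect to a Riemannian metric is computed by the Gram matrices of
    that metric ([tnorm_bdd]), the claims (i) to (v) reduce to the admissibility
    of finitely many explicit functions.

    The relation [v = - P] is affine in [tau^2], hence [S = tau^2 / 2] is the
    explicit quotient [n / (x L)] with [L = 1 - x Lap f / 2] and
    [n = v + f - x |grad f|^2 / 2 + x^2 <grad |grad f|^2, grad f> / 4].  Each
    derivative [e_A n] is divisible by [x], and so [e_A S] is a polynomial
    expression in admissible functions and [1 / L] ([fd_Sf], [adm_time_diff]).
    The coefficients of [P] are exactly the ones for which
    [w = - <dS, dS> = 2 S + x^2 r] with [r] admissible ([time_norm_expand]).  For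
    small [x0] this keeps [w] away from 0; then [alpha^2 = 2 S / w] and the unit
    normal [T = - w^(-1/2) grad S] have admissible components, and so has the
    reference metric, whose inverse is [g^-1 + 2 T (x) T] ([gRef_inverse]).

    On a level set, with the coordinates [(y, x)], the analogous frame is the
    tangential part of the one of the spacetime: it is pushed forward to
    [e_A - (e_A S / e_v S) e_v] ([push_frame]), where [1 / e_v S = L].  Hence
    restrictions of admissible functions are admissible ([adm_level]), the induced
    metric and the second fundamental form too, and (iv) follows as above.

    For the mean curvature, [3 H] is the divergence of [T] because
    [<nabla_T T, T> = 0] ([trace_nablaT]), and
    [div T = - w^(-1/2) Box S + w^(-3/2) <dw, dS> / 2].  The expansions
    [Box S = - 4 + O(x^2)] ([box_expand]) and [<dw, dS> = - 2 w + O(x^2)]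
    ([inner_expand]) yield [H = w^(-1/2) + O(x^2) = 1 / tau + O(x^2)].  Finally, a
    great circle combined with an affine change of [x] joins two points with speed
    at most [C / x], the components of its velocity in the coframe being
    [y_a' / x] and [x' / x]; so the distance to a point at height [x] is at most
    [C / x], and its product with [|H - 1 / tau| <= C x^2] tends to 0. *)

(** * Partial derivatives *)

Lemma near_differentiable {R : realType} {V W : normedModType R}
    (f g : V -> W) (x : V) :
  (\near x, f x = g x) -> differentiable f x -> differentiable g x.
Proof.
move=> fg df; have [dfc /eqaddoP df0] := (diff_locallyP _ _).1 df.
have h : g \o shift x = cst (g x) + 'd f x +o_ 0 id.
  apply/eqaddoP => e e0; have := df0 _ e0.
  have : \forall y \near 0, f (y + x) = g (y + x).
    by have := fg; rewrite (near_shift 0) /= subr0.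
  have fgx := nbhs_singleton fg.
  apply: filterS2 => y fgy.
  by rewrite !fctE /= fgy fgx.
apply/diff_locallyP; have -> := diff_unique dfc h; split => //.
Qed.

Section PartialDerivatives.
Context {R : realType} {n : nat}.
Implicit Types (f g : 'rV[R]_n -> R) (x : 'rV[R]_n) (i : 'I_n).

(** Derivatives only see germs; most formulas below hold on an open set only. *)
Lemma eq_near_pd i f g x : (\near x, f x = g x) -> pd i f x = pd i g x.
Proof. exact: near_eq_derive. Qed.

Lemma pd_cst i (a : R) x : pd i (fun=> a) x = 0.
Proof. exact: derive_cst. Qed.

Lemma pdD i f g x : differentiable f x -> differentiable g x ->
  pd i (fun z => f z + g z) x = pd i f x + pd i g x.
Proof. by move=> df dg; apply: deriveD; apply: diff_derivable. Qed.

Lemma pdN i f x : differentiable f x -> pd i (fun z => - f z) x = - pd i f x.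
Proof. by move=> df; apply: deriveN; apply: diff_derivable. Qed.

Lemma pdB i f g x : differentiable f x -> differentiable g x ->
  pd i (fun z => f z - g z) x = pd i f x - pd i g x.
Proof. by move=> df dg; apply: deriveB; apply: diff_derivable. Qed.

Lemma pdM i f g x : differentiable f x -> differentiable g x ->
  pd i (fun z => f z * g z) x = pd i f x * g x + f x * pd i g x.
Proof.
move=> df dg; rewrite /pd deriveM; try exact: diff_derivable.
by rewrite addrC /GRing.scale /= (mulrC (g x)).
Qed.

Lemma pdV i f x : f x != 0 -> differentiable f x ->
  pd i (fun z => (f z)^-1) x = - (f x) ^- 2 * pd i f x.
Proof. by move=> f0 df; apply: deriveV => //; apply: diff_derivable. Qed.

Lemma differentiable_cst' (a : R) x : differentiable (fun _ : 'rV[R]_n => a) x.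
Proof. exact: differentiable_cst. Qed.

Lemma differentiable_add f g x : differentiable f x -> differentiable g x ->
  differentiable (fun z => f z + g z) x.
Proof. exact: differentiableD. Qed.

Lemma differentiable_opp f x : differentiable f x ->
  differentiable (fun z => - f z) x.
Proof. exact: differentiableN. Qed.

Lemma differentiable_mul f g x : differentiable f x -> differentiable g x ->
  differentiable (fun z => f z * g z) x.
Proof. exact: differentiableM. Qed.

Lemma differentiable_inv f x : f x != 0 -> differentiable f x ->
  differentiable (fun z => (f z)^-1) x.
Proof. by move=> f0 df; apply: differentiableV. Qed.

Lemma differentiable_bigsum (I : Type) (r : seq I) (P : pred I)
    (F : I -> 'rV[R]_n -> R) x :
  (forall j, differentiable (F j) x) ->
  differentiable (fun z => \sum_(j <- r | P j) F j z) x.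
Proof.
move=> dF; elim: r => [|a r IH].
  by under eq_fun do rewrite big_nil; exact: differentiable_cst'.
under eq_fun do rewrite big_cons; case: (P a) => //.
exact: differentiable_add.
Qed.

Lemma differentiable_bigprod (I : Type) (r : seq I) (P : pred I)
    (F : I -> 'rV[R]_n -> R) x :
  (forall j, differentiable (F j) x) ->
  differentiable (fun z => \prod_(j <- r | P j) F j z) x.
Proof.
move=> dF; elim: r => [|a r IH].
  by under eq_fun do rewrite big_nil; exact: differentiable_cst'.
under eq_fun do rewrite big_cons; case: (P a) => //.
exact: differentiable_mul.
Qed.

Lemma pd_bigsum i (I : Type) (r : seq I) (P : pred I)
    (F : I -> 'rV[R]_n -> R) x :
  (forall j, differentiable (F j) x) ->
  pd i (fun z => \sum_(j <- r | P j) F j z) x = \sum_(j <- r | P j) pd i (F j) x.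
Proof.
move=> dF; elim: r => [|a r IH].
  by under eq_fun do rewrite big_nil; rewrite big_nil; exact: pd_cst.
under eq_fun do rewrite big_cons; rewrite big_cons; case: (P a) => //.
by rewrite pdD ?IH //; exact: differentiable_bigsum.
Qed.

Lemma pd_coord i j x : pd i (fun z => z 0 j) x = (j == i)%:R.
Proof.
rewrite /pd deriveE; last exact: differentiable_coord.
have @f : {linear 'rV[R]_n -> R}.
  by exists (fun N : 'rV[R]_n => N 0 j); do 2![eexists]; do ?[constructor];
     rewrite ?mxE// => ? *; rewrite ?mxE//; move=> ?; rewrite !mxE.
rewrite (_ : (fun _ => _) = f) // diff_lin; last exact: coord_continuous.
by rewrite /= mxE.
Qed.

Lemma differentiable_rV {V : normedModType R} (F : V -> 'rV[R]_n) (v : V) :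
  (forall j, differentiable (fun z => F z 0 j) v) -> differentiable F v.
Proof.
move=> dF; have -> : F = \sum_(j < n) (fun z => F z 0 j *: delta_mx 0 j).
  apply/funext => z; rewrite fct_sumE; exact: row_sum_delta.
apply: differentiable_sum => j; exact: differentiableZl.
Qed.

Lemma differentiable_diff_sum f x : differentiable f x -> forall v,
  'd f x v = \sum_i v 0 i * pd i f x.
Proof.
move=> df v; rewrite {1}(row_sum_delta v) linear_sum.
by apply: eq_bigr => i _; rewrite linearZ /= /pd deriveE.
Qed.

End PartialDerivatives.

Section ChainRule.
Context {R : realType} {n k : nat}.
Implicit Types (F : 'rV[R]_n -> 'rV[R]_k).

Lemma derive_rV {V : normedModType R} (F : V -> 'rV[R]_k) (x v : V) j :
  differentiable F x -> 'D_v (fun z => F z 0 j) x = ('D_v F x) 0 j.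
Proof.
by move=> dF; rewrite derive_mx ?mxE //; exact: diff_derivable.
Qed.

Lemma jacobianE F x i j : differentiable F x ->
  ('J F x) i j = pd i (fun z => F z 0 j) x.
Proof.
move=> dF; rewrite /pd derive_rV // deriveEjacobian //.
by rewrite -rowE [RHS]mxE.
Qed.

Lemma derive_comp_rV {V : normedModType R} (f : 'rV[R]_k -> R)
    (F : V -> 'rV[R]_k) (x v : V) :
  differentiable F x -> differentiable f (F x) ->
  'D_v (fun z => f (F z)) x =
  \sum_j 'D_v (fun z => F z 0 j) x * pd j f (F x).
Proof.
move=> dF df; have dc := differentiable_comp dF df.
rewrite (deriveE _ dc) diff_comp // [LHS](differentiable_diff_sum df).
by apply: eq_bigr => j _; rewrite derive_rV // deriveE.
Qed.

Lemma pd_comp (f : 'rV[R]_k -> R) F x i :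
  differentiable F x -> differentiable f (F x) ->
  pd i (fun z => f (F z)) x = \sum_j pd i (fun z => F z 0 j) x * pd j f (F x).
Proof. exact: derive_comp_rV. Qed.

Lemma pd_comp1 (h : R -> R) (f : 'rV[R]_n -> R) x i :
  differentiable f x -> derivable h (f x) 1 ->
  pd i (fun z => h (f z)) x = derive1 h (f x) * pd i f x.
Proof.
move=> df /derivable1_diffP dh; have dc := differentiable_comp df dh.
rewrite /pd (deriveE _ dc) diff_comp // derive1E' // (deriveE _ df) /=.
set y := 'd f x _; have -> : y = y *: 1 by rewrite /GRing.scale /= mulr1.
by rewrite [LHS]linearZ /= /GRing.scale /= mulrC mulr1.
Qed.

End ChainRule.

(** * Smooth functions *)

Section SmoothClosure.
Context {R : realType} {n : nat}.
Implicit Types (U : set 'rV[R]_n) (F G : 'rV[R]_n -> R).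

Lemma smooth_on_pd U F i : smooth_on U F -> smooth_on U (pd i F).
Proof. by move=> sF s x Ux; have := sF (rcons s i) x Ux; rewrite foldr_rcons. Qed.

Lemma smooth_on_differentiable U F x : smooth_on U F -> U x -> differentiable F x.
Proof. by move=> sF Ux; exact: (sF [::] x Ux). Qed.

Lemma smooth_onW U V F : V `<=` U -> smooth_on U F -> smooth_on V F.
Proof. by move=> VU sF s x /VU; exact: sF. Qed.

Lemma open_near_eq U F G x : open U -> U x -> (forall y, U y -> F y = G y) ->
  \near x, F x = G x.
Proof.
by move=> oU Ux FG; have := open_nbhs_nbhs (conj oU Ux); exact: filterS.
Qed.

Lemma eq_open_pd U F G i x : open U -> (forall y, U y -> F y = G y) -> U x ->
  pd i F x = pd i G x.
Proof. by move=> oU FG Ux; apply: eq_near_pd; exact: (open_near_eq oU). Qed.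

Lemma eq_open_differentiable U F G x :
  open U -> (forall y, U y -> F y = G y) -> U x ->
  differentiable F x -> differentiable G x.
Proof. by move=> oU FG Ux; apply: near_differentiable; exact: (open_near_eq oU). Qed.

(** Coinduction: a class of functions that is stable under partial derivatives
    consists of smooth functions as soon as its members are differentiable. *)
Lemma smooth_on_class U (C : ('rV[R]_n -> R) -> Prop) : open U ->
  (forall F x, C F -> U x -> differentiable F x) ->
  (forall F i, C F -> exists2 G, C G & forall x, U x -> pd i F x = G x) ->
  forall F, C F -> smooth_on U F.
Proof.
move=> oU dC pC F CF s.
suff [G CG FG] : exists2 G, C G & forall x, U x -> foldr pd F s x = G x.
  by move=> x Ux; apply: (eq_open_differentiable oU (fun y Uy => esym (FG y Uy))) => //; exact: dC.
elim: s => [|i s [G CG FG]]; first by exists F.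
have [H CH GH] := pC G i CG; exists H => // x Ux.
by rewrite -GH //=; exact: (eq_open_pd i oU FG).
Qed.

Lemma derive1_sqrt (x : R) : 0 < x ->
  derivable Num.sqrt x 1 /\ derive1 Num.sqrt x = (2 * Num.sqrt x)^-1.
Proof.
move=> x0; have h := is_derive1_sqrt x0; split; first exact: ex_derive.
by rewrite derive1E derive_val.
Qed.

Lemma pd_sqrt F x i : differentiable F x -> 0 < F x ->
  pd i (fun z => Num.sqrt (F z)) x = (2 * Num.sqrt (F x))^-1 * pd i F x.
Proof. by move=> dF F0; have [d1 <-] := derive1_sqrt F0; rewrite pd_comp1. Qed.

Lemma differentiable_sqrt F x : differentiable F x -> 0 < F x ->
  differentiable (fun z => Num.sqrt (F z)) x.
Proof.
move=> dF F0; have [/derivable1_diffP d1 _] := derive1_sqrt F0.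
exact: (differentiable_comp dF d1).
Qed.

End SmoothClosure.

Section SmoothExpressions.
Context {R : realType} {n : nat}.
Implicit Types (U : set 'rV[R]_n) (F G : 'rV[R]_n -> R).

(** Expressions built from smooth functions.  The class is closed under partial
    derivatives up to equality on [U], so that [smooth_on_class] applies to it;
    this avoids formulas for iterated derivatives of quotients or compositions. *)
Inductive smooth_expr U : ('rV[R]_n -> R) -> Prop :=
| SmoothBase F : smooth_on U F -> smooth_expr U F
| SmoothCst a : smooth_expr U (fun=> a)
| SmoothAdd F G : smooth_expr U F -> smooth_expr U G ->
    smooth_expr U (fun z => F z + G z)
| SmoothMul F G : smooth_expr U F -> smooth_expr U G ->
    smooth_expr U (fun z => F z * G z)
| SmoothInv F : smooth_expr U F -> (forall x, U x -> F x != 0) ->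
    smooth_expr U (fun z => (F z)^-1)
| SmoothSqrt F : smooth_expr U F -> (forall x, U x -> 0 < F x) ->
    smooth_expr U (fun z => Num.sqrt (F z))
| SmoothComp k (V : set 'rV[R]_k) (F : 'rV[R]_k -> R) (G : 'rV[R]_n -> 'rV[R]_k) :
    smooth_on V F -> (forall j, smooth_expr U (fun z => G z 0 j)) ->
    (forall x, U x -> V (G x)) -> smooth_expr U (fun z => F (G z)).

Lemma smooth_expr_sum U (I : Type) (r : seq I) (F : I -> 'rV[R]_n -> R) :
  (forall i, smooth_expr U (F i)) ->
  smooth_expr U (fun z => \sum_(i <- r) F i z).
Proof.
move=> sF; elim: r => [|i r IH].
  by under eq_fun do rewrite big_nil; exact: SmoothCst.
by under eq_fun do rewrite big_cons; exact: SmoothAdd.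
Qed.

Lemma SmoothOpp U F : smooth_expr U F -> smooth_expr U (fun z => - F z).
Proof.
move=> sF; rewrite (_ : (fun z => - F z) = (fun z => -1 * F z)).
  by apply: SmoothMul => //; exact: SmoothCst.
by apply/funext => z; rewrite mulN1r.
Qed.

Lemma SmoothExp U F k : smooth_expr U F -> smooth_expr U (fun z => F z ^+ k).
Proof.
move=> sF; elim: k => [|k IH].
  by under eq_fun do rewrite expr0; exact: SmoothCst.
by under eq_fun do rewrite exprS; exact: SmoothMul.
Qed.

Lemma smooth_expr_differentiable U F x :
  smooth_expr U F -> U x -> differentiable F x.
Proof.
move=> + Ux; elim=> {F}.
- by move=> F sF; exact: (smooth_on_differentiable sF Ux).
- by move=> a; exact: differentiable_cst'.
- by move=> F G _ dF _ dG; exact: differentiable_add.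
- by move=> F G _ dF _ dG; exact: differentiable_mul.
- by move=> F _ dF F0; apply: differentiable_inv => //; exact: F0.
- by move=> F _ dF F0; apply: differentiable_sqrt => //; exact: F0.
- move=> k V F G sF _ dG UV.
  apply: (@differentiable_comp _ _ _ _ G F); first exact: differentiable_rV.
  exact: (smooth_on_differentiable sF (UV _ Ux)).
Qed.

(** The chain rule keeps the outer function of a composition among the smooth
    functions, and the derivative of a root or an inverse is again an expression. *)
Lemma smooth_expr_pd U F i : smooth_expr U F ->
  exists2 G, smooth_expr U G & forall x, U x -> pd i F x = G x.
Proof.
elim=> {F}.
- by move=> F sF; exists (pd i F) => //; apply: SmoothBase; exact: smooth_on_pd.
- by move=> a; exists (fun=> 0) => [|x _]; [exact: SmoothCst|exact: pd_cst].
- move=> F G sF [F' sF' FF'] sG [G' sG' GG'].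
  exists (fun z => F' z + G' z); first exact: SmoothAdd.
  move=> x Ux; rewrite -FF' // -GG' // pdD //; exact: (@smooth_expr_differentiable U).
- move=> F G sF [F' sF' FF'] sG [G' sG' GG'].
  exists (fun z => F' z * G z + F z * G' z).
    by apply: SmoothAdd; exact: SmoothMul.
  move=> x Ux; rewrite -FF' // -GG' // pdM //; exact: (@smooth_expr_differentiable U).
- move=> F sF [F' sF' FF'] F0.
  exists (fun z => - 1 * ((F z)^-1 * ((F z)^-1 * F' z))).
    apply: SmoothMul; first exact: SmoothCst.
    by apply: SmoothMul; [exact: SmoothInv|apply: SmoothMul => //; exact: SmoothInv].
  move=> x Ux; rewrite pdV ?FF' //; [|exact: F0|exact: (@smooth_expr_differentiable U)].
  by rewrite mulN1r mulNr expr2 invfM mulrA.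
- move=> F sF [F' sF' FF'] F0.
  exists (fun z => (2 * Num.sqrt (F z))^-1 * F' z).
    apply: SmoothMul => //; apply: (@SmoothInv _ (fun z => 2 * Num.sqrt (F z))).
      by apply: SmoothMul; [exact: SmoothCst|exact: SmoothSqrt].
    by move=> x Ux; rewrite mulf_neq0 ?pnatr_eq0 // gt_eqF // sqrtr_gt0 F0.
  by move=> x Ux; rewrite pd_sqrt ?FF' //; [exact: (@smooth_expr_differentiable U)|exact: F0].
- move=> k V F G sF sG IH UV.
  pose G' j := sval (cid2 (IH j)).
  have sG' j : smooth_expr U (G' j) by rewrite /G'; case: cid2.
  have GG' j x : U x -> pd i (fun z => G z 0 j) x = G' j x.
    by rewrite /G'; case: cid2 => ? /= _; exact.
  exists (fun z => \sum_j G' j z * pd j F (G z)).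
    apply: smooth_expr_sum => j; apply: SmoothMul => //.
    by apply: (@SmoothComp _ _ V (pd j F)) => //; exact: smooth_on_pd.
  move=> x Ux; rewrite pd_comp.
  + by apply: eq_bigr => j _; rewrite GG'.
  + by apply: differentiable_rV => j; exact: (@smooth_expr_differentiable U).
  + exact: (smooth_on_differentiable sF (UV _ Ux)).
Qed.

Lemma smooth_expr_on U F : open U -> smooth_expr U F -> smooth_on U F.
Proof.
move=> oU; apply: smooth_on_class => // {}F; first exact: smooth_expr_differentiable.
by move=> i sF; exact: smooth_expr_pd.
Qed.

Lemma smooth_on_ext U F G : open U -> (forall x, U x -> F x = G x) ->
  smooth_on U F -> smooth_on U G.
Proof.
move=> oU FG sF s.
have e : forall x, U x -> foldr pd F s x = foldr pd G s x.
  elim: s => [//|i s IH] x Ux /=; exact: (eq_open_pd i oU).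
by move=> x Ux; apply: (eq_open_differentiable oU e Ux); exact: sF.
Qed.

Lemma smooth_coord U j : smooth_on U (fun z => z 0 j).
Proof.
move=> s x _; case: s => [|i s]; first exact: differentiable_coord.
suff [a ->] : exists a, foldr pd (fun z => z 0 j) (i :: s) = (fun=> a :> R).
  exact: differentiable_cst'.
elim: s i => [|k s IH] i /=.
  by exists (j == i)%:R; apply/funext => z; exact: pd_coord.
by have [a /= ->] := IH k; exists 0; apply/funext => z; exact: pd_cst.
Qed.

Lemma SmoothCoord U j : smooth_expr U (fun z => z 0 j).
Proof. by apply: SmoothBase; exact: smooth_coord. Qed.

End SmoothExpressions.

Ltac smooths := repeat first
  [ assumption | exact: SmoothCst | exact: SmoothCoord | apply: SmoothAdd
  | apply: SmoothOpp | apply: SmoothMul | apply: SmoothExp ].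

(** * Functions with bounded frame derivatives of all orders *)

Section AdmissibleFamilies.
Context {R : realType} {n : nat} {M : finType} {L : Type}.
Variables (U : L -> set 'rV[R]_n) (e : L -> M -> 'rV[R]_n -> 'rV[R]_n).
Hypothesis oU : forall l, open (U l).
Local Notation fam := (L -> 'rV[R]_n -> R).
Implicit Types (F G : fam) (A : M).

(** Derivative along the frame field [A].  The index [l] ranges over the charts,
    together with the time for families of level sets, so that bounds are uniform
    in it. *)
Definition frame_diff A F : fam := fun l x => \sum_i e l A x 0 i * pd i (F l) x.

Definition eqU F G := forall l x, U l x -> F l x = G l x.

Definition diffU F := forall l x, U l x -> differentiable (F l) x.

Definition bdd F := exists C, forall l x, U l x -> `|F l x| <= C.

(** All iterated frame derivatives are bounded, uniformly over the family. *)
Definition admissible F := forall s, diffU (foldr frame_diff F s) /\ bdd (foldr frame_diff F s).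

Lemma fd_ext A F G : eqU F G -> eqU (frame_diff A F) (frame_diff A G).
Proof.
move=> FG l x Ux; apply: eq_bigr => i _; congr (_ * _).
by apply: (eq_open_pd i (@oU l) _ Ux) => y; exact: FG.
Qed.

Lemma diffU_ext F G : eqU F G -> diffU F -> diffU G.
Proof.
move=> FG dF l x Ux; apply: (eq_open_differentiable (@oU l) _ Ux (dF l x Ux)).
by move=> y; exact: FG.
Qed.

Lemma bdd_ext F G : eqU F G -> bdd F -> bdd G.
Proof. by move=> FG [C FC]; exists C => l x Ux; rewrite -FG //; exact: FC. Qed.

Lemma fd_cst A a l x : frame_diff A (fun _ _ => a) l x = 0.
Proof. by rewrite /frame_diff big1 // => i _; rewrite pd_cst mulr0. Qed.

Lemma fdD A F G l x : differentiable (F l) x -> differentiable (G l) x ->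
  frame_diff A (fun l z => F l z + G l z) l x = frame_diff A F l x + frame_diff A G l x.
Proof.
move=> dF dG; rewrite /frame_diff -big_split; apply: eq_bigr => i _ /=.
by rewrite pdD // mulrDr.
Qed.

Lemma fdM A F G l x : differentiable (F l) x -> differentiable (G l) x ->
  frame_diff A (fun l z => F l z * G l z) l x = frame_diff A F l x * G l x + F l x * frame_diff A G l x.
Proof.
move=> dF dG; rewrite /frame_diff mulr_suml mulr_sumr -big_split; apply: eq_bigr => i _ /=.
by rewrite pdM // mulrDr mulrA; congr (_ + _); rewrite mulrCA.
Qed.

Lemma fdV A F l x : F l x != 0 -> differentiable (F l) x ->
  frame_diff A (fun l z => (F l z)^-1) l x = - (frame_diff A F l x) * ((F l x)^-1 * (F l x)^-1).
Proof.
move=> F0 dF; rewrite /frame_diff -sumrN mulr_suml; apply: eq_bigr => i _ /=.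
by rewrite pdV // expr2 invfM; ring.
Qed.

Lemma fd_sqrt A F l x : 0 < F l x -> differentiable (F l) x ->
  frame_diff A (fun l z => Num.sqrt (F l z)) l x =
  2^-1 * (frame_diff A F l x * (Num.sqrt (F l x))^-1).
Proof.
move=> F0 dF; rewrite /frame_diff mulr_suml mulr_sumr; apply: eq_bigr => i _ /=.
by rewrite pd_sqrt // invfM; ring.
Qed.

Lemma fd_sum A (I : Type) (r : seq I) (F : I -> fam) l x :
  (forall i, differentiable (F i l) x) ->
  frame_diff A (fun l z => \sum_(i <- r) F i l z) l x = \sum_(i <- r) frame_diff A (F i) l x.
Proof.
move=> dF; rewrite /frame_diff exchange_big; apply: eq_bigr => i _ /=.
by rewrite pd_bigsum // mulr_sumr.
Qed.

Lemma bdd_cst a : bdd (fun _ _ => a).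
Proof. by exists `|a|. Qed.

Lemma bdd_add F G : bdd F -> bdd G -> bdd (fun l z => F l z + G l z).
Proof.
move=> [C FC] [D GD]; exists (C + D) => l x Ux.
by rewrite (le_trans (ler_normD _ _)) // lerD // ?FC ?GD.
Qed.

Lemma bdd_mul F G : bdd F -> bdd G -> bdd (fun l z => F l z * G l z).
Proof.
move=> [C FC] [D GD]; exists (C * D) => l x Ux.
by rewrite normrM ler_pM // ?FC ?GD.
Qed.

Lemma bdd_sum (I : Type) (r : seq I) (F : I -> fam) :
  (forall i, bdd (F i)) -> bdd (fun l z => \sum_(i <- r) F i l z).
Proof.
move=> bF; elim: r => [|i r [C IH]].
  by exists 0 => l x _; rewrite big_nil normr0.
have [D hD] := bF i; exists (D + C) => l x Ux; rewrite big_cons.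
by rewrite (le_trans (ler_normD _ _)) // lerD // ?IH ?hD.
Qed.

Lemma bdd_prod (I : Type) (r : seq I) (F : I -> fam) :
  (forall i, bdd (F i)) -> bdd (fun l z => \prod_(i <- r) F i l z).
Proof.
move=> bF; elim: r => [|i r [C IH]].
  by exists 1 => l x _; rewrite big_nil normr1.
have [D hD] := bF i; exists (D * C) => l x Ux; rewrite big_cons.
by rewrite normrM ler_pM // ?IH ?hD.
Qed.

Lemma adm_diff F : admissible F -> diffU F.
Proof. by move=> aF; have [] := aF [::]. Qed.

Lemma adm_bdd F : admissible F -> bdd F.
Proof. by move=> aF; have [] := aF [::]. Qed.

Lemma adm_fd A F : admissible F -> admissible (frame_diff A F).
Proof. by move=> aF s; have := aF (rcons s A); rewrite foldr_rcons. Qed.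

(** The analogue of [smooth_on_class]: a class of bounded differentiable
    functions that is stable under frame derivatives is admissible. *)
Lemma adm_class (C : fam -> Prop) :
  (forall F, C F -> diffU F) -> (forall F, C F -> bdd F) ->
  (forall F A, C F -> exists2 G, C G & eqU (frame_diff A F) G) ->
  forall F, C F -> admissible F.
Proof.
move=> dC bC fC F CF s.
suff [G CG FG] : exists2 G, C G & eqU (foldr frame_diff F s) G.
  have GF : eqU G (foldr frame_diff F s) by move=> l x Ux; rewrite FG.
  by split; [exact: diffU_ext (dC _ CG)|exact: bdd_ext (bC _ CG)].
elim: s => [|A s [G CG FG]]; first by exists F.
have [H CH GH] := fC G A CG; exists H => // l x Ux.
by rewrite /= (fd_ext A FG) // GH.
Qed.

Lemma adm_ext F G : eqU F G -> admissible F -> admissible G.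
Proof.
move=> FG aF; apply: (@adm_class (fun G => exists2 F, admissible F & eqU F G)).
- by move=> {aF FG}G [{}F aF FG]; exact: diffU_ext FG (adm_diff aF).
- by move=> {aF FG}G [{}F aF FG]; exact: bdd_ext FG (adm_bdd aF).
- move=> {aF FG}G A [{}F aF FG]; exists (frame_diff A G) => //.
  by exists (frame_diff A F); [exact: adm_fd|exact: fd_ext].
- by exists F.
Qed.

(** The algebra generated by [B] over the admissible functions. *)
Inductive generated (B : fam -> Prop) : fam -> Prop :=
| GenBase F : B F -> generated B F
| GenAdm F : admissible F -> generated B F
| GenCst a : generated B (fun _ _ => a)
| GenAdd F G : generated B F -> generated B G -> generated B (fun l z => F l z + G l z)
| GenMul F G : generated B F -> generated B G -> generated B (fun l z => F l z * G l z).

(** By the product rule it suffices that the frame derivatives of the generators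
    stay in the algebra that they generate. *)
Lemma generated_adm (B : fam -> Prop) :
  (forall F, B F -> diffU F) -> (forall F, B F -> bdd F) ->
  (forall F A, B F -> exists2 G, generated B G & eqU (frame_diff A F) G) ->
  forall F, generated B F -> admissible F.
Proof.
move=> dB bB fB.
have dG F : generated B F -> diffU F.
  elim=> {F}; [exact: dB|by move=> F /adm_diff|by move=> a l x _; exact: differentiable_cst'| |].
    by move=> F G _ dF _ dG l x Ux; apply: differentiable_add; [exact: dF|exact: dG].
  by move=> F G _ dF _ dG l x Ux; apply: differentiable_mul; [exact: dF|exact: dG].
apply: adm_class => //.
  move=> F; elim=> {F}; [exact: bB|by move=> F /adm_bdd|exact: bdd_cst| |].
    by move=> F G _ bF _ bG; exact: bdd_add.
  by move=> F G _ bF _ bG; exact: bdd_mul.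
move=> F A; elim=> {F}.
- by move=> F /fB; exact.
- by move=> F aF; exists (frame_diff A F) => //; apply: GenAdm; exact: adm_fd.
- by move=> a; exists (fun _ _ => 0) => [|l x _]; [exact: GenCst|exact: fd_cst].
- move=> F G gF [F' gF' FF'] gG [G' gG' GG'].
  exists (fun l z => F' l z + G' l z); first exact: GenAdd.
  by move=> l x Ux; rewrite -FF' // -GG' // fdD //; [exact: dG gF _ _ Ux|exact: dG gG _ _ Ux].
- move=> F G gF [F' gF' FF'] gG [G' gG' GG'].
  exists (fun l z => F' l z * G l z + F l z * G' l z).
    by apply: GenAdd; exact: GenMul.
  by move=> l x Ux; rewrite -FF' // -GG' // fdM //; [exact: dG gF _ _ Ux|exact: dG gG _ _ Ux].
Qed.

Lemma generated0_adm F : generated (fun=> False) F -> admissible F.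
Proof. by apply: generated_adm. Qed.

Lemma adm_cst a : admissible (fun _ _ => a).
Proof. by apply: generated0_adm; exact: GenCst. Qed.

Lemma adm_add F G : admissible F -> admissible G -> admissible (fun l z => F l z + G l z).
Proof. by move=> aF aG; apply: generated0_adm; apply: GenAdd; exact: GenAdm. Qed.

Lemma adm_mul F G : admissible F -> admissible G -> admissible (fun l z => F l z * G l z).
Proof. by move=> aF aG; apply: generated0_adm; apply: GenMul; exact: GenAdm. Qed.

Lemma adm_opp F : admissible F -> admissible (fun l z => - F l z).
Proof.
move=> aF; apply: (@adm_ext (fun l z => -1 * F l z)).
  by move=> l x _; rewrite mulN1r.
by apply: adm_mul => //; exact: adm_cst.
Qed.

Lemma adm_sub F G : admissible F -> admissible G -> admissible (fun l z => F l z - G l z).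
Proof. by move=> aF aG; apply: adm_add => //; exact: adm_opp. Qed.

Lemma adm_exp F k : admissible F -> admissible (fun l z => F l z ^+ k).
Proof.
move=> aF; elim: k => [|k IH].
  by under [X in admissible X]eq_fun => l do under eq_fun do rewrite expr0; exact: adm_cst.
by under [X in admissible X]eq_fun => l do under eq_fun do rewrite exprS; exact: adm_mul.
Qed.

Lemma adm_sum (I : Type) (r : seq I) (P : pred I) (F : I -> fam) :
  (forall i, admissible (F i)) -> admissible (fun l z => \sum_(i <- r | P i) F i l z).
Proof.
move=> aF; elim: r => [|i r IH].
  by under [X in admissible X]eq_fun => l do under eq_fun do rewrite big_nil; exact: adm_cst.
under [X in admissible X]eq_fun => l do under eq_fun do rewrite big_cons.
by case: (P i) => //; exact: adm_add.
Qed.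

(** With [F' = 1 / F], the derivative [- (e_A F) F'^2] lies in the algebra
    generated by [F']. *)
Lemma adm_inv F eps : admissible F -> 0 < eps ->
  (forall l x, U l x -> eps <= `|F l x|) -> admissible (fun l z => (F l z)^-1).
Proof.
move=> aF eps0 Feps; set F' := (X in admissible X).
have F0 l x : U l x -> F l x != 0.
  by move=> Ux; rewrite -normr_gt0 (lt_le_trans eps0) // Feps.
apply: (@generated_adm (fun G => G = F')); last exact: GenBase.
- move=> _ -> l x Ux; apply: differentiable_inv; first exact: F0.
  exact: adm_diff.
- move=> _ ->; exists eps^-1 => l x Ux; rewrite normfV lef_pV2 ?posrE // ?Feps //.
  by rewrite (lt_le_trans eps0) // Feps.
- move=> _ A ->; exists (fun l z => - frame_diff A F l z * (F' l z * F' l z)).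
    apply: GenMul; first by apply: GenAdm; apply: adm_opp; exact: adm_fd.
    by apply: GenMul; exact: GenBase.
  move=> l x Ux; rewrite fdV //; first exact: F0.
  exact: adm_diff.
Qed.

(** With [F' = sqrt F], the derivative [(e_A F) / (2 F) F'] lies in the algebra
    generated by [F']. *)
Lemma adm_sqrt F eps : admissible F -> 0 < eps ->
  (forall l x, U l x -> eps <= F l x) -> admissible (fun l z => Num.sqrt (F l z)).
Proof.
move=> aF eps0 Feps; set F' := (X in admissible X).
have F0 l x : U l x -> 0 < F l x by move=> Ux; rewrite (lt_le_trans eps0) // Feps.
have aV : admissible (fun l z => (F l z)^-1).
  by apply: adm_inv (aF) eps0 _ => l x Ux; rewrite gtr0_norm ?Feps // F0.
apply: (@generated_adm (fun G => G = F')); last exact: GenBase.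
- move=> _ -> l x Ux; apply: differentiable_sqrt; last exact: F0.
  exact: adm_diff.
- move=> _ ->; have [C FC] := adm_bdd aF; exists (Num.sqrt C) => l x Ux.
  rewrite ger0_norm ?sqrtr_ge0 // ler_wsqrtr // (le_trans (ler_norm _)) //.
  exact: FC.
- move=> _ A ->.
  exists (fun l z => (2^-1 * (frame_diff A F l z * (F l z)^-1)) * F' l z).
    apply: GenMul; last exact: GenBase.
    apply: GenAdm; apply: adm_mul; first exact: adm_cst.
    by apply: adm_mul => //; exact: adm_fd.
  move=> l x Ux; rewrite fd_sqrt; [|exact: F0|exact: adm_diff].
  rewrite -!mulrA; congr (_ * (_ * _)).
  have s0 : Num.sqrt (F l x) != 0 by rewrite gt_eqF // sqrtr_gt0 F0.
  rewrite /F' -{2}(sqr_sqrtr (ltW (F0 _ _ Ux))) expr2.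
  by rewrite invfM -mulrA mulVf // mulr1.
Qed.

End AdmissibleFamilies.

(** * Components of tensors in an overcomplete frame *)

Lemma updE {n p} (I : {ffun 'I_p -> 'I_n}) a l b :
  upd I a l b = if b == a then l else I b.
Proof. by rewrite ffunE. Qed.

Section UpdateSums.
Context {R : realType} {n : nat}.

Definition setf {T : finType} {X : Type} (J : {ffun T -> X}) (t : T) (l : X) : {ffun T -> X} :=
  [ffun b => if b == t then l else J b].

Lemma sum_setf (T : finType) (t : T) (Psi : {ffun T -> 'I_n} -> 'I_n -> R) :
  \sum_J \sum_l Psi J l = \sum_J \sum_l Psi (setf J t l) (J t).
Proof.
rewrite !pair_big /=.
pose h (p : {ffun T -> 'I_n} * 'I_n) := (setf p.1 t p.2, p.1 t).
have hK : involutive h.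
  move=> [J l]; rewrite /h /=; congr (_, _); last by rewrite ffunE eqxx.
  by apply/ffunP => b; rewrite !ffunE; case: eqP => [->|].
by rewrite (reindex_inj (inv_inj hK)).
Qed.

Lemma prod_setf (T : finType) (t : T) (E : T -> 'I_n -> R) (J : {ffun T -> 'I_n}) l :
  \prod_b E b (setf J t l b) = E t l * \prod_(b | b != t) E b (J b).
Proof.
rewrite (bigD1 t) //= ffunE eqxx; congr (_ * _).
by apply: eq_bigr => b bt; rewrite ffunE (negbTE bt).
Qed.

(** In the derivative of a full contraction the terms of the product rule and
    those of the connection can be collected slot by slot. *)
Lemma leibniz_connection (T : finType) (E dE : T -> 'I_n -> R) (Gam : 'I_n -> 'I_n -> R)
    (Q : {ffun T -> 'I_n} -> R) :
  \sum_(J : {ffun T -> 'I_n}) (\sum_t dE t (J t) * \prod_(b | b != t) E b (J b)) * Q J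
  + \sum_(J : {ffun T -> 'I_n}) (\prod_b E b (J b)) * (\sum_t \sum_l Gam l (J t) * Q (setf J t l))
  = \sum_t \sum_(J : {ffun T -> 'I_n}) (dE t (J t) + \sum_j Gam (J t) j * E t j)
       * (\prod_(b | b != t) E b (J b)) * Q J.
Proof.
under eq_bigr => J _ do rewrite mulr_suml.
rewrite exchange_big /=.
under [X in _ + X]eq_bigr => J _ do rewrite mulr_sumr.
rewrite [X in _ + X]exchange_big /= -big_split; apply: eq_bigr => t _ /=.
under [X in _ + X]eq_bigr => J _ do rewrite mulr_sumr.
rewrite [X in _ + X](sum_setf t) -big_split; apply: eq_bigr => J _ /=.
rewrite !mulrDl mulr_suml mulr_suml; congr (_ + _); apply: eq_bigr => j _.
rewrite prod_setf ffunE eqxx.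
have -> : setf (setf J t j) t (J t) = J.
  by apply/ffunP => b; rewrite !ffunE; case: eqP => [->|].
by ring.
Qed.

End UpdateSums.

Lemma exchange_sum4 (R : realType) (A B C D : finType) (c : A -> B -> R)
    (t : A -> B -> C -> D -> R) :
  \sum_i \sum_j c i j * (\sum_k \sum_l t i j k l) =
  \sum_k \sum_l \sum_i \sum_j c i j * t i j k l.
Proof.
rewrite [LHS]pair_bigA [RHS]pair_bigA /=.
under [RHS]eq_bigr => q _ do rewrite pair_bigA.
rewrite [RHS]exchange_big; apply: eq_bigr => p _ /=.
by rewrite pair_bigA mulr_sumr.
Qed.

Section FrameComponents.
Context {R : realType} {n : nat} {M : finType} {L : Type}.
Variables (U : L -> set 'rV[R]_n) (e : L -> M -> 'rV[R]_n -> 'rV[R]_n).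
Variable (th : L -> M -> 'rV[R]_n -> 'rV[R]_n).
Hypothesis oU : forall l, open (U l).
Hypothesis de : forall A i, diffU U (fun l x => e l A x 0 i).
Hypothesis dth : forall A i, diffU U (fun l x => th l A x 0 i).
Hypothesis complete : forall l x, U l x -> forall i j,
  \sum_A e l A x 0 i * th l A x 0 j = (i == j)%:R.
Local Notation fam := (L -> 'rV[R]_n -> R).
Local Notation fd := (frame_diff e).
Local Notation adm := (admissible U e).
Implicit Types (F : fam) (A : M).

(** Components with respect to the coframe (upper indices) and the frame (lower
    indices).  The frame is overcomplete, so that the components are redundant. *)
Definition frame_comp {p q} (B : L -> tensor R n p q) (I : {ffun 'I_p -> M})
    (J : {ffun 'I_q -> M}) : fam := fun l x =>
  \sum_(I' : {ffun 'I_p -> 'I_n}) \sum_(J' : {ffun 'I_q -> 'I_n})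
    (\prod_a th l (I a) x 0 (I' a)) * (\prod_b e l (J b) x 0 (J' b)) * B l x I' J'.

Definition adm_tensor {p q} (B : L -> tensor R n p q) :=
  forall I J, adm (frame_comp B I J).

(** Completeness of the frame, used in every slot. *)
Lemma fcompK {p q} (B : L -> tensor R n p q) l x I J : U l x ->
  B l x I J = \sum_(I' : {ffun 'I_p -> M}) \sum_(J' : {ffun 'I_q -> M})
    (\prod_a e l (I' a) x 0 (I a)) * (\prod_b th l (J' b) x 0 (J b)) * frame_comp B I' J' l x.
Proof.
move=> Ux.
have kron (k : nat) (K : {ffun 'I_k -> 'I_n}) (K2 : {ffun 'I_k -> 'I_n}) :
    \sum_(K' : {ffun 'I_k -> M})
      (\prod_a e l (K' a) x 0 (K a)) * (\prod_a th l (K' a) x 0 (K2 a)) =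
    (K == K2)%:R :> R.
  under eq_bigr do rewrite -big_split /=.
  rewrite -(bigA_distr_bigA (fun a A => e l A x 0 (K a) * th l A x 0 (K2 a))).
  under eq_bigr do rewrite complete //.
  have [->|/eqP KK] := eqVneq K K2.
    by rewrite big1 // => a _; rewrite eqxx.
  have [a Ka] : exists a, K a != K2 a.
    apply/existsP; rewrite -negb_forall; apply/negP => /forallP h.
    by apply: KK; apply/ffunP => a; apply/eqP.
  by rewrite (bigD1 a) //= (negbTE Ka) mul0r.
transitivity (\sum_(I2 : {ffun 'I_p -> 'I_n}) \sum_(J2 : {ffun 'I_q -> 'I_n})
   (\sum_(I' : {ffun 'I_p -> M}) (\prod_a e l (I' a) x 0 (I a)) *
      (\prod_a th l (I' a) x 0 (I2 a))) *
   (\sum_(J' : {ffun 'I_q -> M}) (\prod_a e l (J' a) x 0 (J2 a)) *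
      (\prod_a th l (J' a) x 0 (J a))) * B l x I2 J2).
  rewrite (bigD1 I) //= [X in _ + X]big1 ?addr0; last first.
    move=> I2 I2I; rewrite big1 // => J2 _.
    by rewrite !kron eq_sym (negbTE I2I) !mul0r.
  rewrite (bigD1 J) //= [X in _ + X]big1 ?addr0.
    by rewrite !kron !eqxx !mul1r.
  by move=> J2 J2J; rewrite !kron (negbTE J2J) mulr0 mul0r.
rewrite exchange_sum4; apply: eq_bigr => I2 _; apply: eq_bigr => J2 _.
rewrite big_distrlr /= mulr_suml; apply: eq_bigr => I' _.
by rewrite mulr_suml; apply: eq_bigr => J' _; ring.
Qed.

Lemma adm_tensor_diff {p q} (B : L -> tensor R n p q) I J :
  adm_tensor B -> diffU U (fun l x => B l x I J).
Proof.
move=> aB; apply: (@diffU_ext _ _ _ U oU (fun l x =>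
  \sum_(I' : {ffun 'I_p -> M}) \sum_(J' : {ffun 'I_q -> M})
    (\prod_a e l (I' a) x 0 (I a)) * (\prod_b th l (J' b) x 0 (J b)) * frame_comp B I' J' l x)).
  by move=> l x Ux; rewrite -fcompK.
move=> l x Ux; apply: differentiable_bigsum => I'; apply: differentiable_bigsum => J'.
apply: differentiable_mul; last exact: adm_diff (aB _ _) _ _ Ux.
by apply: differentiable_mul; apply: differentiable_bigprod => b;
  [exact: de|exact: dth].
Qed.

End FrameComponents.

(** * Covariant derivatives in a frame *)

Lemma prod_setf_fun {R : realType} {X : Type} (T : finType) (t : T) (E : T -> X -> R)
    (K : {ffun T -> X}) C :
  \prod_b E b (setf K t C b) = E t C * \prod_(b | b != t) E b (K b).
Proof.
rewrite (bigD1 t) //= ffunE eqxx; congr (_ * _).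
by apply: eq_bigr => b bt; rewrite ffunE (negbTE bt).
Qed.

Lemma leibniz_frame {R : realType} {n : nat} (M T : finType) (E dE : M -> 'I_n -> R)
    (Gam : 'I_n -> 'I_n -> R) (w : M -> M -> R) (K : {ffun T -> M})
    (Q : {ffun T -> 'I_n} -> R) :
  (forall A k, dE A k + \sum_j Gam k j * E A j = \sum_C w C A * E C k) ->
  \sum_(J : {ffun T -> 'I_n})
     (\sum_t dE (K t) (J t) * \prod_(b | b != t) E (K b) (J b)) * Q J
  + \sum_(J : {ffun T -> 'I_n}) (\prod_b E (K b) (J b)) *
     (\sum_t \sum_l Gam l (J t) * Q (setf J t l))
  = \sum_t \sum_C w C (K t) *
      (\sum_(J : {ffun T -> 'I_n}) (\prod_b E (setf K t C b) (J b)) * Q J).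
Proof.
move=> hw.
rewrite (leibniz_connection (fun t => E (K t)) (fun t => dE (K t)) Gam Q).
apply: eq_bigr => t _.
under [RHS]eq_bigr do rewrite mulr_sumr.
rewrite [RHS]exchange_big; apply: eq_bigr => J _ /=.
rewrite hw !mulr_suml; apply: eq_bigr => C _.
by rewrite (prod_setf_fun t (fun b A => E A (J b))); ring.
Qed.

Section ProductRule.
Context {R : realType} {n : nat} {M : finType} {L : Type}.
Variables (e : L -> M -> 'rV[R]_n -> 'rV[R]_n).

Lemma fd_prod (T : finType) A (F : T -> L -> 'rV[R]_n -> R) l x :
  (forall t, differentiable (F t l) x) ->
  frame_diff e A (fun l z => \prod_t F t l z) l x =
  \sum_t frame_diff e A (F t) l x * \prod_(b | b != t) F b l x.
Proof.
move=> dF.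
suff h (r : seq T) : uniq r -> frame_diff e A (fun l z => \prod_(t <- r) F t l z) l x =
  \sum_(t <- r) frame_diff e A (F t) l x * \prod_(b <- r | b != t) F b l x.
  by apply: h; rewrite /index_enum; exact: (enum_uniq T) || rewrite -enumT enum_uniq.
elim: r => [_|t r IH /= /andP[tr ur]].
  rewrite big_nil; under [X in frame_diff e A X]eq_fun => k do under eq_fun do rewrite big_nil.
  exact: fd_cst.
under [X in frame_diff e A X]eq_fun => k do under eq_fun do rewrite big_cons.
rewrite fdM //; last exact: differentiable_bigprod.
rewrite IH // big_cons; congr (_ + _).
  congr (_ * _); rewrite [RHS]big_cons eqxx /= [RHS]big_seq_cond [LHS]big_seq.
  apply: eq_bigl => b; case: (boolP (b \in r)) => //= br; apply/esym/eqP => bt.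
  by move: tr; rewrite -bt br.
rewrite mulr_sumr [LHS]big_seq [RHS]big_seq; apply: eq_bigr => b br.
rewrite [in RHS]big_cons ifT; first by ring.
by apply/eqP => tb; move: tr; rewrite tb br.
Qed.

End ProductRule.

Definition ffcons {X : finType} {q} (j : X) (K : {ffun 'I_q -> X}) : {ffun 'I_q.+1 -> X} :=
  [ffun b => if unlift ord0 b is Some b' then K b' else j].

Lemma ffcons0 {X : finType} {q} (j : X) (K : {ffun 'I_q -> X}) : ffcons j K ord0 = j.
Proof. by rewrite ffunE unlift_none. Qed.

Lemma ffconsS {X : finType} {q} (j : X) (K : {ffun 'I_q -> X}) b :
  ffcons j K (lift ord0 b) = K b.
Proof. by rewrite ffunE liftK. Qed.

Lemma sum_ffun_recl {R : realType} {X : finType} q (P : {ffun 'I_q.+1 -> X} -> R) :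
  \sum_J P J = \sum_j \sum_(K : {ffun 'I_q -> X}) P (ffcons j K).
Proof.
rewrite pair_big /=.
rewrite (reindex (fun p : X * {ffun 'I_q -> X} => ffcons p.1 p.2)) //=.
exists (fun J => (J ord0, [ffun b => J (lift ord0 b)])) => [[j K] _|J _].
  rewrite ffcons0; congr (_, _).
  by apply/ffunP => b; rewrite ffunE ffconsS.
apply/ffunP => b; rewrite !ffunE; case: unliftP => [b' ->|->] //.
by rewrite ffunE.
Qed.

Section CovariantDerivative.
Context {R : realType} {n : nat} {M : finType} {L : Type}.
Variables (U : L -> set 'rV[R]_n) (e th : L -> M -> 'rV[R]_n -> 'rV[R]_n).
Hypothesis oU : forall l, open (U l).
Hypothesis de : forall A i, diffU U (fun l x => e l A x 0 i).
Hypothesis dth : forall A i, diffU U (fun l x => th l A x 0 i).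
Hypothesis complete : forall l x, U l x -> forall i j,
  \sum_A e l A x 0 i * th l A x 0 j = (i == j)%:R.
Variable G : L -> 'rV[R]_n -> 'M[R]_n.
Local Notation fam := (L -> 'rV[R]_n -> R).
Local Notation fd := (frame_diff e).
Local Notation adm := (admissible U e).
Local Notation fcomp := (frame_comp e th).
Local Notation adm_tensor := (adm_tensor U e th).
Implicit Types (F : fam) (A B C : M).

(** Coordinates of the covariant derivative of [e_B] along [e_A]. *)
Definition frame_nabla A B (k : 'I_n) : fam := fun l x =>
  fd A (fun l z => e l B z 0 k) l x +
  \sum_j (\sum_i e l A x 0 i * christoffel (G l) k i j x) * e l B x 0 j.

(** Coordinates of the covariant derivative of the covector [th^B] along [e_A]. *)
Definition frame_conabla A B (j : 'I_n) : fam := fun l x =>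
  fd A (fun l z => th l B z 0 j) l x +
  \sum_k - (\sum_i e l A x 0 i * christoffel (G l) k i j x) * th l B x 0 k.

Definition conn C A B : fam := fun l x => \sum_k th l C x 0 k * frame_nabla A B k l x.

Definition coconn C A B : fam := fun l x => \sum_j frame_conabla A B j l x * e l C x 0 j.

Lemma frame_nablaE A B k l x : U l x ->
  frame_nabla A B k l x = \sum_C conn C A B l x * e l C x 0 k.
Proof.
move=> Ux; under eq_bigr do rewrite mulr_suml.
rewrite exchange_big /= (bigD1 k) //= [X in _ + X]big1 ?addr0.
  rewrite -[LHS]mul1r.
  transitivity ((\sum_C e l C x 0 k * th l C x 0 k) * frame_nabla A B k l x).
    by rewrite complete // eqxx.
  by rewrite mulr_suml; apply: eq_bigr => C _; ring.
move=> k' k'k.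
transitivity ((\sum_C e l C x 0 k * th l C x 0 k') * frame_nabla A B k' l x).
  by rewrite mulr_suml; apply: eq_bigr => C _; ring.
by rewrite complete // eq_sym (negbTE k'k) mul0r.
Qed.

Lemma frame_conablaE A B k l x : U l x ->
  frame_conabla A B k l x = \sum_C coconn C A B l x * th l C x 0 k.
Proof.
move=> Ux; under eq_bigr do rewrite mulr_suml.
rewrite exchange_big /= (bigD1 k) //= [X in _ + X]big1 ?addr0.
  rewrite -[LHS]mul1r.
  transitivity ((\sum_C e l C x 0 k * th l C x 0 k) * frame_conabla A B k l x).
    by rewrite complete // eqxx.
  by rewrite mulr_suml; apply: eq_bigr => C _; ring.
move=> k' k'k.
transitivity ((\sum_C e l C x 0 k' * th l C x 0 k) * frame_conabla A B k' l x).
  by rewrite mulr_suml; apply: eq_bigr => C _; ring.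
by rewrite complete // (negbTE k'k) mul0r.
Qed.

(** The pairing of [th^B] with [e_C] is not constant for an overcomplete frame:
    its derivative enters the usual duality of the two sets of coefficients. *)
Lemma coconnE C A B l x : U l x ->
  coconn C A B l x =
  fd A (fun l z => \sum_j th l B z 0 j * e l C z 0 j) l x - conn B A C l x.
Proof.
move=> Ux; rewrite fd_sum; last first.
  by move=> j; apply: differentiable_mul; [exact: dth|exact: de].
rewrite /conn /coconn -sumrB.
under [RHS]eq_bigr => j _.
  rewrite fdM; [|exact: dth|exact: de].
  over.
rewrite /frame_nabla /frame_conabla.
under [LHS]eq_bigr do rewrite mulrDl; under [RHS]eq_bigr do rewrite mulrDr opprD addrA.
rewrite !big_split /=; congr (_ + _).
  rewrite -!big_split /=; apply: eq_bigr => j _; ring.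
rewrite [RHS]sumrN.
under eq_bigr do rewrite mulr_suml.
rewrite exchange_big /= -sumrN; apply: eq_bigr => k _.
rewrite mulr_sumr -sumrN; apply: eq_bigr => j _; ring.
Qed.

(** The covariant derivative in frame components: the derivative of the
    components, corrected by one connection coefficient for each slot. *)
Lemma fcomp_cov p q (B : L -> tensor R n p q) (I : {ffun 'I_p -> M})
    (J : {ffun 'I_q.+1 -> M}) l x :
  (forall I' J', diffU U (fun l x => B l x I' J')) -> U l x ->
  let A := J ord0 in
  let K := [ffun b : 'I_q => J (lift ord0 b)] in
  fcomp (fun l => cov (G l) (B l)) I J l x =
  fd A (fcomp B I K) l x
  - (\sum_a \sum_C coconn C A (I a) l x * fcomp B (setf I a C) K l x)
  - (\sum_b \sum_C conn C A (K b) l x * fcomp B I (setf K b C) l x).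
Proof.
move=> dB Ux A K.
pose GA k j := \sum_i e l A x 0 i * christoffel (G l) k i j x.
pose Pt (I' : {ffun 'I_p -> 'I_n}) := \prod_a th l (I a) x 0 (I' a).
pose Pe (J' : {ffun 'I_q -> 'I_n}) := \prod_b e l (K b) x 0 (J' b).
pose dPt (I' : {ffun 'I_p -> 'I_n}) := \sum_a fd A (fun l z => th l (I a) z 0 (I' a)) l x
    * \prod_(b | b != a) th l (I b) x 0 (I' b).
pose dPe (J' : {ffun 'I_q -> 'I_n}) := \sum_a fd A (fun l z => e l (K a) z 0 (J' a)) l x
    * \prod_(b | b != a) e l (K b) x 0 (J' b).
pose dBA I' J' := fd A (fun l z => B l z I' J') l x.
have -> : fcomp (fun l => cov (G l) (B l)) I J l x =
  \sum_(I' : {ffun 'I_p -> 'I_n}) \sum_(J' : {ffun 'I_q -> 'I_n}) Pt I' * Pe J' * (dBA I' J'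
    + \sum_a \sum_k GA (I' a) k * B l x (setf I' a k) J'
    - \sum_b \sum_k GA k (J' b) * B l x I' (setf J' b k)).
  apply: eq_bigr => I' _; rewrite sum_ffun_recl exchange_big /=.
  apply: eq_bigr => J' _.
  have eJ j : \prod_b e l (J b) x 0 (ffcons j J' b) = e l A x 0 j * Pe J'.
    rewrite big_ord_recl ffcons0; congr (_ * _).
    by apply: eq_bigr => b _; rewrite ffconsS ffunE.
  under eq_bigr => j _ do rewrite eJ.
  transitivity (\sum_j Pt I' * Pe J' * (e l A x 0 j * (pd j (fun z => B l z I' J') x
    + \sum_a \sum_k christoffel (G l) (I' a) j k x * B l x (setf I' a k) J'
    - \sum_b \sum_k christoffel (G l) k j (J' b) x * B l x I' (setf J' b k)))).
    apply: eq_bigr => j _; rewrite /cov ffcons0.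
    have -> : [ffun b => ffcons j J' (lift ord0 b)] = J'.
      by apply/ffunP => b; rewrite ffunE ffconsS.
    rewrite /Pt; set X := (X in _ * X = _); set Y := (Y in _ = _ * (_ * Y)).
    have -> : X = Y by [].
    by ring.
  rewrite -mulr_sumr; congr (_ * _).
  under [LHS]eq_bigr do rewrite mulrBr mulrDr.
  rewrite sumrB big_split /=; congr (_ + _ - _).
    under [LHS]eq_bigr do rewrite mulr_sumr.
    rewrite [LHS]exchange_big; apply: eq_bigr => a _ /=.
    under [LHS]eq_bigr do rewrite mulr_sumr.
    rewrite [LHS]exchange_big; apply: eq_bigr => k _ /=.
    by rewrite [RHS]mulr_suml; apply: eq_bigr => j _; ring.
  under [LHS]eq_bigr do rewrite mulr_sumr.
  rewrite [LHS]exchange_big; apply: eq_bigr => a _ /=.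
  under [LHS]eq_bigr do rewrite mulr_sumr.
  rewrite [LHS]exchange_big; apply: eq_bigr => k _ /=.
  by rewrite [RHS]mulr_suml; apply: eq_bigr => j _; ring.
have -> : fd A (fcomp B I K) l x = \sum_(I' : {ffun 'I_p -> 'I_n}) \sum_(J' : {ffun 'I_q -> 'I_n})
   ((dPt I' * Pe J' + Pt I' * dPe J') * B l x I' J' + Pt I' * Pe J' * dBA I' J').
  have dPt' (I' : {ffun 'I_p -> 'I_n}) : differentiable (fun z => \prod_a th l (I a) z 0 (I' a)) x.
    by apply: differentiable_bigprod => a; exact: dth.
  have dPe' (J' : {ffun 'I_q -> 'I_n}) : differentiable (fun z => \prod_b e l (K b) z 0 (J' b)) x.
    by apply: differentiable_bigprod => a; exact: de.
  have dP I' J' := differentiable_mul (dPt' I') (dPe' J').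
  have dPB I' J' := differentiable_mul (dP I' J') (dB I' J' l x Ux).
  rewrite /frame_comp fd_sum; last first.
    by move=> I'; apply: differentiable_bigsum => J'; exact: dPB.
  apply: eq_bigr => I' _; rewrite fd_sum; last by move=> J'; exact: dPB.
  apply: eq_bigr => J' _; rewrite fdM //; last exact: dB.
  by rewrite fdM // !fd_prod // => t; [exact: de|exact: dth].
have hth : \sum_a \sum_C coconn C A (I a) l x * fcomp B (setf I a C) K l x =
   \sum_(J' : {ffun 'I_q -> 'I_n}) Pe J' * (\sum_(I' : {ffun 'I_p -> 'I_n}) dPt I' * B l x I' J' +
     \sum_(I' : {ffun 'I_p -> 'I_n}) Pt I' * \sum_a \sum_k - GA (I' a) k * B l x (setf I' a k) J').
  have hw B0 k : fd A (fun l z => th l B0 z 0 k) l x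
      + \sum_j (fun k j => - GA j k) k j * th l B0 x 0 j =
      \sum_C (fun C B0 => coconn C A B0 l x) C B0 * th l C x 0 k.
    by rewrite -frame_conablaE.
  have hl J' := leibniz_frame I (fun I' => B l x I' J') hw.
  under [RHS]eq_bigr => J' _ do rewrite hl mulr_sumr.
  rewrite [RHS]exchange_big; apply: eq_bigr => a _ /=.
  under [RHS]eq_bigr => J' _ do rewrite mulr_sumr.
  rewrite [RHS]exchange_big; apply: eq_bigr => C _ /=.
  rewrite /frame_comp [in LHS]exchange_big [LHS]mulr_sumr; apply: eq_bigr => J' _ /=.
  rewrite !mulr_sumr; apply: eq_bigr => I' _.
  by rewrite /Pe; ring.
have he : \sum_b \sum_C conn C A (K b) l x * fcomp B I (setf K b C) l x =
   \sum_(I' : {ffun 'I_p -> 'I_n}) Pt I' * (\sum_(J' : {ffun 'I_q -> 'I_n}) dPe J' * B l x I' J' +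
     \sum_(J' : {ffun 'I_q -> 'I_n}) Pe J' * \sum_b \sum_k GA k (J' b) * B l x I' (setf J' b k)).
  have hw B0 k : fd A (fun l z => e l B0 z 0 k) l x
      + \sum_j GA k j * e l B0 x 0 j =
      \sum_C (fun C B0 => conn C A B0 l x) C B0 * e l C x 0 k.
    by rewrite -frame_nablaE.
  have hl I' := leibniz_frame K (fun J' => B l x I' J') hw.
  under [RHS]eq_bigr => I' _ do rewrite hl mulr_sumr.
  rewrite [RHS]exchange_big; apply: eq_bigr => b _ /=.
  under [RHS]eq_bigr => I' _ do rewrite mulr_sumr.
  rewrite [RHS]exchange_big; apply: eq_bigr => C _ /=.
  rewrite /frame_comp [LHS]mulr_sumr; apply: eq_bigr => I' _ /=.
  rewrite !mulr_sumr; apply: eq_bigr => J' _.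
  by rewrite /Pt; ring.
rewrite hth he.
under [X in _ = _ - X - _]eq_bigr do rewrite -big_split mulr_sumr.
under [X in _ = _ - _ - X]eq_bigr do rewrite -big_split mulr_sumr.
rewrite [X in _ = _ - X - _]exchange_big /= -!sumrB; apply: eq_bigr => I' _.
rewrite -!sumrB; apply: eq_bigr => J' _.
have -> : \sum_a \sum_k - GA (I' a) k * B l x (setf I' a k) J' =
   - \sum_a \sum_k GA (I' a) k * B l x (setf I' a k) J'.
  rewrite -sumrN; apply: eq_bigr => a _; rewrite -sumrN; apply: eq_bigr => k _.
  by rewrite mulNr.
set S1 := \sum_a _; set S2 := \sum_b _; ring.
Qed.

Hypothesis aPi : forall A B, adm (fun l z => \sum_j th l A z 0 j * e l B z 0 j).
Hypothesis aconn : forall C A B, adm (conn C A B).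

(** The formula of [fcomp_cov] only involves admissible functions. *)
Lemma adm_cov p q (B : L -> tensor R n p q) :
  adm_tensor B -> adm_tensor (fun l => cov (G l) (B l)).
Proof.
move=> aB I J.
have dB I' J' : diffU U (fun l x => B l x I' J').
  exact: (adm_tensor_diff oU de dth complete).
have ac C A D : adm (coconn C A D).
  apply: (@adm_ext _ _ _ _ U e oU (fun l x =>
     fd A (fun l z => \sum_j th l D z 0 j * e l C z 0 j) l x - conn D A C l x)).
    by move=> l x Ux; rewrite coconnE.
  by apply: adm_sub => //; apply: adm_fd.
apply: (adm_ext oU) (fun l x Ux => esym (fcomp_cov I J dB Ux)) _.
apply: adm_sub => //; first apply: adm_sub => //.
- by apply: adm_fd; exact: aB.
- apply: adm_sum => // a; apply: adm_sum => // C; apply: adm_mul => //; exact: aB.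
- apply: adm_sum => // a; apply: adm_sum => // C; apply: adm_mul => //; exact: aB.
Qed.

Lemma adm_icov p q (B : L -> tensor R n p q) k :
  adm_tensor B -> adm_tensor (fun l => icov (G l) (B l) k).
Proof. by move=> aB; elim: k => [//|k IH]; exact: adm_cov IH. Qed.

End CovariantDerivative.

(** * The Koszul formula in a frame *)

Section LeviCivita.
Context {R : realType} {n : nat} {M : finType} {L : Type}.
Variables (U : L -> set 'rV[R]_n) (e th : L -> M -> 'rV[R]_n -> 'rV[R]_n).
Hypothesis oU : forall l, open (U l).
Hypothesis de : forall A i, diffU U (fun l x => e l A x 0 i).
Hypothesis dth : forall A i, diffU U (fun l x => th l A x 0 i).
Hypothesis complete : forall l x, U l x -> forall i j,
  \sum_A e l A x 0 i * th l A x 0 j = (i == j)%:R.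
Variable G : L -> 'rV[R]_n -> 'M[R]_n.
Local Notation fam := (L -> 'rV[R]_n -> R).
Local Notation fd := (frame_diff e).
Local Notation adm := (admissible U e).
Local Notation nab := (frame_nabla e G).
Implicit Types (F : fam) (A B C D : M).

Hypothesis Gsym : forall l x, U l x -> forall i j, G l x i j = G l x j i.
Hypothesis Gunit : forall l x, U l x -> G l x \in unitmx.
Hypothesis dG : forall i j, diffU U (fun l x => G l x i j).

Definition gram A B : fam := fun l x =>
  \sum_i \sum_j e l A x 0 i * G l x i j * e l B x 0 j.

Definition cogram A B : fam := fun l x =>
  \sum_i \sum_j th l A x 0 i * invmx (G l x) i j * th l B x 0 j.

Variable cc : M -> M -> M -> fam.
Hypothesis commE : forall A B k l x, U l x ->
  fd A (fun l z => e l B z 0 k) l x - fd B (fun l z => e l A z 0 k) l x =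
  \sum_C cc A B C l x * e l C x 0 k.
Hypothesis acc : forall A B C, adm (cc A B C).
Hypothesis agram : forall A B, adm (gram A B).
Hypothesis acogram : forall A B, adm (cogram A B).

(** Lowering the upper index removes the inverse metric from the definition. *)
Lemma christoffel_low l x i j k : U l x ->
  \sum_s G l x k s * christoffel (G l) s i j x =
  2^-1 * (pd i (fun z => G l z j k) x + pd j (fun z => G l z i k) x
          - pd k (fun z => G l z i j) x).
Proof.
move=> Ux; rewrite /christoffel; set Y := fun k => pd i (fun z => G l z j k) x +
  pd j (fun z => G l z i k) x - pd k (fun z => G l z i j) x.
rewrite -/(Y k).
transitivity (2^-1 * \sum_t (G l x *m invmx (G l x)) k t * Y t).
  transitivity (2^-1 * \sum_s \sum_t G l x k s * (invmx (G l x) s t * Y t)).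
    rewrite mulr_sumr; apply: eq_bigr => s _; rewrite mulrCA; congr (_ * _).
    by rewrite mulr_sumr.
  congr (_ * _); rewrite exchange_big; apply: eq_bigr => t _ /=.
  by rewrite mxE mulr_suml; apply: eq_bigr => s _; rewrite mulrA.
congr (_ * _); rewrite mulmxV ?Gunit // (bigD1 k) //= big1 ?addr0.
  by rewrite mxE eqxx mul1r.
by move=> t tk; rewrite mxE eq_sym (negbTE tk) mul0r.
Qed.

Definition bil l x (V W : 'I_n -> R) := \sum_i \sum_j V i * G l x i j * W j.

Lemma bilC l x V W : U l x -> bil l x V W = bil l x W V.
Proof.
move=> Ux; rewrite /bil exchange_big; apply: eq_bigr => i _; apply: eq_bigr => j _.
by rewrite (Gsym Ux i j); ring.
Qed.

Lemma bilB l x V V' W : bil l x (fun k => V k - V' k) W = bil l x V W - bil l x V' W.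
Proof.
rewrite /bil -sumrB; apply: eq_bigr => i _; rewrite -sumrB; apply: eq_bigr => j _.
by rewrite !mulrBl.
Qed.

Lemma bil_suml l x (c : M -> R) (V : M -> 'I_n -> R) W :
  bil l x (fun k => \sum_D c D * V D k) W = \sum_D c D * bil l x (V D) W.
Proof.
rewrite /bil; under [RHS]eq_bigr do rewrite mulr_sumr.
rewrite [RHS]exchange_big; apply: eq_bigr => i _ /=.
under [RHS]eq_bigr do rewrite mulr_sumr.
rewrite [RHS]exchange_big; apply: eq_bigr => j _ /=.
by rewrite !mulr_suml; apply: eq_bigr => D _; rewrite !mulrA.
Qed.

Let ev l x A := fun k => e l A x 0 k.
Let ex l x A B := fun k => fd A (fun l z => e l B z 0 k) l x.

Definition tgrad l x A B C := \sum_i \sum_j \sum_k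
  e l A x 0 i * e l B x 0 j * e l C x 0 k * pd i (fun z => G l z j k) x.

Lemma fd_gram A B C l x : U l x ->
  fd A (gram B C) l x =
  bil l x (ex l x A B) (ev l x C) + bil l x (ex l x A C) (ev l x B) + tgrad l x A B C.
Proof.
move=> Ux.
have d1 i j : differentiable (fun z => e l B z 0 i * G l z i j) x.
  by apply: differentiable_mul; [exact: de|exact: dG].
have d2 i j : differentiable (fun z => e l B z 0 i * G l z i j * e l C z 0 j) x.
  by apply: differentiable_mul => //; exact: de.
rewrite /gram fd_sum; last by move=> i; apply: differentiable_bigsum.
rewrite (bilC (ex l x A C) _ Ux) /bil.
have -> : tgrad l x A B C = \sum_j \sum_k (fd A (fun l z => G l z j k) l x *
    (e l B x 0 j * e l C x 0 k)).
  rewrite /tgrad exchange_big; apply: eq_bigr => j _ /=.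
  rewrite exchange_big; apply: eq_bigr => k _ /=; rewrite /frame_diff mulr_suml.
  by apply: eq_bigr => i _; ring.
rewrite -!big_split; apply: eq_bigr => i _ /=; rewrite fd_sum //.
rewrite -!big_split; apply: eq_bigr => j _ /=.
rewrite fdM // ?fdM //; try exact: de; try exact: dG.
by rewrite /ex /ev; ring.
Qed.

Definition frame_nabla_low A B C : fam := fun l x =>
  bil l x (fun k => nab A B k l x) (ev l x C).

Lemma frame_nabla_lowE A B C l x : U l x ->
  2 * frame_nabla_low A B C l x = 2 * bil l x (ex l x A B) (ev l x C)
    + tgrad l x A B C + tgrad l x B A C - tgrad l x C A B.
Proof.
move=> Ux.
pose chr k := \sum_j (\sum_i e l A x 0 i * christoffel (G l) k i j x) * e l B x 0 j.
have -> : frame_nabla_low A B C l x = bil l x (ex l x A B) (ev l x C) + bil l x chr (ev l x C).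
  rewrite /frame_nabla_low /bil -big_split; apply: eq_bigr => i _; rewrite -big_split.
  by apply: eq_bigr => j _; rewrite /= /nab -!mulrDl.
rewrite mulrDr -!addrA; congr (_ + _); rewrite addrA.
have -> : bil l x chr (ev l x C) = \sum_i \sum_j \sum_k
    e l A x 0 i * e l B x 0 j * e l C x 0 k *
    (\sum_s G l x k s * christoffel (G l) s i j x).
  rewrite (bilC _ _ Ux) /bil /chr.
  transitivity (\sum_k \sum_s \sum_j \sum_i e l A x 0 i * e l B x 0 j * e l C x 0 k *
      (G l x k s * christoffel (G l) s i j x)).
    apply: eq_bigr => k _; apply: eq_bigr => s _; rewrite mulr_sumr.
    apply: eq_bigr => j _; rewrite mulr_suml mulr_sumr; apply: eq_bigr => i _.
    by rewrite /ev; ring.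
  under eq_bigr do rewrite exchange_big /=.
  rewrite exchange_big /= [RHS]exchange_big; apply: eq_bigr => j _ /=.
  under eq_bigr do rewrite exchange_big /=.
  rewrite exchange_big; apply: eq_bigr => i _ /=.
  by apply: eq_bigr => k _; rewrite mulr_sumr.
rewrite /tgrad (exchange_big _ _ _ _ _ (fun i j => \sum_k e l B x 0 i * _ * _ * _)) /=.
have -> : \sum_i \sum_j \sum_k e l C x 0 i * e l A x 0 j * e l B x 0 k *
     pd i (fun z => G l z j k) x =
  \sum_i \sum_j \sum_k e l A x 0 i * e l B x 0 j * e l C x 0 k *
     pd k (fun z => G l z i j) x.
  rewrite exchange_big; apply: eq_bigr => i _ /=; rewrite exchange_big.
  by apply: eq_bigr => j _; apply: eq_bigr => k _; congr (_ * _); ring.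
rewrite mulr_sumr -big_split -sumrB; apply: eq_bigr => i _ /=.
rewrite mulr_sumr -big_split -sumrB; apply: eq_bigr => j _ /=.
rewrite mulr_sumr -big_split -sumrB; apply: eq_bigr => k _ /=.
by rewrite christoffel_low //; field.
Qed.

(** The Koszul formula; [gram] is not constant, and the brackets are given by
    the coefficients [cc]. *)
Lemma koszul A B C l x : U l x ->
  2 * frame_nabla_low A B C l x =
  fd A (gram B C) l x + fd B (gram A C) l x - fd C (gram A B) l x
  + \sum_D cc A B D l x * gram D C l x
  - \sum_D cc A C D l x * gram D B l x
  - \sum_D cc B C D l x * gram D A l x.
Proof.
move=> Ux.
have hc A' B' C' : \sum_D cc A' B' D l x * gram D C' l x =
    bil l x (ex l x A' B') (ev l x C') - bil l x (ex l x B' A') (ev l x C').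
  rewrite -bilB -(bil_suml l x (fun D => cc A' B' D l x) (ev l x)).
  by congr bil; apply/funext => k; rewrite /ex commE.
rewrite frame_nabla_lowE // !hc !fd_gram //; ring.
Qed.

(** Raising the last index with [cogram] is legitimate for an overcomplete
    frame, by completeness. *)
Lemma conn_frame_nabla_low C A B l x : U l x ->
  conn e th G C A B l x = \sum_D cogram C D l x * frame_nabla_low A B D l x.
Proof.
move=> Ux; rewrite /conn.
transitivity (\sum_i \sum_j \sum_k th l C x 0 i * invmx (G l x) i j * (G l x j k
   * nab A B k l x)).
  transitivity (\sum_i \sum_k th l C x 0 i * (1%:M : 'M[R]_n) i k * nab A B k l x).
    apply: eq_bigr => i _; rewrite (bigD1 i) //= big1 ?addr0.
      by rewrite mxE eqxx mulr1.
    by move=> k ki; rewrite mxE eq_sym (negbTE ki) mulr0 mul0r.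
  apply: eq_bigr => i _; rewrite exchange_big; apply: eq_bigr => k _ /=.
  rewrite -(mulVmx (Gunit Ux)) mxE mulr_sumr mulr_suml.
  by apply: eq_bigr => j _; ring.
transitivity (\sum_i \sum_j \sum_k \sum_s th l C x 0 i * invmx (G l x) i j *
   (G l x s k * nab A B k l x) * (\sum_D e l D x 0 s * th l D x 0 j)).
  apply: eq_bigr => i _; apply: eq_bigr => j _; apply: eq_bigr => k _.
  rewrite [RHS](bigD1 j) //= [X in _ + X]big1 ?addr0.
    by rewrite complete // eqxx mulr1.
  by move=> s sj; rewrite complete // (negbTE sj) mulr0.
rewrite /cogram.
under [RHS]eq_bigr do rewrite mulr_suml; rewrite [RHS]exchange_big; apply: eq_bigr => i _ /=.
under [RHS]eq_bigr do rewrite mulr_suml; rewrite [RHS]exchange_big; apply: eq_bigr => j _ /=.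
rewrite /frame_nabla_low /bil.
under [RHS]eq_bigr do rewrite mulr_sumr; rewrite [RHS]exchange_big; apply: eq_bigr => k _ /=.
under [RHS]eq_bigr do rewrite mulr_sumr; rewrite [RHS]exchange_big; apply: eq_bigr => s _ /=.
rewrite mulr_sumr; apply: eq_bigr => D _.
by rewrite /ev (Gsym Ux s k); ring.
Qed.

(** The Koszul formula expresses the connection coefficients by Gram matrices,
    their frame derivatives and bracket coefficients. *)
Lemma adm_conn C A B : adm (conn e th G C A B).
Proof.
pose ks A B C : fam := fun l x =>
  2^-1 * (fd A (gram B C) l x + fd B (gram A C) l x - fd C (gram A B) l x
  + \sum_D cc A B D l x * gram D C l x
  - \sum_D cc A C D l x * gram D B l x
  - \sum_D cc B C D l x * gram D A l x).
apply: (@adm_ext _ _ _ _ U e oU (fun l x => \sum_D cogram C D l x * ks A B D l x)).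
  move=> l x Ux; rewrite conn_frame_nabla_low //; apply: eq_bigr => D _; congr (_ * _).
  by rewrite /ks -koszul // mulKf // pnatr_eq0.
have as3 A' B' C' : adm (fun l x => \sum_D cc A' B' D l x * gram D C' l x).
  by apply: adm_sum => // D; apply: adm_mul.
apply: adm_sum => // D; apply: adm_mul => //; apply: adm_mul => //; first exact: adm_cst.
do 2![apply: adm_sub => //]; apply: adm_add => //; apply: adm_sub => //.
  by apply: adm_add => //; exact: adm_fd.
exact: adm_fd.
Qed.

(** The pairing matrix is the product of the two Gram matrices. *)
Lemma adm_pairing A B : adm (fun l z => \sum_j th l A z 0 j * e l B z 0 j).
Proof.
apply: (@adm_ext _ _ _ _ U e oU (fun l x => \sum_D cogram A D l x * gram D B l x)); last first.
  by apply: adm_sum => // D; apply: adm_mul.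
move=> l x Ux; rewrite /cogram /gram.
under eq_bigr do rewrite mulr_suml; rewrite exchange_big /=.
transitivity (\sum_i \sum_j \sum_k th l A x 0 i * invmx (G l x) i j *
  (G l x j k * e l B x 0 k)).
  apply: eq_bigr => i _; under eq_bigr do rewrite mulr_suml; rewrite exchange_big.
  apply: eq_bigr => j _ /=.
  transitivity (\sum_s \sum_k th l A x 0 i * invmx (G l x) i j *
     (G l x s k * e l B x 0 k) * (\sum_D e l D x 0 s * th l D x 0 j)).
    under [LHS]eq_bigr do rewrite mulr_sumr; rewrite [LHS]exchange_big.
    apply: eq_bigr => s _ /=.
    under [LHS]eq_bigr do rewrite mulr_sumr; rewrite [LHS]exchange_big.
    by apply: eq_bigr => k _ /=; rewrite mulr_sumr; apply: eq_bigr => D _; ring.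
  rewrite exchange_big; apply: eq_bigr => k _ /=.
  rewrite (bigD1 j) //= [X in _ + X]big1 ?addr0.
    by rewrite complete // eqxx mulr1.
  by move=> s sj; rewrite complete // (negbTE sj) mulr0.
apply: eq_bigr => i _; rewrite exchange_big /= (bigD1 i) //= [X in _ + X]big1 ?addr0.
  transitivity (th l A x 0 i * (invmx (G l x) *m G l x) i i * e l B x 0 i).
    by rewrite mxE mulr_sumr mulr_suml; apply: eq_bigr => j _; ring.
  by rewrite mulVmx ?Gunit // mxE eqxx mulr1.
move=> k ki.
transitivity (th l A x 0 i * (invmx (G l x) *m G l x) i k * e l B x 0 k).
  by rewrite mxE mulr_sumr mulr_suml; apply: eq_bigr => j _; ring.
by rewrite mulVmx ?Gunit // mxE eq_sym (negbTE ki) mulr0 mul0r.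
Qed.

Lemma adm_icovE p q (B : L -> tensor R n p q) k :
  adm_tensor U e th B -> adm_tensor U e th (fun l => icov (G l) (B l) k).
Proof. exact: (adm_icov oU de dth complete adm_pairing adm_conn). Qed.

End LeviCivita.

(** * Curvature in a frame *)

(* Ring normalisation compares atoms up to conversion, which is costly for sums
   and derivatives: they are replaced by variables beforehand. *)
Ltac atom_ring := repeat match goal with
  | |- context [@bigop.body ?R ?I ?i ?r ?F] =>
      let h := fresh in move: (@bigop.body R I i r F) => h
  | |- context [@pd ?R ?n ?i ?f ?x] => let h := fresh in move: (@pd R n i f x) => h
  | |- context [@christoffel ?R ?n ?G ?k ?i ?j ?x] =>
      let h := fresh in move: (@christoffel R n G k i j x) => h
  | |- context [@frame_diff ?R ?n ?M ?L ?e ?A ?F ?l ?x] =>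
      let h := fresh in move: (@frame_diff R n M L e A F l x) => h
  | |- context [@fun_of_matrix ?R ?m ?n ?A ?i ?j] =>
      let h := fresh in move: (@fun_of_matrix R m n A i j) => h
  end; ring.

Section Curvature.
Context {R : realType} {n : nat} {M : finType} {L : Type}.
Variables (U : L -> set 'rV[R]_n) (e th : L -> M -> 'rV[R]_n -> 'rV[R]_n).
Hypothesis oU : forall l, open (U l).
Hypothesis de : forall A i, diffU U (fun l x => e l A x 0 i).
Hypothesis dth : forall A i, diffU U (fun l x => th l A x 0 i).
Hypothesis complete : forall l x, U l x -> forall i j,
  \sum_A e l A x 0 i * th l A x 0 j = (i == j)%:R.
Variable G : L -> 'rV[R]_n -> 'M[R]_n.
Local Notation fam := (L -> 'rV[R]_n -> R).
Local Notation fd := (frame_diff e).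
Local Notation adm := (admissible U e).
Local Notation nab := (frame_nabla e G).
Local Notation conn := (conn e th G).
Implicit Types (F : fam) (A B C D : M).

Hypothesis dde : forall A k i, diffU U (fun l => pd i (fun z => e l A z 0 k)).
Hypothesis schwarz : forall l x, U l x -> forall A k i j,
  pd i (pd j (fun z => e l A z 0 k)) x = pd j (pd i (fun z => e l A z 0 k)) x.
Variable cc : M -> M -> M -> fam.
Hypothesis commE : forall A B k l x, U l x ->
  fd A (fun l z => e l B z 0 k) l x - fd B (fun l z => e l A z 0 k) l x =
  \sum_C cc A B C l x * e l C x 0 k.
Hypothesis acc : forall A B C, adm (cc A B C).
Hypothesis aPi : forall A B, adm (fun l z => \sum_j th l A z 0 j * e l B z 0 j).
Hypothesis aconn : forall C A B, adm (conn C A B).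

Local Notation Gam l k i j := (christoffel (G l) k i j).

Lemma diff_fd_frame A B k : diffU U (fd A (fun l z => e l B z 0 k)).
Proof.
move=> l x Ux; apply: differentiable_bigsum => i.
by apply: differentiable_mul; [exact: de|exact: dde].
Qed.

Lemma diff_frame_nabla A B k : diffU U (nab A B k).
Proof.
apply: (diffU_ext oU) (fun l x Ux => esym (frame_nablaE complete G A B k Ux)) _ => l x Ux.
apply: differentiable_bigsum => C; apply: differentiable_mul.
  exact: adm_diff (aconn _ _ _) _ _ Ux.
exact: de.
Qed.

Lemma sum_dual (P : 'I_n -> R) l x i : U l x ->
  \sum_A th l A x 0 i * (\sum_j e l A x 0 j * P j) = P i.
Proof.
move=> Ux; under eq_bigr do rewrite mulr_sumr.
rewrite exchange_big /= (bigD1 i) //= [X in _ + X]big1 ?addr0.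
  transitivity ((\sum_A e l A x 0 i * th l A x 0 i) * P i).
    by rewrite mulr_suml; apply: eq_bigr => A _; atom_ring.
  by rewrite complete // eqxx mul1r.
move=> j ji.
transitivity ((\sum_A e l A x 0 j * th l A x 0 i) * P j).
  by rewrite mulr_suml; apply: eq_bigr => A _; atom_ring.
by rewrite complete // (negbTE ji) mul0r.
Qed.

(** The connection coefficients of the frame and the derivatives of the frame
    determine the Christoffel symbols, so the latter inherit differentiability. *)
Lemma diff_christoffel k i j : diffU U (fun l => Gam l k i j).
Proof.
apply: (@diffU_ext _ _ _ U oU (fun l x => \sum_B th l B x 0 j * \sum_A th l A x 0 i *
    (nab A B k l x - fd A (fun l z => e l B z 0 k) l x))).
  move=> l x Ux.
  transitivity (\sum_B th l B x 0 j * \sum_s e l B x 0 s * Gam l k i s x).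
    apply: eq_bigr => B _; congr (_ * _).
    under eq_bigr do rewrite /frame_nabla addrAC subrr add0r.
    under eq_bigr => A _.
      under eq_bigr do rewrite mulr_suml.
      rewrite exchange_big /=.
      under eq_bigr do (under eq_bigr do rewrite -mulrA; rewrite -mulr_sumr).
      over.
    rewrite (sum_dual (fun i => \sum_s christoffel (G l) k i s x * e l B x 0 s) i Ux).
    by apply: eq_bigr => s _; rewrite mulrC.
  exact: sum_dual (fun s => Gam l k i s x) _ _ _ Ux.
move=> l x Ux; apply: differentiable_bigsum => B; apply: differentiable_mul; first exact: dth.
apply: differentiable_bigsum => A; apply: differentiable_mul; first exact: dth.
apply: differentiable_add; first exact: diff_frame_nabla.
by apply: differentiable_opp; exact: diff_fd_frame.
Qed.

Let Y l C s j x := pd j (fun z => e l C z 0 s) x + \sum_k Gam l s j k x * e l C x 0 k.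

Lemma frame_nabla_cov A B k l x : nab A B k l x = \sum_j e l A x 0 j * Y l B k j x.
Proof.
rewrite /frame_nabla /frame_diff.
under [RHS]eq_bigr do rewrite mulrDr; rewrite [RHS]big_split /=; congr (_ + _).
under [RHS]eq_bigr do rewrite mulr_sumr.
rewrite [RHS]exchange_big; apply: eq_bigr => j _ /=.
by rewrite mulr_suml; apply: eq_bigr => i _; rewrite mulrA.
Qed.

Definition Rm l (t k i j : 'I_n) x :=
  pd i (Gam l t j k) x - pd j (Gam l t i k) x
  + \sum_s (Gam l t i s x * Gam l s j k x - Gam l t j s x * Gam l s i k x).

(** Covariant derivative along [e_A] of the vector field [nabla_(e_B) e_C]. *)
Definition frame_nabla2 A B C t : fam := fun l x =>
  fd A (nab B C t) l x + \sum_s (\sum_i e l A x 0 i * Gam l t i s x) * nab B C s l x.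

Let Z l C t i j x := pd i (pd j (fun z => e l C z 0 t)) x
  + \sum_k (pd i (Gam l t j k) x * e l C x 0 k + Gam l t j k x * pd i (fun z => e l C z 0 k) x
            + Gam l t i k x * pd j (fun z => e l C z 0 k) x)
  + \sum_s Gam l t i s x * \sum_k Gam l s j k x * e l C x 0 k.

Lemma frame_nabla2E A B C t l x : U l x ->
  frame_nabla2 A B C t l x = \sum_j fd A (fun l z => e l B z 0 j) l x * Y l C t j x
  + \sum_i \sum_j e l A x 0 i * e l B x 0 j * Z l C t i j x.
Proof.
move=> Ux; rewrite /frame_nabla2.
have dY j : differentiable (Y l C t j) x.
  apply: differentiable_add; first exact: dde.
  apply: differentiable_bigsum => k.
  by apply: differentiable_mul; [exact: diff_christoffel|exact: de].
have -> : fd A (nab B C t) l x = \sum_j (fd A (fun l z => e l B z 0 j) l x * Y l C t j x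
   + e l B x 0 j * \sum_i e l A x 0 i * pd i (Y l C t j) x).
  rewrite (fd_ext e oU A (G := fun l x => \sum_j e l B x 0 j * Y l C t j x)) //; last first.
    by move=> l' x' _; rewrite frame_nabla_cov.
  rewrite fd_sum; last by move=> j; apply: differentiable_mul; [exact: de|exact: dY].
  by apply: eq_bigr => j _; rewrite fdM //; exact: de.
rewrite big_split -addrA; congr (_ + _).
have pY i j : pd i (Y l C t j) x = pd i (pd j (fun z => e l C z 0 t)) x
  + \sum_k (pd i (Gam l t j k) x * e l C x 0 k + Gam l t j k x * pd i (fun z => e l C z 0 k) x).
  have dGe k : differentiable (fun z => Gam l t j k z * e l C z 0 k) x.
    by apply: differentiable_mul; [exact: diff_christoffel|exact: de].
  rewrite /Y pdD; [|exact: dde|exact: differentiable_bigsum].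
  rewrite pd_bigsum //; congr (_ + _); apply: eq_bigr => k _.
  by rewrite pdM //; [exact: diff_christoffel|exact: de].
under [X in X + _]eq_bigr do rewrite mulr_sumr.
rewrite exchange_big /=.
have -> : \sum_s (\sum_i e l A x 0 i * Gam l t i s x) * nab B C s l x =
  \sum_i \sum_j e l A x 0 i * e l B x 0 j * \sum_s Gam l t i s x * Y l C s j x.
  under eq_bigr do rewrite mulr_suml.
  rewrite exchange_big; apply: eq_bigr => i _ /=.
  under eq_bigr do rewrite frame_nabla_cov mulr_sumr.
  rewrite exchange_big; apply: eq_bigr => j _ /=.
  by rewrite mulr_sumr; apply: eq_bigr => s _; atom_ring.
rewrite -big_split; apply: eq_bigr => i _ /=.
rewrite -big_split; apply: eq_bigr => j _ /=.
rewrite pY /Z /Y.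
under [X in _ + _ * X = _]eq_bigr do rewrite mulrDr.
rewrite !big_split /=; atom_ring.
Qed.

(** [Rm(A, B) C = nabla_A nabla_B C - nabla_B nabla_A C - nabla_[A, B] C] for
    frame fields; the second derivatives of the frame cancel by Schwarz. *)
Lemma curvature_frame A B C t l x : U l x ->
  \sum_i \sum_j \sum_k e l A x 0 i * e l B x 0 j * e l C x 0 k * Rm l t k i j x =
  frame_nabla2 A B C t l x - frame_nabla2 B A C t l x - \sum_D cc A B D l x * nab D C t l x.
Proof.
move=> Ux; rewrite !frame_nabla2E //.
have -> : \sum_i \sum_j e l B x 0 i * e l A x 0 j * Z l C t i j x =
   \sum_i \sum_j e l A x 0 i * e l B x 0 j * Z l C t j i x.
  by rewrite exchange_big; apply: eq_bigr => i _; apply: eq_bigr => j _; congr (_ * _); atom_ring.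
have -> : \sum_D cc A B D l x * nab D C t l x =
  \sum_j fd A (fun l z => e l B z 0 j) l x * Y l C t j x -
  \sum_j fd B (fun l z => e l A z 0 j) l x * Y l C t j x.
  under eq_bigr do rewrite frame_nabla_cov mulr_sumr.
  rewrite exchange_big -sumrB; apply: eq_bigr => j _ /=.
  by rewrite -mulrBl commE // mulr_suml; apply: eq_bigr => D _; atom_ring.
set S1 := \sum_j fd A _ _ _ * _; set S2 := \sum_j fd B _ _ _ * _.
move: S1 S2 => S1 S2.
rewrite (_ : _ - _ - _ = (\sum_i \sum_j e l A x 0 i * e l B x 0 j * Z l C t i j x) -
  (\sum_i \sum_j e l A x 0 i * e l B x 0 j * Z l C t j i x)); last by rewrite /Rm; atom_ring.
rewrite -sumrB; apply: eq_bigr => i _; rewrite -sumrB; apply: eq_bigr => j _.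
rewrite -mulrBr.
transitivity (e l A x 0 i * e l B x 0 j * \sum_k e l C x 0 k * Rm l t k i j x).
  by rewrite mulr_sumr; apply: eq_bigr => k _; rewrite !mulrA.
congr (_ * _); rewrite /Z schwarz //.
have -> : \sum_k e l C x 0 k * Rm l t k i j x =
  \sum_k (pd i (Gam l t j k) x * e l C x 0 k - pd j (Gam l t i k) x * e l C x 0 k)
  + (\sum_s Gam l t i s x * (\sum_k Gam l s j k x * e l C x 0 k)
  - \sum_s Gam l t j s x * (\sum_k Gam l s i k x * e l C x 0 k)).
  have -> : (\sum_s Gam l t i s x * (\sum_k Gam l s j k x * e l C x 0 k)
  - \sum_s Gam l t j s x * (\sum_k Gam l s i k x * e l C x 0 k)) =
   \sum_k e l C x 0 k * \sum_s (Gam l t i s x * Gam l s j k x - Gam l t j s x * Gam l s i k x).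
    rewrite -sumrB; under eq_bigr do rewrite !mulr_sumr -sumrB.
    rewrite exchange_big; apply: eq_bigr => k _ /=; rewrite mulr_sumr.
    by apply: eq_bigr => s _; atom_ring.
  by rewrite -big_split; apply: eq_bigr => k _ /=; rewrite /Rm; atom_ring.
have -> : \sum_k (pd i (Gam l t j k) x * e l C x 0 k - pd j (Gam l t i k) x * e l C x 0 k) =
  \sum_k (pd i (Gam l t j k) x * e l C x 0 k + Gam l t j k x * pd i (fun z => e l C z 0 k) x
            + Gam l t i k x * pd j (fun z => e l C z 0 k) x) -
  \sum_k (pd j (Gam l t i k) x * e l C x 0 k + Gam l t i k x * pd j (fun z => e l C z 0 k) x
            + Gam l t j k x * pd i (fun z => e l C z 0 k) x).
  by rewrite -sumrB; apply: eq_bigr => k _; atom_ring.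
by rewrite /Rm; atom_ring.
Qed.

Lemma adm_frame_nabla2 A B C : forall D, adm (fun l x => \sum_t th l D x 0 t * frame_nabla2 A B C t l x).
Proof.
move=> D.
have h t l x : U l x -> frame_nabla2 A B C t l x =
   \sum_E (fd A (conn E B C) l x + \sum_F conn F B C l x * conn E A F l x) * e l E x 0 t.
  move=> Ux; rewrite /frame_nabla2.
  have dc E : diffU U (conn E B C) by exact: adm_diff.
  rewrite (fd_ext e oU A (frame_nablaE complete G B C t)) //.
  rewrite fd_sum; last by move=> E; apply: differentiable_mul; [exact: dc|exact: de].
  have -> : \sum_s (\sum_i e l A x 0 i * Gam l t i s x) * nab B C s l x =
     \sum_F conn F B C l x * (nab A F t l x - fd A (fun l z => e l F z 0 t) l x).
    under eq_bigr do rewrite (frame_nablaE complete) // mulr_sumr.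
    rewrite exchange_big; apply: eq_bigr => F _ /=.
    rewrite /nab addrAC subrr add0r mulr_sumr; apply: eq_bigr => s _.
    by rewrite /Rm; atom_ring.
  under [X in _ + X]eq_bigr do rewrite mulrBr.
  rewrite sumrB addrCA -sumrB.
  under [RHS]eq_bigr do rewrite mulrDl; rewrite [RHS]big_split /= addrC; congr (_ + _).
    apply: eq_bigr => E _; rewrite fdM //; [by atom_ring|exact: dc|exact: de].
  under eq_bigr do rewrite (frame_nablaE complete) // mulr_sumr.
  rewrite exchange_big; apply: eq_bigr => E _ /=.
  by rewrite mulr_suml; apply: eq_bigr => F _; atom_ring.
apply: (@adm_ext _ _ _ _ U e oU (fun l x => \sum_E
   (fd A (conn E B C) l x + \sum_F conn F B C l x * conn E A F l x) *
   \sum_t th l D x 0 t * e l E x 0 t)).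
  move=> l x Ux; under [RHS]eq_bigr do rewrite h // mulr_sumr.
  rewrite [RHS]exchange_big; apply: eq_bigr => E _ /=.
  by rewrite mulr_sumr; apply: eq_bigr => t _; atom_ring.
apply: adm_sum => // E; apply: adm_mul => //; apply: adm_add => //; first exact: adm_fd.
by apply: adm_sum => // F; apply: adm_mul.
Qed.

(** By [curvature_frame] only covariant derivatives of frame fields occur. *)
Lemma adm_curvature A B C D :
  adm (fun l x => \sum_t th l D x 0 t *
    \sum_i \sum_j \sum_k e l A x 0 i * e l B x 0 j * e l C x 0 k * Rm l t k i j x).
Proof.
apply: (@adm_ext _ _ _ _ U e oU (fun l x =>
   (\sum_t th l D x 0 t * frame_nabla2 A B C t l x) - (\sum_t th l D x 0 t * frame_nabla2 B A C t l x)
   - \sum_E cc A B E l x * conn D E C l x)).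
  move=> l x Ux; under [RHS]eq_bigr do rewrite curvature_frame // !mulrBr.
  rewrite !sumrB; congr (_ - _).
  under [RHS]eq_bigr do rewrite mulr_sumr; rewrite [RHS]exchange_big.
  apply: eq_bigr => E _ /=; rewrite /conn mulr_sumr.
  by apply: eq_bigr => t _; atom_ring.
by do 2?[apply: adm_sub => //]; [exact: adm_frame_nabla2|exact: adm_frame_nabla2|
  apply: adm_sum => // E; apply: adm_mul].
Qed.

Lemma sum_ffun0 (X : finType) (P : {ffun 'I_0 -> X} -> R) (J0 : {ffun 'I_0 -> X}) :
  \sum_J P J = P J0.
Proof.
rewrite (big_pred1 J0) // => J; apply/esym/eqP/ffunP; by case.
Qed.

Lemma adm_riemann : adm_tensor U e th (fun l => riemann (G l)).
Proof.
move=> I J.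
pose o1 := lift (ord0 : 'I_3) (ord0 : 'I_2); pose o2 := lift (ord0 : 'I_3) (lift (ord0 : 'I_2) (ord0 : 'I_1)).
apply: (adm_ext oU) _ (adm_curvature (J o1) (J o2) (J ord0) (I ord0)) => l x Ux.
rewrite /frame_comp sum_ffun_recl; apply: eq_bigr => t _ /=.
pose z : {ffun 'I_0 -> 'I_n} := [ffun=> t].
rewrite (sum_ffun0 _ z) mulr_sumr.
under [RHS]eq_bigr => J' _ do rewrite big_ord1 ffcons0.
rewrite sum_ffun_recl.
under [RHS]eq_bigr => k _ do rewrite sum_ffun_recl.
under [RHS]eq_bigr => k _ do under eq_bigr => i _ do rewrite sum_ffun_recl.
under [RHS]eq_bigr => k _ do under eq_bigr => i _ do under eq_bigr => j _ do
  rewrite (sum_ffun0 _ z).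
rewrite [RHS]exchange_big; apply: eq_bigr => i _ /=; rewrite mulr_sumr.
rewrite [RHS]exchange_big; apply: eq_bigr => j _ /=; rewrite mulr_sumr.
apply: eq_bigr => k _.
rewrite /riemann !big_ord_recl big_ord0 mulr1 !ffcons0.
rewrite (_ : inord 0 = ord0 :> 'I_3); last by apply: val_inj; rewrite /= inordK.
rewrite (_ : inord 1 = o1 :> 'I_3); last by apply: val_inj; rewrite /= inordK.
rewrite (_ : inord 2 = o2 :> 'I_3); last by apply: val_inj; rewrite /= inordK.
rewrite !ffcons0 !ffconsS !ffcons0 -/(Rm l t k i j x).
by rewrite /o1 /o2; atom_ring.
Qed.

End Curvature.

(** * Bounds on tensor norms *)

Lemma sum4E (R : realType) (A B C D : finType) (f : A -> B -> C -> D -> R) :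
  \sum_a \sum_b \sum_c \sum_d f a b c d =
  \sum_(p : (A * B) * (C * D)) f p.1.1 p.1.2 p.2.1 p.2.2.
Proof.
rewrite pair_bigA; under eq_bigr do rewrite pair_bigA.
by rewrite pair_bigA.
Qed.

Lemma exchange_sum44 (R : realType) (A B C D A' B' C' D' : finType)
    (f : A -> B -> C -> D -> A' -> B' -> C' -> D' -> R) :
  \sum_a \sum_b \sum_c \sum_d \sum_a' \sum_b' \sum_c' \sum_d' f a b c d a' b' c' d' =
  \sum_a' \sum_b' \sum_c' \sum_d' \sum_a \sum_b \sum_c \sum_d f a b c d a' b' c' d'.
Proof.
rewrite [LHS]sum4E [RHS]sum4E.
under [LHS]eq_bigr do rewrite sum4E; under [RHS]eq_bigr do rewrite sum4E.
exact: exchange_big.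
Qed.

Section NormBound.
Context {R : realType} {n : nat} {M : finType} {L : Type}.
Variables (U : L -> set 'rV[R]_n) (e th : L -> M -> 'rV[R]_n -> 'rV[R]_n).
Hypothesis complete : forall l x, U l x -> forall i j,
  \sum_A e l A x 0 i * th l A x 0 j = (i == j)%:R.
Variable E : L -> 'rV[R]_n -> 'M[R]_n.
Hypothesis bgram : forall A B, bdd U (gram e E A B).
Hypothesis bcogram : forall A B, bdd U (cogram th E A B).

(** Distributivity turns a sum over multi-indices of products of bilinear
    expressions into a product of sums. *)
Lemma sum_prod_bilinear (T : finType) (N : 'I_n -> 'I_n -> R) (V : M -> 'I_n -> R)
    (I I' : {ffun T -> M}) :
  \sum_(J : {ffun T -> 'I_n}) \sum_(J' : {ffun T -> 'I_n})
    (\prod_a V (I a) (J a)) * (\prod_a N (J a) (J' a)) * (\prod_a V (I' a) (J' a)) =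
  \prod_a \sum_i \sum_j V (I a) i * N i j * V (I' a) j.
Proof.
have -> : \prod_a \sum_i \sum_j V (I a) i * N i j * V (I' a) j =
  \sum_(J : {ffun T -> 'I_n}) \prod_a \sum_j V (I a) (J a) * N (J a) j * V (I' a) j.
  by rewrite -(bigA_distr_bigA (fun a i => \sum_j V (I a) i * N i j * V (I' a) j)).
apply: eq_bigr => J _.
rewrite (bigA_distr_bigA (fun a j => V (I a) (J a) * N (J a) j * V (I' a) j)).
by apply: eq_bigr => J' _; rewrite !big_split.
Qed.

(** Completeness lets the norm be computed with the redundant components and
    the Gram matrices of the frame and the coframe. *)
Lemma tnorm_frame p q (B : L -> tensor R n p q) l x : U l x ->
  \sum_(I : {ffun 'I_p -> 'I_n}) \sum_(I' : {ffun 'I_p -> 'I_n})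
    \sum_(J : {ffun 'I_q -> 'I_n}) \sum_(J' : {ffun 'I_q -> 'I_n})
      (\prod_(a < p) E l x (I a) (I' a)) *
      (\prod_(b < q) invmx (E l x) (J b) (J' b)) * (B l x I J * B l x I' J')
  = \sum_(I1 : {ffun 'I_p -> M}) \sum_(I2 : {ffun 'I_p -> M})
    \sum_(J1 : {ffun 'I_q -> M}) \sum_(J2 : {ffun 'I_q -> M})
      (\prod_(a < p) gram e E (I1 a) (I2 a) l x) *
      (\prod_(b < q) cogram th E (J1 b) (J2 b) l x) *
      (frame_comp e th B I1 J1 l x * frame_comp e th B I2 J2 l x).
Proof.
move=> Ux.
pose Ge (I1 : {ffun 'I_p -> M}) (I : {ffun 'I_p -> 'I_n}) := \prod_a e l (I1 a) x 0 (I a).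
pose Gt (J1 : {ffun 'I_q -> M}) (J : {ffun 'I_q -> 'I_n}) := \prod_a th l (J1 a) x 0 (J a).
transitivity (\sum_(I : {ffun 'I_p -> 'I_n}) \sum_(I' : {ffun 'I_p -> 'I_n})
    \sum_(J : {ffun 'I_q -> 'I_n}) \sum_(J' : {ffun 'I_q -> 'I_n})
    \sum_(I1 : {ffun 'I_p -> M}) \sum_(I2 : {ffun 'I_p -> M})
    \sum_(J1 : {ffun 'I_q -> M}) \sum_(J2 : {ffun 'I_q -> M})
   ((Ge I1 I * (\prod_(a < p) E l x (I a) (I' a)) * Ge I2 I') *
    (Gt J1 J * (\prod_(b < q) invmx (E l x) (J b) (J' b)) * Gt J2 J')) *
    (frame_comp e th B I1 J1 l x * frame_comp e th B I2 J2 l x)).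
  apply: eq_bigr => I _; apply: eq_bigr => I' _; apply: eq_bigr => J _; apply: eq_bigr => J' _.
  rewrite (fcompK complete B I J Ux) (fcompK complete B I' J' Ux).
  rewrite big_distrlr /= mulr_sumr; apply: eq_bigr => I1 _.
  rewrite mulr_sumr; apply: eq_bigr => I2 _.
  rewrite big_distrlr /= mulr_sumr; apply: eq_bigr => J1 _.
  rewrite mulr_sumr; apply: eq_bigr => J2 _.
  by rewrite /Ge /Gt; ring.
rewrite exchange_sum44.
apply: eq_bigr => I1 _; apply: eq_bigr => I2 _; apply: eq_bigr => J1 _; apply: eq_bigr => J2 _.
rewrite /gram /cogram; move: (frame_comp e th B I1 J1 l x) (frame_comp e th B I2 J2 l x) => f1 f2.
have hE := sum_prod_bilinear (E l x) (fun A i => e l A x 0 i) I1 I2.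
have hT := sum_prod_bilinear (invmx (E l x)) (fun A i => th l A x 0 i) J1 J2.
rewrite -hE -hT.
rewrite !mulr_suml; apply: eq_bigr => I _; rewrite !mulr_suml; apply: eq_bigr => I' _.
rewrite mulr_sumr mulr_suml; apply: eq_bigr => J _.
by rewrite mulr_sumr mulr_suml; apply: eq_bigr => J' _.
Qed.

Lemma tnorm_bdd p q (B : L -> tensor R n p q) :
  (forall I J, bdd U (frame_comp e th B I J)) ->
  bdd U (fun l x => tnorm (E l) (B l) x).
Proof.
move=> bB.
have [C hC] : bdd U (fun l x => \sum_(I1 : {ffun 'I_p -> M}) \sum_(I2 : {ffun 'I_p -> M})
    \sum_(J1 : {ffun 'I_q -> M}) \sum_(J2 : {ffun 'I_q -> M})
      (\prod_(a < p) gram e E (I1 a) (I2 a) l x) *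
      (\prod_(b < q) cogram th E (J1 b) (J2 b) l x) *
      (frame_comp e th B I1 J1 l x * frame_comp e th B I2 J2 l x)).
  apply: bdd_sum => I1; apply: bdd_sum => I2; apply: bdd_sum => J1; apply: bdd_sum => J2.
  by apply: bdd_mul; apply: bdd_mul => //; apply: bdd_prod.
exists (Num.sqrt C) => l x Ux; rewrite /tnorm tnorm_frame // ger0_norm ?sqrtr_ge0 //.
by rewrite ler_wsqrtr // (le_trans (ler_norm _)) // hC.
Qed.

End NormBound.

(** * Vectors, gradients and bilinear forms in a frame *)

Definition no_index {X : Type} : {ffun 'I_0 -> X} :=
  [ffun b : 'I_0 => match b with Ordinal _ h => match notF h with end end].

Section SmallTensors.
Context {R : realType} {n : nat} {M : finType} {L : Type}.
Variables (U : L -> set 'rV[R]_n) (e th : L -> M -> 'rV[R]_n -> 'rV[R]_n).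
Hypothesis oU : forall l, open (U l).
Hypothesis complete : forall l x, U l x -> forall i j,
  \sum_A e l A x 0 i * th l A x 0 j = (i == j)%:R.
Local Notation fam := (L -> 'rV[R]_n -> R).
Local Notation fd := (frame_diff e).
Local Notation adm := (admissible U e).

Lemma sum_ffun1 (X : finType) (P : {ffun 'I_1 -> X} -> R) :
  \sum_J P J = \sum_j P [ffun=> j].
Proof.
rewrite sum_ffun_recl; apply: eq_bigr => j _; rewrite (sum_ffun0 _ [ffun => j]).
by congr (P _); apply/ffunP => b; rewrite !ffunE; case: unlift => // b'; rewrite ffunE.
Qed.

Lemma fcomp_vector (V : L -> 'rV[R]_n -> 'rV[R]_n) I J l x :
  frame_comp e th (fun l => of_vector (V l)) I J l x = \sum_j th l (I 0) x 0 j * V l x 0 j.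
Proof.
rewrite /frame_comp sum_ffun1; apply: eq_bigr => j _; rewrite (sum_ffun0 _ no_index).
by rewrite big_ord1 big_ord0 mulr1 /of_vector !ffunE.
Qed.

Lemma fcomp_bilinear (B : L -> 'rV[R]_n -> 'M[R]_n) I J l x :
  frame_comp e th (fun l => of_bilinear (B l)) I J l x = gram e B (J 0) (J 1) l x.
Proof.
rewrite /frame_comp (sum_ffun0 _ no_index).
rewrite sum_ffun_recl /gram; apply: eq_bigr => i _; rewrite sum_ffun1; apply: eq_bigr => j _.
rewrite big_ord0 mul1r big_ord_recl big_ord1 /of_bilinear.
have e0 (K : {ffun 'I_1 -> 'I_n}) : ffcons i K 0 = i by exact: ffcons0.
have -> : (1 : 'I_2) = lift ord0 (0 : 'I_1) by exact: val_inj.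
by rewrite e0 !ffconsS !ffunE; ring.
Qed.

(** The frame components of a covector with raised index: completeness makes
    [cogram] the matrix of the operation. *)
Lemma raise_comp (G : L -> 'rV[R]_n -> 'M[R]_n) A (p : 'rV[R]_n) l x : U l x ->
  \sum_j th l A x 0 j * (p *m invmx (G l x)) 0 j =
  \sum_B (\sum_i e l B x 0 i * p 0 i) * cogram th G B A l x.
Proof.
move=> Ux; under [RHS]eq_bigr do rewrite /cogram mulr_suml.
rewrite exchange_big /=.
under [RHS]eq_bigr => i _.
  have -> : \sum_B e l B x 0 i * p 0 i *
      (\sum_i0 \sum_j th l B x 0 i0 * invmx (G l x) i0 j * th l A x 0 j) =
    \sum_i0 (\sum_B e l B x 0 i * th l B x 0 i0) *
      (\sum_j p 0 i * invmx (G l x) i0 j * th l A x 0 j).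
    under [RHS]eq_bigr do rewrite mulr_suml.
    rewrite [RHS]exchange_big; apply: eq_bigr => B _ /=.
    rewrite mulr_sumr; apply: eq_bigr => i0 _.
    by rewrite !mulr_sumr; apply: eq_bigr => j _; ring.
  under eq_bigr do rewrite complete //.
  rewrite (bigD1 i) //= [X in _ + X]big1 ?addr0 => [|i0 i0i]; last by rewrite eq_sym (negbTE i0i) mul0r.
  rewrite eqxx mul1r.
  over.
rewrite exchange_big; apply: eq_bigr => j _ /=.
by rewrite mxE mulr_sumr; apply: eq_bigr => i _; ring.
Qed.

Lemma fcomp_grad (G : L -> 'rV[R]_n -> 'M[R]_n) (F : fam) I J l x : U l x ->
  frame_comp e th (fun l => of_vector (grad (G l) (F l))) I J l x =
  \sum_B fd B F l x * cogram th G B (I 0) l x.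
Proof.
move=> Ux; rewrite fcomp_vector /grad raise_comp //; apply: eq_bigr => B _.
by congr (_ * _); apply: eq_bigr => i _; rewrite mxE.
Qed.

Lemma adm_grad (G : L -> 'rV[R]_n -> 'M[R]_n) (F : fam) :
  (forall A B, adm (cogram th G A B)) -> (forall A, adm (fd A F)) ->
  adm_tensor U e th (fun l => of_vector (grad (G l) (F l))).
Proof.
move=> aG aF I J; apply: (adm_ext oU (F := fun l x => \sum_B fd B F l x * cogram th G B (I 0) l x)).
  by move=> l x Ux; rewrite fcomp_grad.
by apply: (adm_sum oU) => B; exact: (adm_mul oU).
Qed.

End SmallTensors.

(** * The sphere in stereographic charts *)

Ltac diffs := repeat first
  [ assumption | exact: differentiable_coord | exact: differentiable_cst'
  | apply: differentiable_add | apply: differentiable_opp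
  | apply: differentiable_mul ].

Lemma ord2P (i : 'I_2) : i = 0 \/ i = 1.
Proof. by case: i => [[|[|k]] lti] //; [left|right]; apply: val_inj. Qed.

Lemma ord3P (P : 'I_(2 + 1) -> Prop) :
  P (lshift 1 0) -> P (lshift 1 1) -> P (rshift 2 0) -> forall a, P a.
Proof.
move=> p0 p1 p2 a; rewrite -(splitK a); case: (fintype.split a) => j /=.
  by have [->|->] := ord2P j.
by rewrite (ord1 j).
Qed.

Lemma big_ord2 (R : realType) (F : 'I_2 -> R) : \sum_i F i = F 0 + F 1.
Proof. by rewrite !big_ord_recl big_ord0 addr0; congr (_ + F _); apply: val_inj. Qed.

Lemma big_ord3 (R : realType) (F : 'I_(2 + 1) -> R) :
  \sum_i F i = F (lshift 1 0) + F (lshift 1 1) + F (rshift 2 0).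
Proof. by rewrite big_split_ord big_ord2 big_ord1. Qed.

Section StereographicCharts.
Context {R : realType}.
Implicit Types (u : 'rV[R]_2) (c : bool) (a b : 'I_(2 + 1)) (i j : 'I_2).

Lemma sqnorm2 u : sqnorm u = u 0 0 ^+ 2 + u 0 1 ^+ 2.
Proof. exact: big_ord2. Qed.

Lemma sqnorm_gt0 u : 0 < 1 + sqnorm u.
Proof. by rewrite sqnorm2 ltr_pwDl // addr_ge0 // sqr_ge0. Qed.

Lemma sqnorm_neq0 u : 1 + sqnorm u != 0.
Proof. by rewrite gt_eqF // sqnorm_gt0. Qed.

Lemma stereo_l c u i : stereo c u 0 (lshift 1 i) = (1 + sqnorm u)^-1 * (2 * u 0 i).
Proof. by rewrite mxE row_mxEl mxE. Qed.

Lemma stereo_r c u (i : 'I_1) : stereo c u 0 (rshift 2 i) =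
  (1 + sqnorm u)^-1 * ((-1) ^+ c * (sqnorm u - 1)).
Proof. by rewrite mxE row_mxEr mxE ord1 eqxx. Qed.

(** The coordinates of the gradient of the ambient coordinate [a] on the
    sphere: a conformal Killing field, hence polynomial in the chart. *)
Definition Dvec c a u : 'rV[R]_2 :=
  match fintype.split a with
  | inl k => \row_i (2^-1 * (1 + sqnorm u) * (k == i)%:R - u 0 k * u 0 i)
  | inr _ => (-1) ^+ c *: u
  end.

(** The conformal factor of the stereographic charts. *)
Definition lam2 u : R := 4 * ((1 + sqnorm u)^-1 * (1 + sqnorm u)^-1).

Lemma Dvec_l c k u i : Dvec c (lshift 1 k) u 0 i =
  2^-1 * (1 + sqnorm u) * (k == i)%:R - u 0 k * u 0 i.
Proof. by rewrite /Dvec (unsplitK (inl k)) mxE. Qed.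

Lemma Dvec_r c (k : 'I_1) u i : Dvec c (rshift 2 k) u 0 i = (-1) ^+ c * u 0 i.
Proof. by rewrite /Dvec (unsplitK (inr k)) mxE. Qed.

Lemma signM c : (-1) ^+ c * (-1) ^+ c = 1 :> R.
Proof. by case: c; rewrite ?expr1 ?expr0 ?mulrNN mulr1. Qed.

Lemma differentiable_sqnorm u : differentiable (@sqnorm R) u.
Proof.
rewrite /sqnorm; apply: differentiable_bigsum => i.
by apply: (differentiable_mul (f := fun z => z 0 i) (g := fun z => z 0 i)); diffs.
Qed.

Lemma pd_sqnorm i u : pd i (@sqnorm R) u = 2 * u 0 i.
Proof.
rewrite (_ : @sqnorm R = fun z => z 0 0 * z 0 0 + z 0 1 * z 0 1); last first.
  by apply/funext => z; rewrite sqnorm2.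
rewrite pdD; diffs; rewrite !pdM; diffs; rewrite !pd_coord.
by have [->|->] := ord2P i; rewrite /=; ring.
Qed.

Lemma differentiable_stereo_coord c a u : differentiable (fun z => stereo c z 0 a) u.
Proof.
have dV : differentiable (fun z => (1 + @sqnorm R z)^-1) u.
  apply: differentiable_inv; first exact: sqnorm_neq0.
  by apply: differentiable_add; [exact: differentiable_cst'|exact: differentiable_sqnorm].
have dq := differentiable_sqnorm u.
elim/ord3P: a.
- by under eq_fun do rewrite stereo_l; diffs.
- by under eq_fun do rewrite stereo_l; diffs.
- by under eq_fun do rewrite stereo_r; diffs.
Qed.

Lemma differentiable_stereo c u : differentiable (stereo c) u.
Proof. by apply: differentiable_rV => a; exact: differentiable_stereo_coord. Qed.

Lemma pd_stereo c a i u : pd i (fun z => stereo c z 0 a) u = lam2 u * Dvec c a u 0 i.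
Proof.
have dq := differentiable_sqnorm u.
have d1 : differentiable (fun z => 1 + @sqnorm R z) u.
  by apply: differentiable_add; [exact: differentiable_cst'|].
have q0 := sqnorm_neq0 u.
have dV : differentiable (fun z => (1 + @sqnorm R z)^-1) u by exact: differentiable_inv.
have pV : pd i (fun z => (1 + @sqnorm R z)^-1) u =
    - (1 + sqnorm u) ^- 2 * (2 * u 0 i).
  by rewrite pdV // pdD ?pd_cst ?add0r ?pd_sqnorm //; exact: differentiable_cst'.
have pu k : pd i (fun z : 'rV[R]_2 => 2 * z 0 k) u = 2 * (k == i)%:R.
  by rewrite pdM ?pd_cst ?pd_coord ?mul0r ?add0r //; diffs.
elim/ord3P: a.
- under eq_fun do rewrite stereo_l.
  rewrite pdM ?pV ?pu ?Dvec_l //; diffs.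
  by rewrite /lam2; field.
- under eq_fun do rewrite stereo_l.
  rewrite pdM ?pV ?pu ?Dvec_l //; diffs.
  by rewrite /lam2; field.
- under eq_fun do rewrite stereo_r.
  rewrite pdM //; diffs; rewrite pV pdM; diffs; rewrite pd_cst mul0r add0r.
  rewrite pdB; diffs; rewrite pd_sqnorm pd_cst Dvec_r /lam2; field.
  exact: q0.
Qed.

Lemma lam2_neq0 u : lam2 u != 0.
Proof. by rewrite /lam2 !mulf_neq0 ?pnatr_eq0 // invr_neq0 // sqnorm_neq0. Qed.

(** The metric of the chart is [lam2] times the flat one, so this says that the
    gradients of the ambient coordinates form a tight frame. *)
Lemma Dvec_tight c u i j :
  \sum_a Dvec c a u 0 i * Dvec c a u 0 j = (lam2 u)^-1 * (i == j)%:R.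
Proof.
rewrite big_ord3 !Dvec_l !Dvec_r /lam2 (sqnorm2 u).
have : 1 + (u 0 0 ^+ 2 + u 0 1 ^+ 2) != 0 by rewrite -sqnorm2 sqnorm_neq0.
move=> q0; rewrite mulrACA signM mul1r.
by have [->|->] := ord2P i; have [->|->] := ord2P j; rewrite /=; field.
Qed.

Lemma Dvec_complete c u i j :
  \sum_a Dvec c a u 0 i * (lam2 u * Dvec c a u 0 j) = (i == j)%:R.
Proof.
under eq_bigr do rewrite mulrCA.
by rewrite -mulr_sumr Dvec_tight mulrA mulfV ?lam2_neq0 // mul1r.
Qed.

(** The Gram matrix of the gradients is the projection to the tangent plane. *)
Lemma Dvec_stereo c a b u :
  \sum_i Dvec c b u 0 i * (lam2 u * Dvec c a u 0 i) =
  (b == a)%:R - stereo c u 0 b * stereo c u 0 a.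
Proof.
have : 1 + (u 0 0 ^+ 2 + u 0 1 ^+ 2) != 0 by rewrite -sqnorm2 sqnorm_neq0.
rewrite big_ord2 /lam2 => q0.
elim/ord3P: a; elim/ord3P: b; rewrite ?stereo_l ?stereo_r ?Dvec_l ?Dvec_r sqnorm2 /=;
  by case: c; rewrite ?expr1 ?expr0; field.
Qed.

Lemma differentiable_Dvec c a i u : differentiable (fun z => Dvec c a z 0 i) u.
Proof.
have dq := differentiable_sqnorm u.
by elim/ord3P: a; under eq_fun do rewrite ?Dvec_l ?Dvec_r; diffs.
Qed.

Lemma pd_Dvec_l c k i j u : pd j (fun z => Dvec c (lshift 1 k) z 0 i) u =
  u 0 j * (k == i)%:R - (k == j)%:R * u 0 i - u 0 k * (i == j)%:R.
Proof.
have dq := differentiable_sqnorm u.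
under eq_fun do rewrite Dvec_l.
rewrite pdB; diffs; rewrite !pdM; diffs; rewrite pdD; diffs.
by rewrite !pd_cst !pd_coord pd_sqnorm; field.
Qed.

Lemma pd_Dvec_r c (k : 'I_1) i j u : pd j (fun z => Dvec c (rshift 2 k) z 0 i) u =
  (-1) ^+ c * (i == j)%:R.
Proof.
under eq_fun do rewrite Dvec_r.
by rewrite pdM; diffs; rewrite pd_cst pd_coord mul0r add0r.
Qed.

(** [[D_a, D_b] = y_a D_b - y_b D_a]: up to sign the field [[D_a, D_b]] is the
    rotation in the plane of the coordinates [a] and [b]. *)
Lemma Dvec_comm c a b i u :
  \sum_j Dvec c a u 0 j * pd j (fun z => Dvec c b z 0 i) u
  - \sum_j Dvec c b u 0 j * pd j (fun z => Dvec c a z 0 i) u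
  = stereo c u 0 a * Dvec c b u 0 i - stereo c u 0 b * Dvec c a u 0 i.
Proof.
have : 1 + (u 0 0 ^+ 2 + u 0 1 ^+ 2) != 0 by rewrite -sqnorm2 sqnorm_neq0.
rewrite !big_ord2 => q0.
elim/ord3P: a; elim/ord3P: b; rewrite ?pd_Dvec_l ?pd_Dvec_r ?stereo_l ?stereo_r ?Dvec_l
  ?Dvec_r sqnorm2; have [->|->] := ord2P i; rewrite /=;
  by case: c; rewrite ?expr1 ?expr0; field.
Qed.

(** The sum of the squares of the [D_a] has no first order part in the charts. *)
Lemma Dvec_div c i u :
  \sum_a \sum_j Dvec c a u 0 j * pd j (fun z => Dvec c a z 0 i) u = 0.
Proof.
rewrite big_ord3 !big_ord2 ?pd_Dvec_l ?pd_Dvec_r ?Dvec_l ?Dvec_r sqnorm2.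
by have [->|->] := ord2P i; rewrite /=; case: c; rewrite ?expr1 ?expr0; field.
Qed.

Lemma differentiable_lam2 u : differentiable lam2 u.
Proof.
have dV : differentiable (fun z => (1 + @sqnorm R z)^-1) u.
  apply: differentiable_inv; first exact: sqnorm_neq0.
  by apply: differentiable_add; [exact: differentiable_cst'|exact: differentiable_sqnorm].
by apply: differentiable_mul; first exact: differentiable_cst'; exact: differentiable_mul.
Qed.

Lemma sphere_metricE c u : sphere_metric c u = (lam2 u)%:M.
Proof.
apply/matrixP => i j; rewrite /sphere_metric /pullback mulmx1 !mxE.
under eq_bigr do rewrite [_^T _ _]mxE !(jacobianE _ _ (differentiable_stereo _ _)) !pd_stereo mulrACA.
rewrite -mulr_sumr Dvec_tight mulrA mulfK ?lam2_neq0 //.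
by rewrite mulr_natr.
Qed.

Lemma invmx_sphere_metric c u : invmx (sphere_metric c u) = ((lam2 u)^-1)%:M.
Proof. by rewrite sphere_metricE invmx_scalar. Qed.

Definition Dop c a (h : 'rV[R]_2 -> R) u := \sum_i Dvec c a u 0 i * pd i h u.

Lemma sum_DopM c (h k : 'rV[R]_2 -> R) u :
  \sum_a Dop c a h u * Dop c a k u = (lam2 u)^-1 * \sum_i pd i h u * pd i k u.
Proof.
under eq_bigr do rewrite /Dop big_distrlr /=.
rewrite exchange_big mulr_sumr; apply: eq_bigr => i _ /=.
rewrite exchange_big (bigD1 i) //= [X in _ + X]big1 ?addr0 => [|j ji].
  transitivity ((\sum_a Dvec c a u 0 i * Dvec c a u 0 i) * (pd i h u * pd i k u)).
    by rewrite mulr_suml; apply: eq_bigr => a _; ring.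
  by rewrite Dvec_tight eqxx mulr1.
transitivity ((\sum_a Dvec c a u 0 i * Dvec c a u 0 j) * (pd i h u * pd j k u)).
  by rewrite mulr_suml; apply: eq_bigr => a _; ring.
by rewrite Dvec_tight eq_sym (negbTE ji) mulr0 mul0r.
Qed.

Lemma gradE c (h : 'rV[R]_2 -> R) u i :
  grad (sphere_metric c) h u 0 i = (lam2 u)^-1 * pd i h u.
Proof. by rewrite /grad invmx_sphere_metric mul_mx_scalar !mxE. Qed.

Lemma ip_grad c (h k : 'rV[R]_2 -> R) u :
  ip (sphere_metric c u) (grad (sphere_metric c) h u) (grad (sphere_metric c) k u) =
  \sum_a Dop c a h u * Dop c a k u.
Proof.
rewrite /ip sphere_metricE mul_mx_scalar -scalemxAl !mxE sum_DopM !mulr_sumr.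
apply: eq_bigr => i _; rewrite [_^T _ _]mxE !gradE.
by field; exact: lam2_neq0.
Qed.

(** The right-hand side is the Laplacian of the sphere, the dimension being two. *)
Lemma sum_DopDop c (h : 'rV[R]_2 -> R) u : (forall i, differentiable (pd i h) u) ->
  \sum_a Dop c a (Dop c a h) u = (lam2 u)^-1 * \sum_i pd i (pd i h) u.
Proof.
move=> dh.
have e1 a : Dop c a (Dop c a h) u =
  \sum_j (\sum_i Dvec c a u 0 i * pd i (fun z => Dvec c a z 0 j) u) * pd j h u
  + \sum_i \sum_j Dvec c a u 0 i * Dvec c a u 0 j * pd i (pd j h) u.
  rewrite {1}/Dop.
  under [X in X + _]eq_bigr do rewrite mulr_suml.
  rewrite exchange_big -big_split; apply: eq_bigr => i _ /=.
  rewrite /Dop pd_bigsum => [|j]; last first.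
    by apply: differentiable_mul => //; exact: differentiable_Dvec.
  rewrite mulr_sumr -big_split; apply: eq_bigr => j _ /=.
  by rewrite pdM //; [ring|exact: differentiable_Dvec].
under eq_bigr do rewrite e1; rewrite big_split /= exchange_big /=.
rewrite [X in X + _]big1 ?add0r => [|j _]; last by rewrite -mulr_suml Dvec_div mul0r.
rewrite exchange_big mulr_sumr; apply: eq_bigr => i _ /=.
rewrite exchange_big (bigD1 i) //= [X in _ + X]big1 ?addr0 => [|j ji].
  by rewrite -mulr_suml Dvec_tight eqxx mulr1.
by rewrite -mulr_suml Dvec_tight eq_sym (negbTE ji) mulr0 mul0r.
Qed.

Lemma laplacianE c (h : 'rV[R]_2 -> R) u : (forall i, differentiable (pd i h) u) ->
  laplacian (sphere_metric c) h u = \sum_a Dop c a (Dop c a h) u.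
Proof.
move=> dh; rewrite sum_DopDop // /laplacian.
have dl := differentiable_lam2 u; have l0 := lam2_neq0 u.
have dV : differentiable (fun z => (lam2 z)^-1) u by exact: differentiable_inv.
have eG : (fun z => sphere_metric c z) = (fun z => (lam2 z)%:M).
  by apply/funext => z; rewrite sphere_metricE.
have chr i k : christoffel (sphere_metric c) i i k u =
   2^-1 * (lam2 u)^-1 * pd k lam2 u.
  rewrite /christoffel (bigD1 i) //= [X in _ + X]big1 ?addr0 => [|l li]; last first.
    by rewrite invmx_sphere_metric mxE eq_sym (negbTE li) mulr0n mul0r.
  rewrite invmx_sphere_metric mxE eqxx mulr1n mulrA; congr (_ * _).
  rewrite addrAC; set S := (X in X + _).
  have -> : S = 0.
    rewrite /S; apply/eqP; rewrite subr_eq0; apply/eqP; congr (pd i _ u).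
    by apply/funext => z; rewrite sphere_metricE !mxE eq_sym.
  rewrite add0r; congr (pd k _ u); apply/funext => z.
  by rewrite sphere_metricE mxE eqxx.
rewrite mulr_sumr.
transitivity (\sum_i (pd i (fun z => (lam2 z)^-1 * pd i h z) u +
    \sum_l 2^-1 * (lam2 u)^-1 * pd l lam2 u * ((lam2 u)^-1 * pd l h u))).
  apply: eq_bigr => i _; rewrite /cov big_ord0 subr0 big_ord1 ffunE /of_vector.
  congr (_ + _).
    by congr (pd i _ u); apply/funext => z; rewrite gradE ffunE.
  by apply: eq_bigr => l _; rewrite !ffunE /= chr gradE.
have pdq i : pd i (fun z => (lam2 z)^-1 * pd i h z) u =
    - lam2 u ^- 2 * pd i lam2 u * pd i h u + (lam2 u)^-1 * pd i (pd i h) u.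
  by rewrite (pdM i dV (dh i)) (pdV i l0 dl).
rewrite !big_ord2 !pdq; clear -l0.
move: (pd 0 (pd 0 h) u) (pd 1 (pd 1 h) u) (pd 0 h u) (pd 1 h u) => h00 h11 h0 h1.
move: (pd 0 lam2 u) (pd 1 lam2 u) (lam2 u) l0 => l0' l1' l l0.
by field.
Qed.

End StereographicCharts.

(** * Functions on the sphere as ambient functions *)

Section AmbientFunctions.
Context {R : realType}.
Implicit Types (u : 'rV[R]_2) (c : bool) (a b : 'I_(2 + 1)) (i j : 'I_2).
Implicit Types (F : 'rV[R]_(2 + 1) -> R) (y : 'rV[R]_(2 + 1)).

Definition nonzero : set 'rV[R]_(2 + 1) := [set y | 0 < \sum_i y 0 i ^+ 2].

Lemma differentiable_sumsq y : differentiable (fun z : 'rV[R]_(2 + 1) => \sum_i z 0 i ^+ 2) y.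
Proof.
apply: differentiable_bigsum => i.
by apply: (differentiable_mul (f := fun z => z 0 i) (g := fun z => z 0 i)); diffs.
Qed.

Lemma open_nonzero : open nonzero.
Proof.
apply: (@open_comp _ _ (fun y => \sum_i y 0 i ^+ 2) [set r | 0 < r]); last exact: open_gt.
by move=> y _; exact: (differentiable_continuous (differentiable_sumsq y)).
Qed.

(** Derivative of the restriction of [F] to the unit sphere along the gradient
    of the ambient coordinate [a]. *)
Definition DS a F y := \sum_b ((a == b)%:R - y 0 a * y 0 b) * pd b F y.

Lemma smooth_DS a F : smooth_on nonzero F -> smooth_on nonzero (DS a F).
Proof.
move=> sF; apply: smooth_expr_on; first exact: open_nonzero.
apply: smooth_expr_sum => b; apply: SmoothMul; last first.
  by apply: SmoothBase; exact: smooth_on_pd.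
by smooths.
Qed.

Lemma stereo_on_sphere c u : on_sphere (stereo c u).
Proof.
have : 1 + (u 0 0 ^+ 2 + u 0 1 ^+ 2) != 0 by rewrite -sqnorm2 sqnorm_neq0.
rewrite /on_sphere big_ord3 !stereo_l stereo_r sqnorm2 => q0.
by case: c; rewrite ?expr1 ?expr0; field.
Qed.

Lemma on_sphere_nonzero y : on_sphere y -> nonzero y.
Proof.
by rewrite /on_sphere /nonzero /= => ->.
Qed.

Lemma compact_sphere : compact [set y : 'rV[R]_(2 + 1) | on_sphere y].
Proof.
apply: bounded_closed_compact.
  exists 1; split => // M M1 y /= hy; rewrite /Num.Def.normr /= mx_normrE.
  apply: bigmax_le => [|[i j] _ /=]; first by rewrite (le_trans _ (ltW M1)).
  rewrite (le_trans _ (ltW M1)) // -(ler_pXn2r (n := 2)) ?nnegrE // expr1n.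
  rewrite real_normK ?num_real // (ord1 i) -hy (bigD1 j) //= lerDl.
  by apply: sumr_ge0 => k _; exact: sqr_ge0.
rewrite (_ : [set y | on_sphere y] = (fun y : 'rV[R]_(2 + 1) => \sum_i y 0 i ^+ 2) @^-1` [set 1]) //.
apply: closed_comp => [y _|]; last exact: closed_eq.
exact: (differentiable_continuous (differentiable_sumsq y)).
Qed.

(** Compactness of the sphere. *)
Lemma smooth_bdd F : smooth_on nonzero F ->
  exists C, forall c u, `|F (stereo c u)| <= C.
Proof.
move=> sF.
have cF : {within [set y | on_sphere y], continuous F}.
  apply: continuous_in_subspaceT => y; rewrite inE => hy.
  apply: differentiable_continuous; apply: (smooth_on_differentiable sF).
  exact: on_sphere_nonzero.
have := compact_bounded (continuous_compact cF compact_sphere).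
move=> [C [_ hC]]; exists (C + 1) => c u.
by apply: (hC (C + 1)); rewrite ?ltrDl //; exists (stereo c u) => //; exact: stereo_on_sphere.
Qed.

Lemma Dop_stereo c a F u : smooth_on nonzero F ->
  Dop c a (F \o stereo c) u = DS a F (stereo c u).
Proof.
move=> sF; rewrite /Dop.
have dF : differentiable F (stereo c u).
  by apply: (smooth_on_differentiable sF); apply: on_sphere_nonzero; exact: stereo_on_sphere.
transitivity (\sum_i Dvec c a u 0 i * \sum_b (lam2 u * Dvec c b u 0 i) * pd b F (stereo c u)).
  apply: eq_bigr => i _; congr (_ * _).
  rewrite (pd_comp i (differentiable_stereo c u) dF).
  by apply: eq_bigr => b _; rewrite pd_stereo.
under eq_bigr do rewrite mulr_sumr; rewrite exchange_big; apply: eq_bigr => b _ /=.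
by rewrite -Dvec_stereo mulr_suml; apply: eq_bigr => i _; rewrite mulrA.
Qed.

Lemma smooth_stereo c a : smooth_expr setT (fun z : 'rV[R]_2 => stereo c z 0 a).
Proof.
have sq : smooth_expr setT (@sqnorm R).
  by rewrite /sqnorm; apply: smooth_expr_sum => i; smooths.
have sV : smooth_expr setT (fun z => (1 + @sqnorm R z)^-1).
  by apply: (@SmoothInv _ _ _ (fun z => 1 + @sqnorm R z)) => [|z _]; [smooths|exact: sqnorm_neq0].
by elim/ord3P: a; under eq_fun do rewrite ?stereo_l ?stereo_r; smooths.
Qed.

Lemma smooth_comp_stereo c F : smooth_on nonzero F -> smooth_on setT (F \o stereo c).
Proof.
move=> sF; apply: smooth_expr_on; first exact: openT.
apply: (SmoothComp sF) => [a|u _]; first exact: smooth_stereo.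
by apply: on_sphere_nonzero; exact: stereo_on_sphere.
Qed.

(** The extension that is constant on rays: it makes the values of [F] on the
    sphere accessible to the ambient operators [DS]. *)
Definition radial F y := F ((Num.sqrt (\sum_i y 0 i ^+ 2))^-1 *: y).

Lemma radialE F y : on_sphere y -> radial F y = F y.
Proof. by rewrite /radial /on_sphere => ->; rewrite sqrtr1 invr1 scale1r. Qed.

Lemma on_sphere_normalize y : nonzero y ->
  on_sphere ((Num.sqrt (\sum_i y 0 i ^+ 2))^-1 *: y).
Proof.
move=> y0; rewrite /on_sphere; under eq_bigr do rewrite mxE exprMn.
rewrite -mulr_sumr exprVn sqr_sqrtr ?ltW // mulVf // gt_eqF //.
Qed.

Lemma on_sphere_r y : on_sphere y ->
  y 0 (lshift 1 0) ^+ 2 + y 0 (lshift 1 1) ^+ 2 = 1 - y 0 (rshift 2 0) ^+ 2.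
Proof. by rewrite /on_sphere big_ord3 => <-; rewrite addrK. Qed.

Lemma stereoK c y : on_sphere y -> 1 - (-1) ^+ c * y 0 (rshift 2 0) != 0 ->
  stereo c (stereo_proj c y) = y.
Proof.
move=> /on_sphere_r hy h0.
have pE i : stereo_proj c y 0 i = (1 - (-1) ^+ c * y 0 (rshift 2 0))^-1 * y 0 (lshift 1 i).
  by rewrite /stereo_proj !mxE.
have sE : sqnorm (stereo_proj c y) = (1 - (-1) ^+ c * y 0 (rshift 2 0)) ^- 2 *
    (1 - y 0 (rshift 2 0) ^+ 2).
  by rewrite sqnorm2 !pE -hy !exprMn exprVn mulrDr.
have s1E : 1 + sqnorm (stereo_proj c y) = 2 * (1 - (-1) ^+ c * y 0 (rshift 2 0))^-1.
  rewrite sE; move: h0; move: (y 0 (rshift 2 0)) => z; clear.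
  by case: c; rewrite ?expr1 ?expr0 ?mulN1r ?opprK ?mul1r => h0; field.
apply/rowP; elim/ord3P; rewrite ?stereo_l ?stereo_r ?pE s1E.
- by rewrite (mulrA 2) mulKf // mulf_neq0 ?pnatr_eq0 // invr_neq0.
- by rewrite (mulrA 2) mulKf // mulf_neq0 ?pnatr_eq0 // invr_neq0.
rewrite (_ : sqnorm _ = 2 * (1 - (-1) ^+ c * y 0 (rshift 2 0))^-1 - 1); last first.
  by rewrite -s1E addrAC subrr add0r.
move: h0; move: (y 0 (rshift 2 0)) => z; clear.
by case: c; rewrite ?expr1 ?expr0 ?mulN1r ?opprK ?mul1r => h0; field.
Qed.

Definition off_pole c : set 'rV[R]_(2 + 1) :=
  nonzero `&` [set y | 0 < Num.sqrt (\sum_i y 0 i ^+ 2) - (-1) ^+ c * y 0 (rshift 2 0)].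

Lemma open_off_pole c : open (off_pole c).
Proof.
rewrite openE => y [y0 hy].
have cy : {for y, continuous (fun y => Num.sqrt (\sum_i y 0 i ^+ 2) - (-1) ^+ c * y 0 (rshift 2 0))}.
  apply: differentiable_continuous; apply: differentiable_add; last by diffs.
  by apply: differentiable_sqrt => //; exact: differentiable_sumsq.
apply: filterI; first by apply: open_nbhs_nbhs; split=> //; exact: open_nonzero.
by apply: (cy [set r : R | 0 < r]); apply: open_nbhs_nbhs; split => //; exact: open_gt.
Qed.

(** Off the pole of a chart the radial extension is a composition of smooth maps
    through that chart; the two charts cover the complement of the origin. *)
Lemma smooth_radial f : smooth_on_sphere f -> smooth_on nonzero (radial f).
Proof.
move=> sf.
have h c : smooth_on (off_pole c) (radial f).
  set r := fun y : 'rV[R]_(2 + 1) => (Num.sqrt (\sum_i y 0 i ^+ 2))^-1.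
  have snz y : off_pole c y -> 0 < \sum_i y 0 i ^+ 2 by case.
  have p0 y : off_pole c y -> 1 - (-1) ^+ c * (r y *: y) 0 (rshift 2 0) != 0.
    move=> [y0 hy]; have s0 : 0 < Num.sqrt (\sum_i y 0 i ^+ 2) by rewrite sqrtr_gt0.
    rewrite mxE mulrCA -{1}(mulVf (lt0r_neq0 s0)) -mulrBr mulf_neq0 //.
      by rewrite invr_neq0 // lt0r_neq0.
    by rewrite lt0r_neq0.
  apply: (@smooth_on_ext _ _ _ (fun y => (f \o stereo c) (stereo_proj c (r y *: y)))).
  - exact: open_off_pole.
  - move=> y hy /=; rewrite stereoK //; first by apply: on_sphere_normalize; case: hy.
    exact: p0.
  apply: smooth_expr_on; first exact: open_off_pole.
  have sr : smooth_expr (off_pole c) r.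
    apply: (@SmoothInv _ _ _ (fun y => Num.sqrt (\sum_i y 0 i ^+ 2))).
      apply: (@SmoothSqrt _ _ _ (fun y => \sum_i y 0 i ^+ 2)) => //.
      by apply: smooth_expr_sum => i; smooths.
    by move=> y /snz s0; rewrite gt_eqF // sqrtr_gt0.
  apply: (SmoothComp (sf c)) => // i.
  under eq_fun do rewrite /stereo_proj !mxE.
  apply: SmoothMul; last by smooths.
  apply: (@SmoothInv _ _ _ (fun y => 1 - (-1) ^+ c * (r y * y 0 (rshift 2 0)))).
    by smooths.
  by move=> y /p0; rewrite mxE.
move=> s y y0.
have [c hc] : exists c, off_pole c y.
  have s0 : 0 < Num.sqrt (\sum_i y 0 i ^+ 2) by rewrite sqrtr_gt0.
  have [z0|z0] := leP 0 (y 0 (rshift 2 0)).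
    by exists true; split => //=; rewrite expr1 mulN1r opprK ltr_wpDr.
  by exists false; split => //=; rewrite expr0 mul1r subr_gt0 (lt_trans z0).
exact: (h c s y hc).
Qed.

Lemma radial_stereo f c u : radial f (stereo c u) = f (stereo c u).
Proof. by rewrite radialE //; exact: stereo_on_sphere. Qed.

End AmbientFunctions.

(** * The frame on a product with the sphere *)

Section PolynomialFunctions.
Context {R : realType} {n : nat}.

(** The coordinates of the frame are polynomials: this gives their smoothness and
    the symmetry of their second derivatives. *)
Inductive poly_fun : ('rV[R]_n -> R) -> Prop :=
| PolyCst a : poly_fun (fun=> a)
| PolyCoord j : poly_fun (fun z => z 0 j)
| PolyAdd F G : poly_fun F -> poly_fun G -> poly_fun (fun z => F z + G z)
| PolyMul F G : poly_fun F -> poly_fun G -> poly_fun (fun z => F z * G z).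

Lemma PolyOpp F : poly_fun F -> poly_fun (fun z => - F z).
Proof.
move=> pF; rewrite (_ : (fun z => - F z) = (fun z => -1 * F z)).
  by apply: PolyMul => //; exact: PolyCst.
by apply/funext => z; rewrite mulN1r.
Qed.

Lemma poly_fun_diff F x : poly_fun F -> differentiable F x.
Proof.
elim=> {F} [a|j|F G _ dF _ dG|F G _ dF _ dG].
- exact: differentiable_cst'.
- exact: differentiable_coord.
- exact: differentiable_add.
- exact: differentiable_mul.
Qed.

Lemma poly_fun_pd F i : poly_fun F -> poly_fun (pd i F).
Proof.
elim=> {F} [a|j|F G pF dF pG dG|F G pF dF pG dG].
- by rewrite (_ : pd i _ = fun=> 0); [exact: PolyCst|apply/funext => x; exact: pd_cst].
- rewrite (_ : pd i _ = fun=> (j == i)%:R); first exact: PolyCst.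
  by apply/funext => x; exact: pd_coord.
- rewrite (_ : pd i _ = fun z => pd i F z + pd i G z); first exact: PolyAdd.
  by apply/funext => x; rewrite pdD //; exact: poly_fun_diff.
- rewrite (_ : pd i _ = fun z => pd i F z * G z + F z * pd i G z).
    by apply: PolyAdd; exact: PolyMul.
  by apply/funext => x; rewrite pdM //; exact: poly_fun_diff.
Qed.

Lemma poly_fun_schwarz F i j x : poly_fun F -> pd i (pd j F) x = pd j (pd i F) x.
Proof.
move=> pF; elim: pF x => {F} [a|k|F G pF hF pG hG|F G pF hF pG hG] x.
- have e s : pd s (fun=> a) = (fun=> 0 : R) :> ('rV[R]_n -> R).
    by apply/funext => z; exact: pd_cst.
  by rewrite !e !pd_cst.
- have e s : pd s (fun z => z 0 k) = (fun=> (k == s)%:R : R) :> ('rV[R]_n -> R).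
    by apply/funext => z; exact: pd_coord.
  by rewrite !e !pd_cst.
- have e s : pd s (fun z => F z + G z) = fun z => pd s F z + pd s G z.
    by apply/funext => z; rewrite pdD //; exact: poly_fun_diff.
  by rewrite !e !pdD ?hF ?hG //; apply: poly_fun_diff; exact: poly_fun_pd.
- have e s : pd s (fun z => F z * G z) = fun z => pd s F z * G z + F z * pd s G z.
    by apply/funext => z; rewrite pdM //; exact: poly_fun_diff.
  have dp s H : poly_fun H -> differentiable (pd s H) x.
    by move=> pH; apply: poly_fun_diff; exact: poly_fun_pd.
  have d H : poly_fun H -> differentiable H x by exact: poly_fun_diff.
  rewrite !e !pdD; do ?[exact: differentiable_mul (dp _ _ _) (d _ _)|
    exact: differentiable_mul (d _ _) (dp _ _ _)].
  rewrite !pdM; do ?[exact: dp|exact: d].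
  rewrite hF hG.
  move: (pd j (pd i F) x) (pd j (pd i G) x) (pd i F x) (pd j F x) (pd i G x) (pd j G x) => *.
  by move: (F x) (G x) => *; clear; ring.
Qed.

End PolynomialFunctions.

Section ProductCoordinates.
Context {R : realType} {n1 n2 : nat}.
Implicit Types (h : 'rV[R]_n1 -> R) (q : 'rV[R]_(n1 + n2)).

Lemma pd_comp_lsubmx h i q : differentiable h (lsubmx q) ->
  pd (lshift n2 i) (fun z => h (lsubmx z)) q = pd i h (lsubmx q).
Proof.
move=> dh; rewrite (pd_comp _ (differentiable_lsubmx q) dh) (bigD1 i) //=.
have e j : pd (lshift n2 i) (fun z : 'rV[R]_(n1 + n2) => lsubmx z 0 j) q = (j == i)%:R.
  by under eq_fun do rewrite mxE; rewrite pd_coord eq_lshift.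
rewrite e eqxx mul1r big1 ?addr0 // => j ji.
by rewrite e (negbTE ji) mul0r.
Qed.

Lemma pd_comp_lsubmx0 h i q : differentiable h (lsubmx q) ->
  pd (rshift n1 i) (fun z => h (lsubmx z)) q = 0.
Proof.
move=> dh; rewrite (pd_comp _ (differentiable_lsubmx q) dh) big1 // => j _.
under eq_fun do rewrite mxE; rewrite pd_coord eq_lrshift mul0r //.
Qed.

Lemma differentiable_comp_lsubmx h q : differentiable h (lsubmx q) ->
  differentiable (fun z => h (lsubmx z)) q.
Proof. by move=> dh; apply: differentiable_comp => //; exact: differentiable_lsubmx. Qed.

End ProductCoordinates.

Section ProductFrame.
Context {R : realType} {k : nat} {L : Type}.
Variables (ch : L -> bool) (U : L -> set 'rV[R]_(2 + k.+1)) (x0 : R).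
Hypothesis oU : forall l, open (U l).
Implicit Types (q : 'rV[R]_(2 + k.+1)).

Definition xq q : R := q 0 (rshift 2 0).

Hypothesis Ux : forall l q, U l q -> 0 < xq q < x0.

Implicit Types (A B C : ('I_(2 + 1) + 'I_k.+1)%type) (a b : 'I_(2 + 1)) (j : 'I_k.+1).

(** The vector fields [x D_a] and [x d/dz_j] on the product of the sphere with
    the half space of the coordinates [z], whose first coordinate is [x]. *)
Definition prod_frame (l : L) A q : 'rV[R]_(2 + k.+1) :=
  match A with
  | inl a => row_mx (xq q *: Dvec (ch l) a (lsubmx q)) 0
  | inr j => row_mx 0 (xq q *: delta_mx 0 j)
  end.

(** The covectors [d y_a / x] and [d z_j / x]. *)
Definition prod_coframe (l : L) A q : 'rV[R]_(2 + k.+1) :=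
  match A with
  | inl a => row_mx (((xq q)^-1 * lam2 (lsubmx q)) *: Dvec (ch l) a (lsubmx q)) 0
  | inr j => row_mx 0 ((xq q)^-1 *: delta_mx 0 j)
  end.

Arguments prod_frame : simpl never.
Arguments prod_coframe : simpl never.

Lemma ef_ll l a q i : prod_frame l (inl a) q 0 (lshift _ i) = xq q * Dvec (ch l) a (lsubmx q) 0 i.
Proof. by rewrite /prod_frame row_mxEl mxE. Qed.

Lemma ef_lr l a q i : prod_frame l (inl a) q 0 (rshift _ i) = 0.
Proof. by rewrite /prod_frame row_mxEr mxE. Qed.

Lemma ef_rl l j q i : prod_frame l (inr j) q 0 (lshift _ i) = 0.
Proof. by rewrite /prod_frame row_mxEl mxE. Qed.

Lemma ef_rr l j q i : prod_frame l (inr j) q 0 (rshift _ i) = xq q * (i == j)%:R.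
Proof. by rewrite /prod_frame row_mxEr !mxE eqxx. Qed.

Lemma thf_ll l a q i : prod_coframe l (inl a) q 0 (lshift _ i) =
  (xq q)^-1 * (lam2 (lsubmx q) * Dvec (ch l) a (lsubmx q) 0 i).
Proof. by rewrite /prod_coframe row_mxEl mxE -mulrA. Qed.

Lemma thf_lr l a q i : prod_coframe l (inl a) q 0 (rshift _ i) = 0.
Proof. by rewrite /prod_coframe row_mxEr mxE. Qed.

Lemma thf_rl l j q i : prod_coframe l (inr j) q 0 (lshift _ i) = 0.
Proof. by rewrite /prod_coframe row_mxEl mxE. Qed.

Lemma thf_rr l j q i : prod_coframe l (inr j) q 0 (rshift _ i) = (xq q)^-1 * (i == j)%:R.
Proof. by rewrite /prod_coframe row_mxEr !mxE eqxx. Qed.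

Definition frE := (ef_ll, ef_lr, ef_rl, ef_rr, thf_ll, thf_lr, thf_rl, thf_rr).

Lemma xq_neq0 l q : U l q -> xq q != 0.
Proof. by move=> /Ux /andP[x_gt0 _]; rewrite gt_eqF. Qed.

(** On the sphere this is the tightness of the gradients [D_a]. *)
Lemma complete_ef l q : U l q -> forall i s,
  \sum_A prod_frame l A q 0 i * prod_coframe l A q 0 s = (i == s)%:R.
Proof.
move=> Uq i j; rewrite big_sumType /=; have xn := xq_neq0 Uq.
rewrite -(splitK i) -(splitK j).
case: (fintype.split i) => i'; case: (fintype.split j) => j' /=.
- rewrite [X in _ + X]big1 ?addr0 => [|b _]; last by rewrite !frE mul0r.
  under eq_bigr do rewrite !frE mulrACA mulfV // mul1r.
  by rewrite Dvec_complete eq_lshift.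
- rewrite [X in X + _]big1 ?add0r; last by move=> b _; rewrite !frE ?mul0r ?mulr0.
  rewrite big1; last by move=> b _; rewrite !frE ?mul0r ?mulr0.
  by rewrite eq_lrshift.
- rewrite [X in X + _]big1 ?add0r; last by move=> b _; rewrite !frE ?mul0r ?mulr0.
  rewrite big1; last by move=> b _; rewrite !frE ?mul0r ?mulr0.
  by rewrite eq_sym eq_lrshift.
- rewrite [X in X + _]big1 ?add0r => [|b _]; last by rewrite !frE mul0r.
  under eq_bigr do rewrite !frE mulrACA mulfV // mul1r.
  rewrite (bigD1 i') //= big1 ?addr0 => [|b bi].
    by rewrite eqxx mul1r eq_rshift eq_sym.
  by rewrite eq_sym (negbTE bi) mul0r.
Qed.

Lemma poly_xq : poly_fun xq.
Proof. exact: PolyCoord. Qed.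

Lemma poly_Dvec c a i : poly_fun (fun q : 'rV[R]_(2 + k.+1) => Dvec c a (lsubmx q) 0 i).
Proof.
have pl s : poly_fun (fun q : 'rV[R]_(2 + k.+1) => lsubmx q 0 s).
  by under eq_fun do rewrite mxE; exact: PolyCoord.
elim/ord3P: a; under eq_fun do rewrite ?Dvec_l ?Dvec_r ?sqnorm2 ?expr2;
  repeat first [exact: PolyCst|exact: pl|apply: PolyAdd|apply: PolyOpp|apply: PolyMul].
Qed.

Lemma poly_ef l A i : poly_fun (fun q => prod_frame l A q 0 i).
Proof.
rewrite -(splitK i); case: (fintype.split i) A => i' [a|j] /=; under eq_fun do rewrite frE.
- by apply: PolyMul; [exact: poly_xq|exact: poly_Dvec].
- exact: PolyCst.
- exact: PolyCst.
- by apply: PolyMul; [exact: poly_xq|exact: PolyCst].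
Qed.

Lemma de_ef A i : diffU U (fun l q => prod_frame l A q 0 i).
Proof. by move=> l q _; apply: poly_fun_diff; exact: poly_ef. Qed.

Lemma dde_ef A s i : diffU U (fun l => pd i (fun q => prod_frame l A q 0 s)).
Proof. by move=> l q _; apply: poly_fun_diff; apply: poly_fun_pd; exact: poly_ef. Qed.

Lemma schwarz_ef l q : U l q -> forall A s i t,
  pd i (pd t (fun z => prod_frame l A z 0 s)) q = pd t (pd i (fun z => prod_frame l A z 0 s)) q.
Proof. by move=> _ A s i j; apply: poly_fun_schwarz; exact: poly_ef. Qed.

Lemma dth_thf A i : diffU U (fun l q => prod_coframe l A q 0 i).
Proof.
move=> l q Uq; have dx : differentiable (fun q : 'rV[R]_(2 + k.+1) => (xq q)^-1) q.
  by apply: differentiable_inv; [exact: xq_neq0 Uq|exact: differentiable_coord].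
rewrite -(splitK i); case: (fintype.split i) A => i' [a|j] /=; under eq_fun do rewrite frE.
- apply: differentiable_mul => //; apply: differentiable_mul.
    by apply: differentiable_comp_lsubmx; exact: differentiable_lam2.
  by apply: poly_fun_diff; exact: poly_Dvec.
- exact: differentiable_cst'.
- exact: differentiable_cst'.
- by apply: differentiable_mul => //; exact: differentiable_cst'.
Qed.

Local Notation fam := (L -> 'rV[R]_(2 + k.+1) -> R).
Local Notation fd := (frame_diff prod_frame).
Local Notation adm := (admissible U prod_frame).
Implicit Types (F : fam).

Lemma fd_inl a F l q : fd (inl a) F l q =
  xq q * \sum_i Dvec (ch l) a (lsubmx q) 0 i * pd (lshift _ i) (F l) q.
Proof.
rewrite /frame_diff big_split_ord /= [X in _ + X]big1 ?addr0 => [|i _]; last by rewrite frE mul0r.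
by rewrite mulr_sumr; apply: eq_bigr => i _; rewrite frE mulrA.
Qed.

Lemma fd_inr j F l q : fd (inr j) F l q = xq q * pd (rshift _ j) (F l) q.
Proof.
rewrite /frame_diff big_split_ord /= [X in X + _]big1 ?add0r => [|i _]; last by rewrite frE mul0r.
rewrite (bigD1 j) //= frE eqxx mulr1 big1 ?addr0 // => i ij.
by rewrite frE (negbTE ij) mulr0 mul0r.
Qed.

Lemma fd_inl_sphere a (h : L -> 'rV[R]_2 -> R) l q : differentiable (h l) (lsubmx q) ->
  fd (inl a) (fun l q => h l (lsubmx q)) l q = xq q * Dop (ch l) a (h l) (lsubmx q).
Proof.
move=> dh; rewrite fd_inl; congr (_ * _); apply: eq_bigr => i _.
by rewrite pd_comp_lsubmx.
Qed.

Lemma fd_inr_sphere j (h : L -> 'rV[R]_2 -> R) l q : differentiable (h l) (lsubmx q) ->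
  fd (inr j) (fun l q => h l (lsubmx q)) l q = 0.
Proof. by move=> dh; rewrite fd_inr pd_comp_lsubmx0 // mulr0. Qed.

Lemma fd_coordr A j l q : fd A (fun l q => q 0 (rshift 2 j)) l q =
  match A with inl _ => 0 | inr j' => xq q * (j == j')%:R end.
Proof.
case: A => [a|j'].
  rewrite fd_inl big1 ?mulr0 // => i _.
  by rewrite pd_coord eq_sym eq_lrshift mulr0.
by rewrite fd_inr pd_coord eq_rshift.
Qed.

Lemma fd_xq A l q : fd A (fun l q => xq q) l q =
  match A with inl _ => 0 | inr j' => xq q * (0 == j')%:R end.
Proof. exact: fd_coordr. Qed.

Definition sphf (F : 'rV[R]_(2 + 1) -> R) : fam := fun l q => F (stereo (ch l) (lsubmx q)).

Lemma differentiable_sphf (F : 'rV[R]_(2 + 1) -> R) l q : smooth_on nonzero F -> differentiable (sphf F l) q.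
Proof.
move=> sF; apply: (differentiable_comp_lsubmx (h := F \o stereo (ch l))).
exact: (smooth_on_differentiable (smooth_comp_stereo (ch l) sF)).
Qed.

Lemma fd_sphf A (F : 'rV[R]_(2 + 1) -> R) l q : smooth_on nonzero F ->
  fd A (sphf F) l q = match A with inl a => xq q * sphf (DS a F) l q | inr _ => 0 end.
Proof.
move=> sF; have dF c u : differentiable (F \o stereo c) u.
  exact: (smooth_on_differentiable (smooth_comp_stereo c sF)).
case: A => [a|j].
  by rewrite (@fd_inl_sphere a (fun l => F \o stereo (ch l))) // Dop_stereo.
by rewrite (@fd_inr_sphere j (fun l => F \o stereo (ch l))).
Qed.

(** [e_A x] is [x] or 0. *)
Lemma adm_xq : adm (fun l q => xq q).
Proof.
apply: (@generated_adm _ _ _ _ U prod_frame oU (fun F => F = (fun l q => xq q))); last exact: GenBase.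
- by move=> _ -> l q _; exact: differentiable_coord.
- by move=> _ ->; exists x0 => l q /Ux /andP[x1 x2]; rewrite gtr0_norm ?ltW.
- move=> _ A ->; exists (match A with inl _ => fun _ _ => 0
    | inr j' => fun l q => xq q * (0 == j')%:R end).
    by case: A => *; [exact: GenCst|apply: GenMul; [exact: GenBase|exact: GenCst]].
  by move=> l q _; rewrite fd_xq; case: A.
Qed.

(** [x D_a] applied to a function on the sphere is [x] times such a function. *)
Lemma adm_sphf (F : 'rV[R]_(2 + 1) -> R) : smooth_on nonzero F -> adm (sphf F).
Proof.
move=> sF; apply: (@generated_adm _ _ _ _ U prod_frame oU (fun G => exists2 F : 'rV[R]_(2 + 1) -> R, smooth_on nonzero F & G = sphf F)).
- by move=> _ [{}F {}sF ->] l q _; exact: differentiable_sphf.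
- move=> _ [{}F {}sF ->]; have [C hC] := smooth_bdd sF.
  by exists C => l q _; exact: hC.
- move=> _ A [{}F {}sF ->]; exists (match A with inl a => fun l q => xq q * sphf (DS a F) l q
     | inr _ => fun _ _ => 0 end).
    case: A => [a|j]; last exact: GenCst.
    apply: GenMul; first by apply: GenAdm; exact: adm_xq.
    by apply: GenBase; exists (DS a F) => //; exact: smooth_DS.
  by move=> l q _; rewrite fd_sphf //; case: A.
- by apply: GenBase; exists F.
Qed.

(** One of the two terms of [bracket_coeff], whose other one results from the
    exchange of [A] and [B]. *)
Definition bracket_half A B : fam :=
  match A, B with
  | inl a, inl _ => fun l q => xq q * stereo (ch l) (lsubmx q) 0 a
  | inr j, _ => fun _ _ => (0 == j)%:R
  | _, _ => fun _ _ => 0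
  end.

(** [[x D_a, x D_b] = x (y_a x D_b - y_b x D_a)] and
    [[x d/dx, e_B] = e_B] for the fields [e_B] other than [x d/dx]. *)
Definition bracket_coeff A B C : fam := fun l q =>
  bracket_half A B l q * (C == B)%:R - bracket_half B A l q * (C == A)%:R.

Lemma adm_bracket_coeff A B C : adm (bracket_coeff A B C).
Proof.
have az A' B' : adm (bracket_half A' B').
  case: A' B' => [a|j] [b|j'] /=; do ?exact: adm_cst.
  apply: adm_mul => //; first exact: adm_xq.
  apply: (@adm_sphf (fun y => y 0 a)); exact: smooth_coord.
by apply: adm_sub => //; apply: adm_mul => //; exact: adm_cst.
Qed.

Lemma bracket_frame A B s l q : U l q ->
  fd A (fun l z => prod_frame l B z 0 s) l q - fd B (fun l z => prod_frame l A z 0 s) l q =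
  \sum_C bracket_coeff A B C l q * prod_frame l C q 0 s.
Proof.
move=> Uq; have -> : \sum_C bracket_coeff A B C l q * prod_frame l C q 0 s =
    bracket_half A B l q * prod_frame l B q 0 s - bracket_half B A l q * prod_frame l A q 0 s.
  have hs (z : R) D : \sum_C z * (C == D)%:R * prod_frame l C q 0 s = z * prod_frame l D q 0 s.
    rewrite (bigD1 D) //= eqxx mulr1 big1 ?addr0 // => C CD.
    by rewrite (negbTE CD) mulr0 mul0r.
  by rewrite /bracket_coeff; under eq_bigr do rewrite mulrBl; rewrite sumrB !hs.
have dx : differentiable xq q by exact: differentiable_coord.
have dD a i : differentiable (fun z : 'rV[R]_(2 + k.+1) => Dvec (ch l) a (lsubmx z) 0 i) q.
  by apply: poly_fun_diff; exact: poly_Dvec.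
have dDu a i u : differentiable (fun z => Dvec (ch l) a z 0 i) u by exact: differentiable_Dvec.
have e1 A' a i : fd A' (fun l z => prod_frame l (inl a) z 0 (lshift _ i)) l q =
    match A' with inl b => xq q * (xq q * Dop (ch l) b (fun u => Dvec (ch l) a u 0 i) (lsubmx q))
    | inr j => xq q * (0 == j)%:R * Dvec (ch l) a (lsubmx q) 0 i end.
  have -> : (fun l z => prod_frame l (inl a) z 0 (lshift _ i)) = (fun l z => xq z * Dvec (ch l) a (lsubmx z) 0 i).
    by apply/funext => ?; apply/funext => ?; rewrite frE.
  rewrite (fdM prod_frame A' (F := fun l z => xq z) (G := fun l z => Dvec (ch l) a (lsubmx z) 0 i)) // fd_xq.
  case: A' => [b|j].
    by rewrite (@fd_inl_sphere b (fun l u => Dvec (ch l) a u 0 i)) // mul0r add0r.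
  by rewrite (@fd_inr_sphere j (fun l u => Dvec (ch l) a u 0 i)) // mulr0 addr0.
have e2 A' a i : fd A' (fun l z => prod_frame l (inl a) z 0 (rshift _ i)) l q = 0.
  have -> : (fun l z => prod_frame l (inl a) z 0 (rshift _ i)) = (fun l z => 0).
    by apply/funext => ?; apply/funext => ?; rewrite frE.
  exact: fd_cst.
have e3 A' j i : fd A' (fun l z => prod_frame l (inr j) z 0 (lshift _ i)) l q = 0.
  have -> : (fun l z => prod_frame l (inr j) z 0 (lshift _ i)) = (fun l z => 0).
    by apply/funext => ?; apply/funext => ?; rewrite frE.
  exact: fd_cst.
have e4 A' j i : fd A' (fun l z => prod_frame l (inr j) z 0 (rshift _ i)) l q =
    match A' with inl b => 0 | inr j' => xq q * (0 == j')%:R * (i == j)%:R end.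
  have -> : (fun l z => prod_frame l (inr j) z 0 (rshift _ i)) = (fun l z => xq z * (i == j)%:R).
    by apply/funext => ?; apply/funext => ?; rewrite frE.
  rewrite (fdM prod_frame A' (F := fun l z => xq z) (G := fun _ _ => (i == j)%:R)) //.
    by rewrite fd_xq fd_cst; case: A' => *; rewrite ?mul0r mulr0 addr0.
rewrite -(splitK s); case: (fintype.split s) => i; case: A B => [a|j] [b|j'] /=;
  rewrite ?e1 ?e2 ?e3 ?e4 !frE; do ?[by move: (xq q) => *; ring].
have := Dvec_comm (ch l) a b i (lsubmx q); rewrite -/(Dop _ _ _ _) -/(Dop _ _ _ _) => h.
by rewrite -!mulrBr h; move: (xq q) (stereo _ _) (Dvec _ _ _) (Dvec _ _ _) => *; ring.
Qed.

End ProductFrame.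

Arguments prod_frame : simpl never.
Arguments prod_coframe : simpl never.

(** * The Schwarzschild metric in the frame *)

Lemma invmx_eq {R : realType} {n} (A B : 'M[R]_n) : A *m B = 1%:M ->
  (A \in unitmx) * (invmx A = B).
Proof.
move=> AB; have [uA _] := mulmx1_unit AB; split => //.
by rewrite -[LHS]mulmx1 -AB mulKmx.
Qed.

Section SchwarzschildFrame.
Context {R : realType} (m : R).
Implicit Types (q : 'rV[R]_(2 + 2)) (c : bool) (a b : 'I_(2 + 1)).

Lemma xcoE q : xco q = xq q.
Proof. by rewrite /xco mxE. Qed.

(** The squared length of [dx / x], and minus that of [x d/dv]. *)
Definition gm (x : R) := x ^+ 2 * (1 - 2 * m * x).

Lemma gSch_ll c q i j : gSch m c q (lshift _ i) (lshift _ j) =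
  (xq q) ^- 2 * lam2 (lsubmx q) * (i == j)%:R.
Proof. by rewrite /gSch block_mxEul mxE sphere_metricE mxE xcoE -mulrA mulr_natr. Qed.

Lemma gSch_lr c q i j : gSch m c q (lshift _ i) (rshift _ j) = 0.
Proof. by rewrite /gSch block_mxEur mxE. Qed.

Lemma gSch_rl c q i j : gSch m c q (rshift _ i) (lshift _ j) = 0.
Proof. by rewrite /gSch block_mxEdl mxE. Qed.

Lemma gSch_rr c q (i j : 'I_2) : gSch m c q (rshift _ i) (rshift _ j) =
  if (i == 0) && (j == 0) then 0
  else if (i == 1) && (j == 1) then - (1 - 2 * m * xq q) else (xq q) ^- 2.
Proof. by rewrite /gSch block_mxEdr mxE xcoE. Qed.

Definition gSchE := (gSch_ll, gSch_lr, gSch_rl, gSch_rr).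

Lemma gSch_sym c q i j : gSch m c q i j = gSch m c q j i.
Proof.
rewrite -(splitK i) -(splitK j); case: (fintype.split i) => i'; case: (fintype.split j) => j' /=;
  rewrite !gSchE //; first by rewrite eq_sym.
by have [->|->] := ord2P i'; have [->|->] := ord2P j'.
Qed.

Definition gInv q : 'M[R]_(2 + 2) :=
  block_mx (((xq q) ^+ 2 * (lam2 (lsubmx q))^-1)%:M) 0
           0 (\matrix_(i < 2, j < 2)
                if (i == 0) && (j == 0) then (xq q) ^+ 2 * gm (xq q)
                else if (i == 1) && (j == 1) then 0 else (xq q) ^+ 2).

Lemma gInv_ll q i j : gInv q (lshift _ i) (lshift _ j) =
  (xq q) ^+ 2 * (lam2 (lsubmx q))^-1 * (i == j)%:R.
Proof. by rewrite /gInv block_mxEul mxE mulr_natr. Qed.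

Lemma gInv_lr q i j : gInv q (lshift _ i) (rshift _ j) = 0.
Proof. by rewrite /gInv block_mxEur mxE. Qed.

Lemma gInv_rl q i j : gInv q (rshift _ i) (lshift _ j) = 0.
Proof. by rewrite /gInv block_mxEdl mxE. Qed.

Lemma gInv_rr q (i j : 'I_2) : gInv q (rshift _ i) (rshift _ j) =
  if (i == 0) && (j == 0) then (xq q) ^+ 2 * gm (xq q)
  else if (i == 1) && (j == 1) then 0 else (xq q) ^+ 2.
Proof. by rewrite /gInv block_mxEdr mxE. Qed.

Definition gInvE := (gInv_ll, gInv_lr, gInv_rl, gInv_rr).

Lemma gSch_inverse c q : xq q != 0 -> gSch m c q *m gInv q = 1%:M.
Proof.
move=> x_neq0; have l0 := lam2_neq0 (lsubmx q).
apply/matrixP => i j; rewrite mxE big_split_ord /= !big_ord2 [RHS]mxE.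
rewrite -(splitK i) -(splitK j); case: (fintype.split i) => i'; case: (fintype.split j) => j' /=;
  rewrite !gSchE !gInvE ?eq_lshift ?eq_rshift ?eq_lrshift ?[rshift _ _ == _]eq_sym ?eq_lrshift;
  have [->|->] := ord2P i'; have [->|->] := ord2P j'; rewrite /= /gm; move: (lam2 _) l0 (xq q) x_neq0 => l l0 x x0; clear -l0 x0;
  field; rewrite ?l0 ?x0 //.
Qed.

Lemma gSch_unit c q : xq q != 0 -> gSch m c q \in unitmx.
Proof. by move=> x_neq0; rewrite (invmx_eq (gSch_inverse c x_neq0)). Qed.

Lemma invmx_gSch c q : xq q != 0 -> invmx (gSch m c q) = gInv q.
Proof. by move=> x_neq0; rewrite (invmx_eq (gSch_inverse c x_neq0)). Qed.

Lemma differentiable_gSch c q i j : xq q != 0 -> differentiable (fun q => gSch m c q i j) q.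
Proof.
move=> x_neq0; have dx : differentiable (@xq R 1) q by exact: differentiable_coord.
have dV : differentiable (fun q => (@xq R 1 q) ^- 2) q.
  have -> : (fun q => (@xq R 1 q) ^- 2) = (fun q => (@xq R 1 q)^-1 * (@xq R 1 q)^-1).
    by apply/funext => z; rewrite -invfM -expr2.
  by apply: differentiable_mul; exact: differentiable_inv.
rewrite -(splitK i) -(splitK j); case: (fintype.split i) => i'; case: (fintype.split j) => j' /=;
  under eq_fun do rewrite gSchE; try exact: differentiable_cst'.
  apply: differentiable_mul; last exact: differentiable_cst'.
  by apply: differentiable_mul => //; apply: differentiable_comp_lsubmx; exact: differentiable_lam2.
by have [->|->] := ord2P i'; have [->|->] := ord2P j'; rewrite /=; diffs.
Qed.

(** By tightness the spherical part of the inverse metric is the sum of the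
    squares of the [e_a]: no projection to the tangent planes is needed. *)
Lemma gInv_frame l (p p' : 'rV[R]_(2 + 2)) q : xq q != 0 ->
  (p *m gInv q *m p'^T) 0 0 =
  (\sum_a (\sum_i prod_frame (fun c => c) l (inl a) q 0 i * p 0 i) *
          (\sum_i prod_frame (fun c => c) l (inl a) q 0 i * p' 0 i))
  + gm (xq q) * (xq q * p 0 (rshift 2 0)) * (xq q * p' 0 (rshift 2 0))
  + (xq q * p 0 (rshift 2 0)) * (xq q * p' 0 (rshift 2 1))
  + (xq q * p 0 (rshift 2 1)) * (xq q * p' 0 (rshift 2 0)).
Proof.
move=> x_neq0.
have -> : \sum_a (\sum_i prod_frame (fun c => c) l (inl a) q 0 i * p 0 i) *
          (\sum_i prod_frame (fun c => c) l (inl a) q 0 i * p' 0 i) =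
  xq q ^+ 2 * (lam2 (lsubmx q))^-1 * \sum_(i < 2) p 0 (lshift 2 i) * p' 0 (lshift 2 i).
  have e r a : \sum_i prod_frame (fun c => c) l (inl a) q 0 i * r 0 i =
      xq q * \sum_i Dvec l a (lsubmx q) 0 i * r 0 (lshift 2 i).
    rewrite big_split_ord /= [X in _ + X]big1 ?addr0; last by move=> i _; rewrite frE mul0r.
    by rewrite mulr_sumr; apply: eq_bigr => i _; rewrite frE mulrA.
  under eq_bigr do rewrite !e mulrACA -expr2.
  rewrite -mulr_sumr -mulrA; congr (_ * _).
  under eq_bigr do rewrite big_distrlr /=.
  rewrite exchange_big mulr_sumr; apply: eq_bigr => i _ /=.
  rewrite exchange_big (bigD1 i) //= [X in _ + X]big1 ?addr0 => [|j ji].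
    transitivity ((\sum_a Dvec l a (lsubmx q) 0 i * Dvec l a (lsubmx q) 0 i) *
        (p 0 (lshift 2 i) * p' 0 (lshift 2 i))).
      by rewrite mulr_suml; apply: eq_bigr => a _; ring.
    by rewrite Dvec_tight eqxx mulr1.
  transitivity ((\sum_a Dvec l a (lsubmx q) 0 i * Dvec l a (lsubmx q) 0 j) *
        (p 0 (lshift 2 i) * p' 0 (lshift 2 j))).
    by rewrite mulr_suml; apply: eq_bigr => a _; ring.
  by rewrite Dvec_tight eq_sym (negbTE ji) mulr0 mul0r.
rewrite mxE big_split_ord /= !big_ord2 ![(_ *m _) _ _]mxE !big_split_ord /= !big_ord2 !gInvE /=.
rewrite ![_^T _ _]mxE /gm; ring.
Qed.

Section OnDomain.
Variables (U : bool -> set 'rV[R]_(2 + 2)) (x0 : R).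
Hypothesis oU : forall c, open (U c).
Hypothesis Ux : forall c q, U c q -> 0 < xq q < x0.
Local Notation efN := (prod_frame (fun c : bool => c)).
Local Notation thN := (prod_coframe (fun c : bool => c)).
Local Notation adm := (admissible U efN).

(** The singular factors [x^-2] of the metric cancel against those of the frame. *)
Lemma gram_gSch A B c q : U c q -> gram efN (gSch m) A B c q =
  match A, B with
  | inl a, inl b => (a == b)%:R - stereo c (lsubmx q) 0 a * stereo c (lsubmx q) 0 b
  | inr i, inr j => if (i == 0) && (j == 0) then 0
       else if (i == 1) && (j == 1) then - gm (xq q) else 1
  | _, _ => 0
  end.
Proof.
move=> Uq; have x_neq0 := xq_neq0 Ux Uq; rewrite /gram.
case: A B => [a|i] [b|j].
- rewrite -Dvec_stereo big_split_ord /= [X in _ + X]big1 ?addr0; last first.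
    by move=> i _; rewrite big1 // => j _; rewrite frE !mul0r.
  apply: eq_bigr => i _; rewrite big_split_ord /= [X in _ + X]big1 ?addr0; last first.
    by move=> j _; rewrite frE gSchE mulr0 mul0r.
  rewrite (bigD1 i) //= [X in _ + X]big1 ?addr0 => [|j ji].
    by rewrite !frE gSchE eqxx mulr1; field.
  by rewrite gSchE eq_sym (negbTE ji) !mulr0 mul0r.
- rewrite big1 // => s _; rewrite big1 // => t _.
  by rewrite -(splitK s) -(splitK t); case: (fintype.split s) => ?; case: (fintype.split t) => ? /=;
    rewrite !frE ?gSchE ?mulr0 ?mul0r.
- rewrite big1 // => s _; rewrite big1 // => t _.
  by rewrite -(splitK s) -(splitK t); case: (fintype.split s) => ?; case: (fintype.split t) => ? /=;
    rewrite !frE ?gSchE ?mulr0 ?mul0r.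
- rewrite !big_split_ord /= !big_ord2 !big_split_ord /= !big_ord2 !frE !gSchE /=.
  have [->|->] := ord2P i; have [->|->] := ord2P j; rewrite /= /gm;
  by move: (xq q) x_neq0 => x xn; field.
Qed.

Lemma cogram_gSch A B c q : U c q -> cogram thN (gSch m) A B c q =
  match A, B with
  | inl a, inl b => (a == b)%:R - stereo c (lsubmx q) 0 a * stereo c (lsubmx q) 0 b
  | inr i, inr j => if (i == 0) && (j == 0) then gm (xq q)
       else if (i == 1) && (j == 1) then 0 else 1
  | _, _ => 0
  end.
Proof.
move=> Uq; have x_neq0 := xq_neq0 Ux Uq; rewrite /cogram invmx_gSch //.
have l0 := lam2_neq0 (lsubmx q).
case: A B => [a|i] [b|j].
- rewrite -Dvec_stereo big_split_ord /= [X in _ + X]big1 ?addr0; last first.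
    by move=> i _; rewrite big1 // => j _; rewrite frE !mul0r.
  apply: eq_bigr => i _; rewrite big_split_ord /= [X in _ + X]big1 ?addr0; last first.
    by move=> j _; rewrite frE gInvE mulr0 mul0r.
  rewrite (bigD1 i) //= [X in _ + X]big1 ?addr0 => [|j ji].
    rewrite !frE gInvE eqxx mulr1; move: (lam2 _) l0 => l l0.
    by field; rewrite ?l0 ?x_neq0.
  by rewrite gInvE eq_sym (negbTE ji) !mulr0 mul0r.
- rewrite big1 // => s _; rewrite big1 // => t _.
  by rewrite -(splitK s) -(splitK t); case: (fintype.split s) => ?; case: (fintype.split t) => ? /=;
    rewrite !frE ?gInvE ?mulr0 ?mul0r.
- rewrite big1 // => s _; rewrite big1 // => t _.
  by rewrite -(splitK s) -(splitK t); case: (fintype.split s) => ?; case: (fintype.split t) => ? /=;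
    rewrite !frE ?gInvE ?mulr0 ?mul0r.
- rewrite !big_split_ord /= !big_ord2 !big_split_ord /= !big_ord2 !frE !gInvE /=.
  have [->|->] := ord2P i; have [->|->] := ord2P j; rewrite /= /gm.
  all: by move: (xq q) x_neq0 ((lam2 (lsubmx q))^-1) => x xn l; field.
Qed.

Lemma adm_gm : adm (fun _ q => gm (xq q)).
Proof.
have ax : adm (fun _ q => xq q) by exact: (adm_xq _ oU Ux).
apply: adm_mul => //; first exact: adm_exp.
by apply: adm_sub => //; [exact: adm_cst|apply: adm_mul => //; exact: adm_cst].
Qed.

Lemma adm_stereo a : adm (fun c q => stereo c (lsubmx q) 0 a).
Proof. exact: (adm_sphf (fun c : bool => c) oU Ux (@smooth_coord _ _ nonzero a)). Qed.

Lemma adm_gram_gSch A B : adm (gram efN (gSch m) A B).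
Proof.
apply: (adm_ext oU) (fun c q Uq => esym (gram_gSch A B Uq)) _.
case: A B => [a|i] [b|j]; do ?exact: adm_cst.
  apply: adm_sub => //; first exact: adm_cst.
  by apply: adm_mul => //; exact: adm_stereo.
have [->|->] := ord2P i; have [->|->] := ord2P j; rewrite /=; do ?exact: adm_cst.
by apply: adm_opp => //; exact: adm_gm.
Qed.

Lemma adm_cogram_gSch A B : adm (cogram thN (gSch m) A B).
Proof.
apply: (adm_ext oU) (fun c q Uq => esym (cogram_gSch A B Uq)) _.
case: A B => [a|i] [b|j]; do ?exact: adm_cst.
  apply: adm_sub => //; first exact: adm_cst.
  by apply: adm_mul => //; exact: adm_stereo.
have [->|->] := ord2P i; have [->|->] := ord2P j; rewrite /=; do ?exact: adm_cst.
exact: adm_gm.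
Qed.

Let gSch_symU c q : U c q -> forall i j, gSch m c q i j = gSch m c q j i.
Proof. by move=> _ i j; exact: gSch_sym. Qed.

Let gSch_unitU c q : U c q -> gSch m c q \in unitmx.
Proof. by move=> /(xq_neq0 Ux); exact: gSch_unit. Qed.

Let gSch_diffU i j : diffU U (fun c q => gSch m c q i j).
Proof. by move=> c q /(xq_neq0 Ux); exact: differentiable_gSch. Qed.

Lemma adm_conn_gSch A B C : adm (conn efN thN (gSch m) A B C).
Proof.
exact: (adm_conn oU (de_ef _ (U := U)) (complete_ef _ Ux) gSch_symU gSch_unitU gSch_diffU
  (bracket_frame _ (U := U)) (adm_bracket_coeff _ oU Ux) adm_gram_gSch adm_cogram_gSch).
Qed.

Lemma adm_icov_gSch p r (B : bool -> tensor R (2 + 2) p r) k :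
  adm_tensor U efN thN B -> adm_tensor U efN thN (fun c => icov (gSch m c) (B c) k).
Proof.
exact: (adm_icovE oU (de_ef _ (U := U)) (dth_thf _ Ux) (complete_ef _ Ux) gSch_symU gSch_unitU
  gSch_diffU (bracket_frame _ (U := U)) (adm_bracket_coeff _ oU Ux) adm_gram_gSch adm_cogram_gSch).
Qed.

Lemma adm_riemann_gSch : adm_tensor U efN thN (fun c => riemann (gSch m c)).
Proof.
exact: (adm_riemann oU (de_ef _ (U := U)) (dth_thf _ Ux) (complete_ef _ Ux) (dde_ef _ (U := U))
  (schwarz_ef _ (U := U)) (bracket_frame _ (U := U)) (adm_bracket_coeff _ oU Ux)
  (adm_pairing oU (complete_ef _ Ux) gSch_unitU adm_gram_gSch adm_cogram_gSch)
  adm_conn_gSch).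
Qed.

End OnDomain.
End SchwarzschildFrame.

(** * The time function in closed form *)

Section SphereData.
Context {R : realType} (f : 'rV[R]_(2 + 1) -> R) (sf : smooth_on_sphere f).
Implicit Types (u : 'rV[R]_2) (c : bool) (y : 'rV[R]_(2 + 1)).

Definition gradsq y := \sum_a DS a (radial f) y * DS a (radial f) y.
Definition lap y := \sum_a DS a (DS a (radial f)) y.
(** [<grad |grad f|^2, grad f>], as in the coefficient [psi]. *)
Definition hess_grad y := \sum_a DS a gradsq y * DS a (radial f) y.

Lemma smooth_f : smooth_on nonzero (radial f).
Proof. exact: smooth_radial. Qed.

Lemma smooth_gradsq : smooth_on nonzero gradsq.
Proof.
apply: smooth_expr_on; first exact: open_nonzero.
by apply: smooth_expr_sum => a; apply: SmoothMul; apply: SmoothBase;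
  apply: smooth_DS; exact: smooth_f.
Qed.

Lemma smooth_lap : smooth_on nonzero lap.
Proof.
apply: smooth_expr_on; first exact: open_nonzero.
by apply: smooth_expr_sum => a; apply: SmoothBase; do 2!apply: smooth_DS; exact: smooth_f.
Qed.

Lemma smooth_hess_grad : smooth_on nonzero hess_grad.
Proof.
apply: smooth_expr_on; first exact: open_nonzero.
by apply: smooth_expr_sum => a; apply: SmoothMul; apply: SmoothBase;
  apply: smooth_DS; [exact: smooth_gradsq|exact: smooth_f].
Qed.

Lemma fchartE c : fchart f c = radial f \o stereo c.
Proof. by apply/funext => u; rewrite /fchart /= radial_stereo. Qed.

Lemma sqgradfE c : sqgradf f c = gradsq \o stereo c.
Proof.
apply/funext => u; rewrite /sqgradf /gradf ip_grad fchartE /gradsq /=.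
by apply: eq_bigr => a _; rewrite !Dop_stereo //; exact: smooth_f.
Qed.

Lemma laplacianfE c u : laplacian (sphere_metric c) (fchart f c) u = lap (stereo c u).
Proof.
have sc := smooth_comp_stereo c smooth_f.
rewrite laplacianE => [|i]; last first.
  by rewrite fchartE; exact: (smooth_on_differentiable (smooth_on_pd i sc)).
rewrite /lap fchartE; apply: eq_bigr => a _.
have -> : Dop c a (radial f \o stereo c) = DS a (radial f) \o stereo c.
  by apply/funext => v; rewrite Dop_stereo //; exact: smooth_f.
by rewrite Dop_stereo //; apply: smooth_DS; exact: smooth_f.
Qed.

(** The chart expressions of [phi] and [psi] agree with the ambient ones. *)
Lemma PfunE c u (x t : R) : Defs.Pfun f c u x t =
  radial f (stereo c u) - 2^-1 * x * (t ^+ 2 + gradsq (stereo c u))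
  + 2^-1 * x ^+ 2 * (2^-1 * (t ^+ 2 * lap (stereo c u) + hess_grad (stereo c u))).
Proof.
rewrite /Defs.Pfun /phi /psi laplacianfE sqgradfE /gradf ip_grad fchartE.
have -> : \sum_a Dop c a (gradsq \o stereo c) u * Dop c a (radial f \o stereo c) u =
    hess_grad (stereo c u).
  by apply: eq_bigr => a _; rewrite !Dop_stereo //; first [exact: smooth_f|exact: smooth_gradsq].
rewrite /=; move: (radial f _) (gradsq _) (lap _) (hess_grad _) => *; field => //.
Qed.

Local Notation sph := (@sphf R 1 bool (fun c : bool => c)).

Definition vq (q : 'rV[R]_(2 + 2)) : R := q 0 (rshift 2 1).

(** [x L] is the coefficient of [tau^2 / 2] in [- P]. *)
Definition Lf c q := 1 - 2^-1 * xq q * sph lap c q.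

(** The part of [v + P] without [tau]. *)
Definition nf c q := vq q + sph (radial f) c q - 2^-1 * (xq q * sph gradsq c q)
  + 4^-1 * (xq q ^+ 2 * sph hess_grad c q).

(** Half the square of the time function: the solution [S] of
    [v = - P(y, x, sqrt (2 S))], an equation that is affine in [S]. *)
Definition Sf c q := nf c q * (xq q * Lf c q)^-1.

(** [Lap f] is bounded on the sphere. *)
Lemma Lf_bound : exists2 x1 : R, 0 < x1 &
  forall c q, 0 < xq q < x1 -> 2^-1 <= Lf c q.
Proof.
have [C hC] := smooth_bdd smooth_lap.
have C0 : 0 <= C by rewrite (le_trans _ (hC true 0)).
(* [x |Lap f| <= 1] below this height. *)
exists (C + 1)^-1; first by rewrite invr_gt0 ltr_wpDl.
move=> c q /andP[x_gt0 x_lt].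
have h : xq q * sph lap c q <= 1.
  rewrite (le_trans (ler_norm _)) // normrM gtr0_norm //.
  rewrite (@le_trans _ _ ((C + 1)^-1 * (C + 1))) //; last first.
    by rewrite mulVf // gt_eqF // ltr_wpDl.
  rewrite ler_pM ?normr_ge0 ?ltW //.
  by apply: (le_lt_trans (hC c (lsubmx q))); rewrite ltrDl.
by rewrite /Lf -mulrA; lra.
Qed.

Section TimeFunction.
Variables (x0 t1 t2 : R).
Hypothesis t1_gt0 : 0 < t1.
Hypothesis hL : forall c q, 0 < xq q < x0 -> 2^-1 <= Lf c q.

Definition small_x : set 'rV[R]_(2 + 2) := [set q | 0 < xq q < x0].

Lemma open_slab : open small_x.
Proof.
have cx : continuous (@xq R 1) by move=> q; apply: differentiable_continuous; exact: differentiable_coord.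
rewrite (_ : small_x = [set q | 0 < xq q] `&` [set q | xq q < x0]); last first.
  by apply/seteqP; split => q /=; [move=> /andP[]|move=> [h1 h2]; apply/andP].
apply: openI.
  by apply: (@open_comp _ _ (@xq R 1) [set r | 0 < r]); [move=> q _; exact: cx|exact: open_gt].
by apply: (@open_comp _ _ (@xq R 1) [set r | r < x0]); [move=> q _; exact: cx|exact: open_lt].
Qed.

Lemma smooth_expr_sph (F : 'rV[R]_(2 + 1) -> R) c (U : set 'rV[R]_(2 + 2)) : smooth_on nonzero F ->
  smooth_expr U (fun q => sph F c q).
Proof.
move=> sF; apply: (SmoothComp sF) => [a|q _].
  apply: (@SmoothComp _ _ U _ setT (fun u => stereo c u 0 a) lsubmx) => //.
    apply: smooth_expr_on; first exact: openT.
    exact: smooth_stereo.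
  by move=> i; under eq_fun do rewrite mxE; exact: SmoothCoord.
by apply: on_sphere_nonzero; exact: stereo_on_sphere.
Qed.

Lemma Lf_neq0 c q : small_x q -> Lf c q != 0.
Proof. by move=> /(hL c) h; rewrite gt_eqF // (lt_le_trans _ h). Qed.

Lemma slab_neq0 q : small_x q -> xq q != 0.
Proof. by move=> /andP[h _]; rewrite gt_eqF. Qed.

Lemma smooth_Sf c : smooth_expr small_x (Sf c).
Proof.
have sx : smooth_expr small_x (@xq R 1) by exact: SmoothCoord.
have sv : smooth_expr small_x vq by exact: SmoothCoord.
have sL : smooth_expr small_x (Lf c).
  rewrite /Lf; apply: SmoothAdd; first exact: SmoothCst.
  apply: SmoothOpp; apply: SmoothMul; first by smooths.
  exact: (smooth_expr_sph c small_x smooth_lap).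
apply: (@SmoothMul _ _ _ (nf c) (fun q => (xq q * Lf c q)^-1)); last first.
  apply: (@SmoothInv _ _ _ (fun q => xq q * Lf c q)); first exact: SmoothMul.
  by move=> q hq; rewrite mulf_neq0 ?slab_neq0 ?Lf_neq0.
have sf0 := smooth_expr_sph c small_x smooth_f.
have sg := smooth_expr_sph c small_x smooth_gradsq.
have sh := smooth_expr_sph c small_x smooth_hess_grad.
by rewrite /nf; smooths.
Qed.

(** The image of [Phi], described by the closed form of the time function. *)
Definition img c : set 'rV[R]_(2 + 2) :=
  [set q | 0 < xq q < x0 /\ 2^-1 * t1 ^+ 2 < Sf c q < 2^-1 * t2 ^+ 2].

Lemma img_small_x c q : img c q -> small_x q.
Proof. by case. Qed.

Lemma img_x c q : img c q -> 0 < xq q < x0.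
Proof. by case. Qed.

Lemma open_img c : open (img c).
Proof.
rewrite openE => q [hx /andP[h1 h2]].
have cS : {for q, continuous (Sf c)}.
  apply: differentiable_continuous.
  exact: (smooth_expr_differentiable (smooth_Sf c)).
have n1 : nbhs q (Sf c @^-1` [set r | 2^-1 * t1 ^+ 2 < r]).
  by apply: (cS [set r : R | _ < r]); apply: open_nbhs_nbhs; split => //; exact: open_gt.
have n2 : nbhs q (Sf c @^-1` [set r | r < 2^-1 * t2 ^+ 2]).
  by apply: (cS [set r : R | r < _]); apply: open_nbhs_nbhs; split => //; exact: open_lt.
have n3 : nbhs q small_x by apply: open_nbhs_nbhs; split => //; exact: open_slab.
apply: filterS3 n1 n2 n3 => z /= z1 z2 z3; split => //.
by rewrite z1 z2.
Qed.

Lemma Sf_ge c q : img c q -> 2^-1 * t1 ^+ 2 <= Sf c q.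
Proof. by move=> [_ /andP[/ltW]]. Qed.

Lemma Sf_gt0 c q : img c q -> 0 < Sf c q.
Proof.
by move=> /Sf_ge; apply: lt_le_trans; rewrite mulr_gt0 ?invr_gt0 ?exprn_gt0.
Qed.

Lemma SfE c q : small_x q -> Sf c q * (xq q * Lf c q) = nf c q.
Proof. by move=> hq; rewrite /Sf mulfVK // mulf_neq0 ?slab_neq0 ?Lf_neq0. Qed.

Local Notation efN := (prod_frame (fun c : bool => c)).
Local Notation fd := (frame_diff efN).
Local Notation adm := (admissible img efN).
Local Notation fam := (bool -> 'rV[R]_(2 + 2) -> R).

Let oU : forall c, open (img c) := open_img.
Let Ux : forall c q, img c q -> 0 < xq q < x0 := img_x.

(** [e_A (x L) = x den_diff A]. *)
Definition den_diff (A : 'I_(2 + 1) + 'I_2) : fam := fun c q =>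
  match A with
  | inl a => - (2^-1 * xq q ^+ 2 * sph (DS a lap) c q)
  | inr j => (j == 0)%:R * (1 - xq q * sph lap c q)
  end.

(** [e_A n = x num_diff A]. *)
Definition num_diff (A : 'I_(2 + 1) + 'I_2) : fam := fun c q =>
  match A with
  | inl a => sph (DS a (radial f)) c q - 2^-1 * xq q * sph (DS a gradsq) c q
     + 4^-1 * xq q ^+ 2 * sph (DS a hess_grad) c q
  | inr j => if j == 0 then - 2^-1 * sph gradsq c q + 2^-1 * xq q * sph hess_grad c q else 1
  end.

(** The frame derivative [e_A S]: in the quotient rule for [n / (x L)] the factor
    [x] of the derivatives cancels against the denominator. *)
Definition time_diff A : fam := fun c q => (num_diff A c q - Sf c q * den_diff A c q) * (Lf c q)^-1.

Lemma adm_x : adm (fun _ q => xq q).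
Proof. exact: (adm_xq _ oU Ux). Qed.

Lemma adm_sphere (F : 'rV[R]_(2 + 1) -> R) : smooth_on nonzero F -> adm (sph F).
Proof. exact: (adm_sphf _ oU Ux). Qed.

Let dsph F c q : smooth_on nonzero F -> differentiable (sph F c) q.
Proof. exact: differentiable_sphf. Qed.

Let dx q : differentiable (@xq R 1) q.
Proof. exact: differentiable_coord. Qed.

Lemma fd_xL A c q : fd A (fun c q => xq q * Lf c q) c q = xq q * den_diff A c q.
Proof.
have dl := dsph c q smooth_lap.
have -> : (fun c q => xq q * Lf c q) = (fun c q => xq q + (- 2^-1) * (xq q * (xq q * sph lap c q))).
  by apply/funext => ?; apply/funext => z; rewrite /Lf; move: (sph _ _ _) => *; ring.
rewrite (fdD efN A (F := fun c q => xq q) (G := fun c q => (- 2^-1) * (xq q * (xq q * sph lap c q)))); [|done|by diffs].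
rewrite (fdM efN A (F := fun c q => - 2^-1) (G := fun c q => (xq q * (xq q * sph lap c q)))); [|by diffs|by diffs].
rewrite (fdM efN A (F := fun c q => xq q) (G := fun c q => (xq q * sph lap c q))); [|by diffs|by diffs].
rewrite (fdM efN A (F := fun c q => xq q) (G := sph lap)); [|by diffs|by diffs].
rewrite fd_cst !fd_xq fd_sphf; last exact: smooth_lap.
case: A => [a|j]; rewrite /den_diff.
  by move: (sph (DS a lap) c q) (sph lap c q) (xq q) => *; field.
by rewrite (eq_sym j); move: (sph lap c q) (xq q) (0 == j) => *; field.
Qed.

Lemma fd_nf A c q : fd A nf c q = xq q * num_diff A c q.
Proof.
have d1 := dsph c q smooth_f; have d2 := dsph c q smooth_gradsq; have d3 := dsph c q smooth_hess_grad.
have dv : differentiable vq q by exact: differentiable_coord.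
have -> : nf = (fun c q => (vq q + sph (radial f) c q) + ((- 2^-1) * (xq q * sph gradsq c q)
  + 4^-1 * (xq q * (xq q * sph hess_grad c q)))).
  apply/funext => ?; apply/funext => z; rewrite /nf.
  by move: (sph _ _ _) (sph _ _ _) (sph _ _ _) => *; ring.
rewrite (fdD efN A (F := fun c q => vq q + sph (radial f) c q)); [|by diffs|by diffs].
rewrite (fdD efN A (F := fun c q => vq q)); [|by diffs|by diffs].
rewrite (fdD efN A (F := fun c q => (- 2^-1) * (xq q * sph gradsq c q))); [|by diffs|by diffs].
rewrite (fdM efN A (F := fun c q => - 2^-1)); [|by diffs|by diffs].
rewrite (fdM efN A (F := fun c q => xq q) (G := sph gradsq)); [|by diffs|by diffs].
rewrite (fdM efN A (F := fun c q => 4^-1)); [|by diffs|by diffs].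
rewrite (fdM efN A (F := fun c q => xq q) (G := fun c q => xq q * sph hess_grad c q)); [|by diffs|by diffs].
rewrite (fdM efN A (F := fun c q => xq q) (G := sph hess_grad)); [|by diffs|by diffs].
rewrite !fd_cst !fd_xq !fd_sphf; [|exact: smooth_hess_grad|exact: smooth_gradsq|exact: smooth_f].
rewrite (fd_coordr (fun c : bool => c) A 1).
case: A => [a|j]; rewrite /num_diff.
  generalize (sph (DS a (radial f)) c q) (sph (DS a gradsq) c q) (sph (DS a hess_grad) c q).
  generalize (sph gradsq c q) (sph hess_grad c q) (xq q) => g h x fa ga ha.
  by rewrite !mul0r; field.
generalize (sph gradsq c q) (sph hess_grad c q) (xq q) => g h x.
by have [->|->] := ord2P j; rewrite /=; field.
Qed.

Lemma fd_Sf A c q : small_x q -> fd A Sf c q = time_diff A c q.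
Proof.
move=> hq; have xn := slab_neq0 hq; have Ln := Lf_neq0 c hq.
have dS : differentiable (Sf c) q by exact: (smooth_expr_differentiable (smooth_Sf c)).
have dL : differentiable (fun q => xq q * Lf c q) q.
  have -> : (fun q => xq q * Lf c q) = (fun q => xq q * (1 + (- 2^-1) * (xq q * sph lap c q))).
    by apply/funext => z; rewrite /Lf; move: (sph _ _ _) => *; ring.
  by have := dsph c q smooth_lap => ?; diffs.
have : fd A (fun c q => Sf c q * (xq q * Lf c q)) c q = fd A nf c q.
  by apply: (fd_ext efN (fun=> open_slab) A (U := fun=> small_x)) => // c' q'; exact: SfE.
rewrite (fdM efN A (G := fun c q => xq q * Lf c q)) // fd_xL fd_nf /time_diff => h.
apply: (@mulIf _ (xq q * Lf c q)); first by rewrite mulf_neq0.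
move: h; move: (fd A Sf c q) (num_diff A c q) (den_diff A c q) (Sf c q) (Lf c q) Ln (xq q) xn => a b c' d l ln x xn h.
transitivity (x * b - d * (x * c')); first by rewrite -h; ring.
by field.
Qed.

Lemma adm_Lf : adm Lf.
Proof.
apply: adm_sub => //; first exact: adm_cst.
apply: adm_mul => //; last exact: adm_sphere smooth_lap.
by apply: adm_mul => //; [exact: adm_cst|exact: adm_x].
Qed.

Lemma adm_LfV : adm (fun c q => (Lf c q)^-1).
Proof.
apply: (@adm_inv _ _ _ _ img efN oU Lf 2^-1 adm_Lf) => //.
by move=> c q /img_small_x /(hL c) h; rewrite (le_trans h) // ler_norm.
Qed.

Lemma adm_den_diff A : adm (den_diff A).
Proof.
case: A => [a|j]; rewrite /den_diff.
  apply: adm_opp => //; apply: adm_mul => //; last by apply: adm_sphere; apply: smooth_DS; exact: smooth_lap.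
  by apply: adm_mul => //; [exact: adm_cst|apply: adm_exp => //; exact: adm_x].
apply: adm_mul => //; first exact: adm_cst.
apply: adm_sub => //; first exact: adm_cst.
by apply: adm_mul => //; [exact: adm_x|exact: adm_sphere smooth_lap].
Qed.

Lemma adm_num_diff A : adm (num_diff A).
Proof.
case: A => [a|j]; rewrite /num_diff.
  apply: adm_add => //.
    apply: adm_sub => //; first by apply: adm_sphere; apply: smooth_DS; exact: smooth_f.
    apply: adm_mul => //; last by apply: adm_sphere; apply: smooth_DS; exact: smooth_gradsq.
    by apply: adm_mul => //; [exact: adm_cst|exact: adm_x].
  apply: adm_mul => //; last by apply: adm_sphere; apply: smooth_DS; exact: smooth_hess_grad.
  by apply: adm_mul => //; [exact: adm_cst|apply: adm_exp => //; exact: adm_x].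
case: (j == 0); last exact: adm_cst.
apply: adm_add => //; first by apply: adm_mul => //; [exact: adm_cst|exact: adm_sphere smooth_gradsq].
apply: adm_mul => //; last exact: adm_sphere smooth_hess_grad.
by apply: adm_mul => //; [exact: adm_cst|exact: adm_x].
Qed.

(** [S] is bounded on the image because [tau] is, and its derivatives are
    polynomials in [S] with admissible coefficients. *)
Lemma adm_Sf : adm Sf.
Proof.
apply: (@generated_adm _ _ _ _ img efN oU (fun F => F = Sf)); last exact: GenBase.
- by move=> _ -> c q /img_small_x hq; exact: (smooth_expr_differentiable (smooth_Sf c)).
- move=> _ ->; exists (2^-1 * t2 ^+ 2) => c q hq; rewrite gtr0_norm ?Sf_gt0 //.
  by case: hq => _ /andP[_ /ltW].
- move=> _ A ->; exists (time_diff A); last by move=> c q /img_small_x; exact: fd_Sf.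
  apply: (@GenMul _ _ _ _ img efN _ (fun c q => num_diff A c q - Sf c q * den_diff A c q)).
    apply: (@GenAdd _ _ _ _ img efN _ (num_diff A)); first by apply: GenAdm; exact: adm_num_diff.
    have -> : (fun c q => - (Sf c q * den_diff A c q)) = (fun c q => Sf c q * (- den_diff A c q)).
      by apply/funext => ?; apply/funext => ?; rewrite mulrN.
    apply: GenMul; first exact: GenBase.
    by apply: GenAdm; apply: adm_opp => //; exact: adm_den_diff.
  by apply: GenAdm; exact: adm_LfV.
Qed.

Lemma adm_time_diff A : adm (time_diff A).
Proof.
apply: adm_mul => //; last exact: adm_LfV.
apply: adm_sub => //; first exact: adm_num_diff.
by apply: adm_mul => //; [exact: adm_Sf|exact: adm_den_diff].
Qed.

End TimeFunction.
End SphereData.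

(** * Expansions at infinity *)

Section Expansion.
Context {R : realType} (m : R) (f : 'rV[R]_(2 + 1) -> R) (sf : smooth_on_sphere f).
Variables (x0 t1 t2 : R).
Hypothesis t1_gt0 : 0 < t1.
Hypothesis hL : forall c q, 0 < xq q < x0 -> 2^-1 <= Lf f c q.
Implicit Types (c : bool) (q : 'rV[R]_(2 + 2)) (a : 'I_(2 + 1)).
Local Notation fam := (bool -> 'rV[R]_(2 + 2) -> R).
Local Notation img := (img f x0 t1 t2).
Local Notation efN := (prod_frame (fun c : bool => c)).
Local Notation fd := (frame_diff efN).
Local Notation adm := (admissible img efN).
Local Notation sph := (@sphf R 1 bool (fun c : bool => c)).
Local Notation S := (Sf f).
Local Notation sA := (time_diff f).
Local Notation slab := (small_x x0).

Let oU : forall c, open (img c) := open_img sf hL.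
Let Ux : forall c q, img c q -> 0 < xq q < x0 := @img_x R f x0 t1 t2.

Lemma S_diff c q : slab q -> differentiable (S c) q.
Proof. exact: (smooth_expr_differentiable (smooth_Sf sf hL c)). Qed.

(** Order 1 coefficient of [e_a S]; that of order 0 is [D_a f]. *)
Definition B1 a (y : 'rV[R]_(2 + 1)) := 2^-1 * (lap f y * DS a (radial f) y) - 2^-1 * DS a (gradsq f) y.

Lemma smooth_B1 a : smooth_on nonzero (B1 a).
Proof.
have s1 : smooth_expr nonzero (lap f) by apply: SmoothBase; exact: smooth_lap.
have s2 : smooth_expr nonzero (DS a (radial f)).
  by apply: SmoothBase; apply: smooth_DS; exact: smooth_f.
have s3 : smooth_expr nonzero (DS a (gradsq f)).
  by apply: SmoothBase; apply: smooth_DS; exact: smooth_gradsq.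
apply: smooth_expr_on; first exact: open_nonzero.
by rewrite /B1; smooths.
Qed.

(** Second order remainder of [1 / L]. *)
Definition rv : fam := fun c q => 4^-1 * (sph (lap f) c q * sph (lap f) c q) * (Lf f c q)^-1.

Definition cA a : fam := fun c q =>
  4^-1 * sph (DS a (hess_grad f)) c q + 2^-1 * (S c q * sph (DS a (lap f)) c q).

(** Second order remainder of [e_a S]. *)
Definition ra a : fam := fun c q =>
  (- 4^-1) * (sph (lap f) c q * sph (DS a (gradsq f)) c q) + cA a c q * (Lf f c q)^-1
  + (sph (DS a (radial f)) c q + (- 2^-1) * (xq q * sph (DS a (gradsq f)) c q)) * rv c q.

(** Order 0 part of [x d_x S], in which [S] itself counts as a coefficient. *)
Definition X0 : fam := fun c q => (- 2^-1) * sph (gradsq f) c q - S c q.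

(** Order 1 coefficient of [x d_x S]. *)
Definition X1 : fam := fun c q => 2^-1 * sph (hess_grad f) c q + 2^-1 * (S c q * sph (lap f) c q)
  - 4^-1 * (sph (lap f) c q * sph (gradsq f) c q).

(** Second order remainder of [x d_x S]. *)
Definition rx : fam := fun c q =>
  2^-1 * sph (lap f) c q * (2^-1 * sph (hess_grad f) c q + S c q * sph (lap f) c q)
  + (X0 c q + xq q * (2^-1 * sph (hess_grad f) c q + S c q * sph (lap f) c q)) * rv c q.

Lemma LfV_expand c q : slab q ->
  (Lf f c q)^-1 = 1 + 2^-1 * (xq q * sph (lap f) c q) + xq q ^+ 2 * rv c q.
Proof.
move=> hq; have L0 := Lf_neq0 hL c hq.
have xD : xq q * sph (lap f) c q = 2 * (1 - Lf f c q) by rewrite /Lf; field.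
rewrite /rv; move: L0 xD; generalize (Lf f c q) (sph (lap f) c q) (xq q) => l D x l0 xD.
have -> : x ^+ 2 * (4^-1 * (D * D) * l^-1) = 4^-1 * ((x * D) * (x * D)) * l^-1 by ring.
by rewrite xD; field.
Qed.

Lemma time_diff_sphere a c q : slab q -> sA (inl a) c q =
  sph (DS a (radial f)) c q + xq q * sph (B1 a) c q + xq q ^+ 2 * ra a c q.
Proof.
move=> hq; have -> : sph (B1 a) c q = 2^-1 * (sph (lap f) c q * sph (DS a (radial f)) c q)
  - 2^-1 * sph (DS a (gradsq f)) c q by [].
rewrite /sA /num_diff /den_diff /ra /cA; move: (LfV_expand c hq).
generalize (rv c q) (Lf f c q)^-1 (sph (DS a (radial f)) c q) (sph (DS a (gradsq f)) c q).
generalize (sph (DS a (hess_grad f)) c q) (sph (lap f) c q) (sph (DS a (lap f)) c q) (xq q) (S c q).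
move=> ha D Da x s r lv fa ga lvE.
transitivity ((fa - 2^-1 * x * ga) * lv + x ^+ 2 * ((4^-1 * ha + 2^-1 * (s * Da)) * lv)); first by field.
by rewrite {1}lvE; field.
Qed.

Lemma time_diff_x c q : slab q -> sA (inr 0) c q = X0 c q + xq q * X1 c q + xq q ^+ 2 * rx c q.
Proof.
move=> hq; rewrite /sA /num_diff /den_diff /rx /X1 /X0 /=; move: (LfV_expand c hq).
generalize (rv c q) (Lf f c q)^-1 (sph (gradsq f) c q).
generalize (sph (hess_grad f) c q) (sph (lap f) c q) (xq q) (S c q) => h D x s r lv g ->.
by field.
Qed.

Lemma time_diff_v c q : slab q -> sA (inr 1) c q =
  1 + 2^-1 * (xq q * sph (lap f) c q) + xq q ^+ 2 * rv c q.
Proof. by move=> hq; rewrite -LfV_expand // /sA /num_diff /den_diff /= !mul0r mulr0 subr0 mul1r. Qed.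

(** Minus the squared length of the gradient of [S], computed with the inverse
    metric in the frame. *)
Definition time_norm : fam := fun c q => - ((\sum_a sA (inl a) c q * sA (inl a) c q)
  + gm m (xq q) * sA (inr 0) c q * sA (inr 0) c q + 2 * (sA (inr 0) c q * sA (inr 1) c q)).

(** The remainder of [time_norm_expand]. *)
Definition rw : fam := fun c q => - (
  (\sum_a (sph (B1 a) c q * sph (B1 a) c q + 2 * (sph (DS a (radial f)) c q * ra a c q)
     + 2 * (xq q * (sph (B1 a) c q * ra a c q)) + xq q ^+ 2 * (ra a c q * ra a c q)))
  + (1 - 2 * m * xq q) * (sA (inr 0) c q * sA (inr 0) c q)
  + 2 * (X0 c q * rv c q + 2^-1 * (sph (lap f) c q * X1 c q) + rx c q
      + xq q * (X1 c q * rv c q + 2^-1 * (sph (lap f) c q * rx c q))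
      + xq q ^+ 2 * (rx c q * rv c q))).

Lemma gradsqE c q : \sum_a sph (DS a (radial f)) c q * sph (DS a (radial f)) c q = sph (gradsq f) c q.
Proof. by []. Qed.

Lemma hess_gradE c q :
  \sum_a sph (DS a (gradsq f)) c q * sph (DS a (radial f)) c q = sph (hess_grad f) c q.
Proof. by []. Qed.

Lemma lapE c q : \sum_a sph (DS a (DS a (radial f))) c q = sph (lap f) c q.
Proof. by []. Qed.

(** The orders 0 and 1 in [x] cancel: they are
    [|grad f|^2 + 2 X0 = - 2 S] and
    [Lap f |grad f|^2 - <grad |grad f|^2, grad f> + 2 X1 + X0 Lap f = 0].  This is
    what the choice of [phi] and [psi] achieves. *)
Lemma time_norm_expand c q : slab q -> time_norm c q = 2 * S c q + xq q ^+ 2 * rw c q.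
Proof.
move=> hq.
have e1 : \sum_a sA (inl a) c q * sA (inl a) c q = sph (gradsq f) c q
   + xq q * (sph (lap f) c q * sph (gradsq f) c q - sph (hess_grad f) c q)
   + xq q ^+ 2 * \sum_a (sph (B1 a) c q * sph (B1 a) c q + 2 * (sph (DS a (radial f)) c q * ra a c q)
     + 2 * (xq q * (sph (B1 a) c q * ra a c q)) + xq q ^+ 2 * (ra a c q * ra a c q)).
  rewrite -hess_gradE -gradsqE [in X in _ + xq q * X]mulr_sumr -sumrB !mulr_sumr -!big_split.
  apply: eq_bigr => a _ /=; rewrite time_diff_sphere //.
  have -> : sph (B1 a) c q = 2^-1 * (sph (lap f) c q * sph (DS a (radial f)) c q)
    - 2^-1 * sph (DS a (gradsq f)) c q by [].
  generalize (sph (DS a (radial f)) c q) (sph (DS a (gradsq f)) c q) (ra a c q) (sph (lap f) c q) (xq q).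
  by move=> fa ga r D x; field.
rewrite /time_norm e1 /rw /gm time_diff_v //; set SB := \sum_a _; clear e1.
have e2 : sA (inr 0) c q = X0 c q + xq q * X1 c q + xq q ^+ 2 * rx c q by exact: time_diff_x.
move: e2; rewrite /X0 /X1; move: SB; generalize (sA (inr 0) c q) (rx c q) (rv c q).
generalize (sph (gradsq f) c q) (sph (hess_grad f) c q) (sph (lap f) c q) (xq q) (S c q).
move=> g h D x s s0 r r' SB s0E.
transitivity (- (g + x * (D * g - h) + x ^+ 2 * SB + x ^+ 2 * (1 - 2 * m * x) * s0 * s0 +
   2 * ((- 2^-1 * g - s + x * (2^-1 * h + 2^-1 * (s * D) - 4^-1 * (D * g)) + x ^+ 2 * r) *
     (1 + 2^-1 * (x * D) + x ^+ 2 * r')))); first by rewrite -s0E.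
by field.
Qed.

Local Notation adm_x := (adm_x sf t1 t2 hL).
Local Notation aS := (adm_Sf sf t2 t1_gt0 hL).
Local Notation adm_time_diff := (adm_time_diff sf t2 t1_gt0 hL).
Local Notation adm_sphere := (adm_sphere sf t1 t2 hL).
Local Notation aLV := (adm_LfV sf t1 t2 hL).

(* Purely syntactic: unification of two different sphere functions is costly. *)
Ltac smooth_sphere := repeat lazymatch goal with
  | |- smooth_on _ (DS _ _) => apply: smooth_DS
  | |- smooth_on _ (radial _) => exact: smooth_f
  | |- smooth_on _ (gradsq _) => exact: smooth_gradsq
  | |- smooth_on _ (lap _) => exact: smooth_lap
  | |- smooth_on _ (hess_grad _) => exact: smooth_hess_grad
  | |- smooth_on _ (B1 _) => exact: smooth_B1
  end.

Ltac adms := repeat lazymatch goal with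
  | |- admissible _ _ (fun c q => @?F c q + @?G c q) => apply: (adm_add oU)
  | |- admissible _ _ (fun c q => - @?F c q) => apply: (adm_opp oU)
  | |- admissible _ _ (fun c q => @?F c q * @?G c q) => apply: (adm_mul oU)
  | |- admissible _ _ (fun c q => @?F c q ^+ _) => apply: (adm_exp oU)
  | |- admissible _ _ (fun c q => bigop.body _ _ (@?F c q)) => apply: (adm_sum oU); move=> ?
  | |- admissible _ _ (fun c q => sphf _ _ _ _) => apply: adm_sphere; smooth_sphere
  | |- admissible _ _ (sphf _ _) => apply: adm_sphere; smooth_sphere
  | |- admissible _ _ (Sf _) => exact: aS
  | |- admissible _ _ (time_diff _ _) => exact: adm_time_diff
  | |- admissible _ _ (fun c q => xq q) => exact: adm_x
  | |- admissible _ _ (fun c q => Sf _ _ _) => exact: aS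
  | |- admissible _ _ (fun c q => time_diff _ _ _ _) => exact: adm_time_diff
  | |- admissible _ _ (fun c q => (Lf _ _ _)^-1) => exact: aLV
  | |- admissible _ _ (fun c q => ?a) => exact: adm_cst
  | h : admissible _ _ ?F |- admissible _ _ ?F => exact: h
  | h : admissible _ _ ?F |- admissible _ _ (fun c q => ?F _ _) => exact: h
  | h : forall a, admissible _ _ _ |- admissible _ _ _ => exact: h
  end.

Lemma adm_rv : adm rv. Proof. by rewrite /rv; adms. Qed.
Lemma adm_ra a : adm (ra a).
Proof.
have h1 := adm_rv; have h2 : adm (cA a) by rewrite /cA; adms.
by rewrite /ra; adms.
Qed.
Lemma adm_X0 : adm X0. Proof. by rewrite /X0; adms. Qed.
Lemma adm_X1 : adm X1. Proof. by rewrite /X1; adms. Qed.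
Lemma adm_rx : adm rx.
Proof. by have h1 := adm_rv; have h2 := adm_X0; rewrite /rx; adms. Qed.
Lemma adm_rw : adm rw.
Proof.
have h1 := adm_rv; have h2 := adm_X0; have h3 := adm_X1; have h4 := adm_rx; have h5 := adm_ra.
by rewrite /rw; adms.
Qed.
Lemma adm_time_norm : adm time_norm.
Proof. by rewrite /time_norm /gm; adms. Qed.

Let dsph (F : 'rV[R]_(2 + 1) -> R) c q : smooth_on nonzero F -> differentiable (sph F c) q.
Proof. exact: differentiable_sphf. Qed.

Let dx q : differentiable (@xq R 1) q.
Proof. exact: differentiable_coord. Qed.

(** As [x d/dx] multiplies [x^k] by [k] and the other fields annihilate it, the
    order of a remainder is preserved by differentiation along the frame. *)
Lemma fd_expand A (F G H : fam) c q : differentiable (F c) q -> differentiable (G c) q ->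
  differentiable (H c) q ->
  fd A (fun c q => F c q + xq q * G c q + xq q ^+ 2 * H c q) c q =
  fd A F c q + xq q * fd A G c q + xq q ^+ 2 * fd A H c q +
  match A with inl _ => 0 | inr j => (0 == j)%:R * (xq q * G c q + 2 * (xq q ^+ 2 * H c q)) end.
Proof.
move=> dF dG dH.
have dx2 : differentiable (fun z : 'rV[R]_(2 + 2) => xq z * xq z) q by have := dx q => ?; diffs.
have -> : (fun c q => F c q + xq q * G c q + xq q ^+ 2 * H c q) =
   (fun c q => (F c q + xq q * G c q) + (xq q * xq q) * H c q).
  by apply/funext => ?; apply/funext => ?; rewrite expr2.
have dxq := dx q.
rewrite (fdD efN A (F := fun c q => F c q + xq q * G c q)); try by diffs.
rewrite (fdD efN A (F := F)); try by diffs.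
rewrite (fdM efN A (F := fun c q => xq q) (G := G)) //.
rewrite (fdM efN A (F := fun c q => xq q * xq q) (G := H)) //.
rewrite (fdM efN A (F := fun c q => xq q) (G := fun c q => xq q)) // !fd_xq.
by case: A => [a|j]; move: (fd _ F c q) (fd _ G c q) (fd _ H c q) => *; ring.
Qed.

(** The wave operator of the metric applied to [S], in the frame; see [div_Tvec]. *)
Definition boxS : fam := fun c q =>
  (\sum_a fd (inl a) (sA (inl a)) c q)
  + xq q ^+ 2 * (fd (inr 0) (fun c q => (1 - 2 * m * xq q) * sA (inr 0) c q) c q
                 - (1 - 2 * m * xq q) * sA (inr 0) c q)
  - 2 * sA (inr 1) c q + (fd (inr 0) (sA (inr 1)) c q - sA (inr 1) c q)
  + fd (inr 1) (sA (inr 0)) c q.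

Definition rb : fam := fun c q =>
  (\sum_a (sph (DS a (B1 a)) c q + fd (inl a) (ra a) c q))
  + (fd (inr 0) (fun c q => (1 - 2 * m * xq q) * sA (inr 0) c q) c q
                 - (1 - 2 * m * xq q) * sA (inr 0) c q)
  - 2 * rv c q + (rv c q + fd (inr 0) rv c q)
  + (- rv c q + 4^-1 * (sph (lap f) c q * sph (lap f) c q)
     + 2^-1 * (xq q * (sph (lap f) c q * rv c q)) + fd (inr 1) rx c q).

(** At order 0 the derivatives [e_v S] and [e_v (x d_x S)] contribute [- 3] and
    [- 1]; at order 1 all terms are multiples of [Lap f], and they cancel. *)
Lemma box_expand c q : img c q -> boxS c q = - 4 + xq q ^+ 2 * rb c q.
Proof.
move=> hq; have hs := img_small_x hq.
have d_ra a : differentiable (ra a c) q by exact: (adm_diff (adm_ra a)).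
have d_rv : differentiable (rv c) q by exact: (adm_diff adm_rv).
have d_rx : differentiable (rx c) q by exact: (adm_diff adm_rx).
have d_X0 : differentiable (X0 c) q by exact: (adm_diff adm_X0).
have d_X1 : differentiable (X1 c) q by exact: (adm_diff adm_X1).
have dl : differentiable (sph (lap f) c) q by apply: dsph; exact: smooth_lap.
have dg : differentiable (sph (gradsq f) c) q by apply: dsph; exact: smooth_gradsq.
have dh : differentiable (sph (hess_grad f) c) q by apply: dsph; exact: smooth_hess_grad.
have dS : differentiable (S c) q by exact: S_diff.
have eA a : fd (inl a) (sA (inl a)) c q = xq q * sph (DS a (DS a (radial f))) c q
    + xq q ^+ 2 * (sph (DS a (B1 a)) c q + fd (inl a) (ra a) c q).
  rewrite (fd_ext efN (fun=> @open_slab R x0) (inl a) (U := fun=> slab) (fun c q => @time_diff_sphere a c q)) //.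
  rewrite fd_expand //; [|by apply: dsph; smooth_sphere|by apply: dsph; smooth_sphere].
  rewrite !fd_sphf; [|by smooth_sphere|by smooth_sphere].
  by ring.
have e1 : fd (inr 0) (sA (inr 1)) c q = 2^-1 * (xq q * sph (lap f) c q)
    + xq q ^+ 2 * (2 * rv c q + fd (inr 0) rv c q).
  rewrite (fd_ext efN (fun=> @open_slab R x0) (inr 0) (U := fun=> slab)
    (G := fun c q => 1 + xq q * (2^-1 * sph (lap f) c q) + xq q ^+ 2 * rv c q)) //; last first.
    by move=> c' q' h'; rewrite time_diff_v // mulrCA.
  rewrite fd_expand //; try by diffs.
  rewrite fd_cst (fdM efN (inr 0) (F := fun c q => 2^-1)); try by diffs.
  rewrite fd_cst fd_sphf; last by smooth_sphere.
  by rewrite eqxx /= mulr1n; field.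
have e0 : fd (inr 1) (sA (inr 0)) c q = - sA (inr 1) c q
    + xq q * (2^-1 * (sph (lap f) c q * sA (inr 1) c q)) + xq q ^+ 2 * fd (inr 1) rx c q.
  rewrite (fd_ext efN (fun=> @open_slab R x0) (inr 1) (U := fun=> slab) (fun c q => @time_diff_x c q)) //.
  rewrite fd_expand //.
  have f0 : fd (inr 1) X0 c q = - sA (inr 1) c q.
    rewrite /X0; have -> : (fun c q => - 2^-1 * sph (gradsq f) c q - S c q) =
      (fun c q => - 2^-1 * sph (gradsq f) c q + (-1) * S c q).
      by apply/funext => ?; apply/funext => ?; rewrite mulN1r.
    rewrite (fdD efN _ (F := fun c q => - 2^-1 * sph (gradsq f) c q)); try by diffs.
    rewrite (fdM efN _ (F := fun c q => - 2^-1)); try by diffs.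
    rewrite (fdM efN _ (F := fun c q => - 1)); try by diffs.
    rewrite !fd_cst fd_sphf; last by smooth_sphere.
    by rewrite (fd_Sf sf hL) //; ring.
  have f1 : fd (inr 1) X1 c q = 2^-1 * (sph (lap f) c q * sA (inr 1) c q).
    rewrite /X1; have -> : (fun c q => 2^-1 * sph (hess_grad f) c q + 2^-1 * (S c q * sph (lap f) c q)
       - 4^-1 * (sph (lap f) c q * sph (gradsq f) c q)) =
      (fun c q => 2^-1 * sph (hess_grad f) c q + (2^-1 * (S c q * sph (lap f) c q)
       + (- 4^-1) * (sph (lap f) c q * sph (gradsq f) c q))).
      by apply/funext => ?; apply/funext => ?; rewrite mulNr addrA.
    rewrite (fdD efN _ (F := fun c q => 2^-1 * sph (hess_grad f) c q)); try by diffs.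
    rewrite (fdD efN _ (F := fun c q => 2^-1 * (S c q * sph (lap f) c q))); try by diffs.
    rewrite (fdM efN _ (F := fun c q => 2^-1) (G := sph (hess_grad f))); try by diffs.
    rewrite (fdM efN _ (F := fun c q => 2^-1) (G := fun c q => S c q * sph (lap f) c q)); try by diffs.
    rewrite (fdM efN _ (F := fun c q => - 4^-1)); try by diffs.
    rewrite (fdM efN _ (F := S) (G := sph (lap f))) //.
    rewrite (fdM efN _ (F := sph (lap f)) (G := sph (gradsq f))) //.
    rewrite !fd_cst !fd_sphf; [|by smooth_sphere|by smooth_sphere|by smooth_sphere].
    by rewrite (fd_Sf sf hL) //; ring.
  by rewrite f0 f1 /=; ring.
rewrite /boxS e0 e1; under eq_bigr do rewrite eA.
rewrite big_split /= -!mulr_sumr lapE /rb.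
set SB := \sum_a _; set W1 := fd _ _ c q - _ * sA (inr 0) c q.
rewrite time_diff_v //.
have key (SB' W1' d1 d2 r D x : R) :
  x * D + x ^+ 2 * SB' + x ^+ 2 * W1' - 2 * (1 + 2^-1 * (x * D) + x ^+ 2 * r) +
  (2^-1 * (x * D) + x ^+ 2 * (2 * r + d1) - (1 + 2^-1 * (x * D) + x ^+ 2 * r)) +
  (- (1 + 2^-1 * (x * D) + x ^+ 2 * r) +
   x * (2^-1 * (D * (1 + 2^-1 * (x * D) + x ^+ 2 * r))) + x ^+ 2 * d2) =
  - 4 + x ^+ 2 * (SB' + W1' - 2 * r + (r + d1) +
     (- r + 4^-1 * (D * D) + 2^-1 * (x * (D * r)) + d2)) by field.
exact: key.
Qed.

Lemma adm_rb : adm rb.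
Proof.
have h1 := adm_rv; have h2 := adm_rx; have h3 := adm_ra.
have h4 : adm (fd (inr 0) (fun c q => (1 - 2 * m * xq q) * sA (inr 0) c q)).
  by apply: adm_fd; clear h3; adms.
have h8 : adm (fd (inr 0) rv) by exact: adm_fd.
have h9 : adm (fd (inr 1) rx) by exact: adm_fd.
have h10 a : adm (fd (inl a) (ra a)) by exact: adm_fd.
clear h3; rewrite /rb; adms.
Qed.

(** The inner product of [dF] and [dS], in the frame. *)
Definition innerS (F : fam) : fam := fun c q =>
  (\sum_a fd (inl a) F c q * sA (inl a) c q)
  + gm m (xq q) * fd (inr 0) F c q * sA (inr 0) c q
  + fd (inr 0) F c q * sA (inr 1) c q + fd (inr 1) F c q * sA (inr 0) c q.

Definition rho : fam := fun c q =>
  (\sum_a fd (inl a) rw c q * sA (inl a) c q)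
  + gm m (xq q) * (fd (inr 0) rw c q + 2 * rw c q) * sA (inr 0) c q
  + (fd (inr 0) rw c q + 2 * rw c q) * sA (inr 1) c q + fd (inr 1) rw c q * sA (inr 0) c q.

(** As [w = 2 S + x^2 r], the leading part is [2 <dS, dS> = - 2 w]. *)
Lemma inner_expand c q : img c q -> innerS time_norm c q = - (2 * time_norm c q) + xq q ^+ 2 * rho c q.
Proof.
move=> hq; have hs := img_small_x hq.
have d_rw : differentiable (rw c) q by exact: (adm_diff adm_rw).
have dS : differentiable (S c) q by exact: S_diff.
have e A : fd A time_norm c q = 2 * sA A c q + xq q ^+ 2 * (fd A rw c q +
    match A with inl _ => 0 | inr j => (0 == j)%:R * (2 * rw c q) end).
  rewrite (fd_ext efN (fun=> @open_slab R x0) A (U := fun=> slab)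
    (G := fun c q => 2 * S c q + xq q * 0 + xq q ^+ 2 * rw c q)) //; last first.
    by move=> c' q' h'; rewrite time_norm_expand // mulr0 addr0.
  rewrite fd_expand //; try by diffs.
  rewrite (fdM efN A (F := fun c q => 2)); try by diffs.
  rewrite !fd_cst (fd_Sf sf hL) //.
  case: A => [a|j]; first by generalize (fd (inl a) rw c q) (sA (inl a) c q) => *; ring.
  by generalize (fd (inr j) rw c q) (sA (inr j) c q) (rw c q) => *; ring.
rewrite /innerS /rho !e.
under eq_bigr do rewrite e addr0 mulrDl -mulrA -[X in _ + X]mulrA.
rewrite big_split /= -!mulr_sumr /time_norm.
have key (g x s0 s1 d0 d1 r S1' S2' : R) :
  2 * S1' + x ^+ 2 * S2' + g * (2 * s0 + x ^+ 2 * (d0 + true%:R * (2 * r))) * s0 +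
  (2 * s0 + x ^+ 2 * (d0 + true%:R * (2 * r))) * s1
  + (2 * s1 + x ^+ 2 * (d1 + false%:R * (2 * r))) * s0 =
  - (2 * - (S1' + g * s0 * s0 + 2 * (s0 * s1))) + x ^+ 2 * (S2' + g * (d0 + 2 * r) * s0
   + (d0 + 2 * r) * s1 + d1 * s0) by rewrite /= mulr1n mulr0n; ring.
exact: key.
Qed.

Lemma adm_rho : adm rho.
Proof.
have h0 := adm_rw.
have h1 : adm (fd (inr 0) rw) by exact: adm_fd.
have h2 : adm (fd (inr 1) rw) by exact: adm_fd.
have h3 a : adm (fd (inl a) rw) by exact: adm_fd.
by rewrite /rho /gm; adms.
Qed.

End Expansion.

(** * The parametrization is a diffeomorphism *)

Section Points.
Context {R : realType}.
Implicit Types (q z : 'rV[R]_(2 + 2)).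

Lemma pt_r0 (u : 'rV[R]_2) x v : pt u x v 0 (rshift 2 0) = x.
Proof.
rewrite /pt row_mxEr; have -> : (0 : 'I_2) = lshift 1 (0 : 'I_1) by exact: val_inj.
by apply: etrans (row_mxEl _ _ _ _) _; rewrite mxE.
Qed.

Lemma pt_r1 (u : 'rV[R]_2) x v : pt u x v 0 (rshift 2 1) = v.
Proof.
rewrite /pt row_mxEr; have -> : (1 : 'I_2) = rshift 1 (0 : 'I_1) by exact: val_inj.
by apply: etrans (row_mxEr _ _ _ _) _; rewrite mxE.
Qed.

Lemma pt_l (u : 'rV[R]_2) x v i : pt u x v 0 (lshift 2 i) = u 0 i.
Proof. by rewrite /pt row_mxEl. Qed.

Lemma ang_pt (u : 'rV[R]_2) x v : lsubmx (pt u x v) = u.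
Proof. by rewrite /pt row_mxKl. Qed.

Lemma xq_pt (u : 'rV[R]_2) x v : xq (pt u x v) = x.
Proof. exact: pt_r0. Qed.

Lemma vq_pt (u : 'rV[R]_2) x v : vq (pt u x v) = v.
Proof. exact: pt_r1. Qed.

Lemma last_coE q : last_co q = vq q.
Proof. by rewrite /last_co mxE. Qed.

Lemma ptK q : pt (lsubmx q) (xq q) (vq q) = q.
Proof.
apply/rowP => i; rewrite -(splitK i); case: (fintype.split i) => j /=.
  by rewrite pt_l mxE.
by have [->|->] := ord2P j; rewrite ?pt_r0 ?pt_r1.
Qed.

End Points.

Section Foliation.
Context {R : realType} (m : R) (f : 'rV[R]_(2 + 1) -> R) (sf : smooth_on_sphere f).
Variables (x0 t1 t2 : R).
Hypothesis t1_gt0 : 0 < t1.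
Hypothesis t12 : t1 < t2.
Hypothesis hL : forall c q, 0 < xq q < x0 -> 2^-1 <= Lf f c q.
Implicit Types (c : bool) (q z : 'rV[R]_(2 + 2)) (a : 'I_(2 + 1)).
Local Notation img := (img f x0 t1 t2).
Local Notation S := (Sf f).
Local Notation slab := (small_x x0).
Local Notation Phi := (Defs.Phi f).
Local Notation Dom := (Dom t1 t2 x0).
Local Notation N := (Defs.N f t1 t2 x0).

Let oU : forall c, open (img c) := open_img sf hL.

Lemma Sf_Phi c z : slab z -> S c (Phi c z) = 2^-1 * vq z ^+ 2.
Proof.
move=> hz; have Ln : Lf f c (Phi c z) != 0.
  by apply: (Lf_neq0 hL); rewrite /small_x /Defs.Phi /= xq_pt xcoE.
have xn := slab_neq0 hz.
rewrite /Sf /nf /Defs.Phi vq_pt xq_pt (PfunE sf) // xcoE last_coE.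
move: Ln; rewrite /Lf /Defs.Phi !xq_pt xcoE /sphf !ang_pt /ang.
generalize (radial f (stereo c (lsubmx z))) (gradsq f (stereo c (lsubmx z))).
generalize (lap f (stereo c (lsubmx z))) (hess_grad f (stereo c (lsubmx z))).
move=> D h r g Ln; move: xn Ln; generalize (xq z) (vq z) => x v xn Ln.
apply: (canLR (mulfK (mulf_neq0 xn Ln))).
by field.
Qed.

(** The inverse of [Phi] in closed form. *)
Definition Psi c q := pt (lsubmx q) (xq q) (Num.sqrt (2 * S c q)).

Lemma Phi_Psi c q : slab q -> 0 <= S c q -> Phi c (Psi c q) = q.
Proof.
move=> hq S0; rewrite -[RHS](ptK q) /Defs.Phi /Psi xcoE xq_pt last_coE vq_pt /ang ang_pt.
have S2 : 0 <= 2 * S c q by exact: mulr_ge0.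
congr pt; rewrite (PfunE sf) sqr_sqrtr //.
have := SfE hL c hq; rewrite /nf /Lf /sphf.
generalize (radial f (stereo c (lsubmx q))) (gradsq f (stereo c (lsubmx q))).
generalize (lap f (stereo c (lsubmx q))) (hess_grad f (stereo c (lsubmx q))).
generalize (S c q) (xq q) (vq q) => s x v D h r g e.
have -> : v = s * (x * (1 - 2^-1 * x * D)) - r + 2^-1 * (x * g) - 4^-1 * (x ^+ 2 * h).
  by rewrite e; ring.
by field.
Qed.

Lemma Dom_slab z : Dom z -> slab z.
Proof. by rewrite /Defs.Dom /= xcoE => -[]. Qed.

Lemma xq_Phi c z : xq (Phi c z) = xq z.
Proof. by rewrite /Defs.Phi xq_pt xcoE. Qed.

Lemma ang_Phi c z : lsubmx (Phi c z) = lsubmx z.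
Proof. exact: ang_pt. Qed.

Lemma half_sq_lt (a b : R) : 0 <= a -> 0 <= b -> (2^-1 * a ^+ 2 < 2^-1 * b ^+ 2) = (a < b).
Proof. by move=> a0 b0; rewrite ltr_pM2l ?invr_gt0 // ltr_pXn2r. Qed.

(** [Phi] maps a point with last coordinate [tau] to a point with [S = tau^2 / 2]. *)
Lemma N_img c : N c = img c.
Proof.
have t2_gt0 := lt_trans t1_gt0 t12.
apply/seteqP; split => [q [z hz <-]|q hq].
  have hs := Dom_slab hz; case: hz => _ /andP[]; rewrite last_coE => z1 z2.
  have z0 := lt_trans t1_gt0 z1.
  split; first by rewrite xq_Phi.
  by rewrite Sf_Phi // !half_sq_lt ?ltW // z1 z2.
have hs := img_small_x hq; have S0 := Sf_gt0 t1_gt0 hq.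
exists (Psi c q); last by apply: Phi_Psi => //; exact: ltW.
rewrite /Defs.Dom /= xcoE last_coE /Psi xq_pt vq_pt; split; first by case: hq.
have SE : S c q = 2^-1 * Num.sqrt (2 * S c q) ^+ 2.
  by rewrite sqr_sqrtr ?mulKf //; apply: mulr_ge0 => //; exact: ltW.
have : 2^-1 * t1 ^+ 2 < 2^-1 * Num.sqrt (2 * S c q) ^+ 2 < 2^-1 * t2 ^+ 2.
  by rewrite -SE; case: hq.
by rewrite !half_sq_lt ?sqrtr_ge0 // ltW.
Qed.

Lemma Phi_inj c : {in Dom &, injective (Phi c)}.
Proof.
move=> z z'; rewrite !inE => hz hz' e.
have tt0 : 2^-1 * vq z' ^+ 2 = 2^-1 * vq z ^+ 2.
  by rewrite -(Sf_Phi c (Dom_slab hz)) -(Sf_Phi c (Dom_slab hz')) -e.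
have tt : vq z' ^+ 2 = vq z ^+ 2.
  by move: tt0 => /mulfI; apply; rewrite invr_neq0 // pnatr_eq0.
have [z0 z0'] : 0 < vq z /\ 0 < vq z'.
  by case: hz hz' => _ /andP[+ _] [_ /andP[+ _]]; rewrite !last_coE => h h'; split; exact: lt_trans t1_gt0 _.
have vE : vq z' = vq z by have := congr1 Num.sqrt tt; rewrite !sqrtr_sqr !gtr0_norm.
have uE : lsubmx z = lsubmx z' by rewrite -(ang_Phi c z) -(ang_Phi c z') e.
have xE : xq z = xq z' by rewrite -(xq_Phi c z) -(xq_Phi c z') e.
by rewrite -(ptK z) -(ptK z') vE uE xE.
Qed.

Local Notation Phi_inv := (Defs.Phi_inv f t1 t2 x0).

Lemma Phi_invE c q : img c q -> Phi_inv c q = Psi c q.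
Proof.
move=> hq; have hs := img_small_x hq; have S0 := ltW (Sf_gt0 t1_gt0 hq).
have [z hz zq] : N c q by rewrite N_img.
rewrite /Defs.Phi_inv -zq pinvKV; [|exact: Phi_inj|by rewrite inE].
have hz' := Dom_slab hz.
rewrite /Psi Sf_Phi // mulrA mulfV // mul1r sqrtr_sqr gtr0_norm; last first.
  by case: hz => _ /andP[+ _]; rewrite last_coE; exact: lt_trans.
by rewrite xq_Phi ang_Phi ptK.
Qed.

Lemma smooth_expr_row (U : set 'rV[R]_(2 + 2)) (F : 'rV[R]_(2 + 2) -> 'rV[R]_(2 + 2)) :
  (forall i : 'I_2, smooth_expr U (fun z => F z 0 (lshift 2 i))) ->
  smooth_expr U (fun z => xq (F z)) -> smooth_expr U (fun z => vq (F z)) ->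
  forall i, smooth_expr U (fun z => F z 0 i).
Proof.
move=> hl h0 h1 i; rewrite -(splitK i); case: (fintype.split i) => j //=.
by have [->|->] := ord2P j.
Qed.

(** Both [Phi] and its closed inverse [Psi] are smooth expressions. *)
Lemma Phi_diffeoP : Phi_diffeo f t1 t2 x0.
Proof.
move=> c; split.
- exact: Phi_inj.
- by rewrite N_img.
- have oD : open Dom.
    rewrite (_ : Dom = slab `&` ([set z | t1 < vq z] `&` [set z | vq z < t2])); last first.
      apply/seteqP; split => z; rewrite /Defs.Dom /small_x /= xcoE last_coE.
        by move=> [? /andP[]].
      by move=> [? [? ?]]; split => //; apply/andP.
    have cv : continuous (@vq R) by move=> q; apply: differentiable_continuous; exact: differentiable_coord.
    apply: openI; first exact: open_slab.
    apply: openI.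
      by apply: (@open_comp _ _ (@vq R) [set r | t1 < r]); [move=> q _; exact: cv|exact: open_gt].
    by apply: (@open_comp _ _ (@vq R) [set r | r < t2]); [move=> q _; exact: cv|exact: open_lt].
  move=> i; apply: smooth_expr_on => //.
  have s1 := smooth_expr_sph c Dom (smooth_f sf).
  have s2 := smooth_expr_sph c Dom (smooth_gradsq sf).
  have s3 := smooth_expr_sph c Dom (smooth_lap sf).
  have s4 := smooth_expr_sph c Dom (smooth_hess_grad sf).
  have sx : smooth_expr Dom (@xq R 1) by exact: SmoothCoord.
  have sv : smooth_expr Dom (@vq R) by exact: SmoothCoord.
  move: i; apply: smooth_expr_row => [i||].
  + by under eq_fun do rewrite /Defs.Phi pt_l mxE; exact: SmoothCoord.
  + by under eq_fun do rewrite xq_Phi.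
  + under eq_fun do rewrite /Defs.Phi vq_pt (PfunE sf) xcoE last_coE.
    by smooths.
- move=> i; rewrite N_img; apply: smooth_expr_on => //.
  have sS : smooth_expr (img c) (S c).
    apply: SmoothBase; apply: (smooth_onW (@img_small_x _ f x0 t1 t2 c)).
    by apply: smooth_expr_on; [exact: open_slab|exact: smooth_Sf].
  have sPsi j : smooth_expr (img c) (fun q => Psi c q 0 j).
    move: j; apply: smooth_expr_row => [j||].
    + by under eq_fun do rewrite /Psi pt_l mxE; exact: SmoothCoord.
    + by under eq_fun do rewrite /Psi xq_pt; exact: SmoothCoord.
    + under eq_fun do rewrite /Psi vq_pt.
      apply: (@SmoothSqrt _ _ _ (fun q => 2 * S c q)); first by smooths.
      by move=> q hq; rewrite mulr_gt0 // (Sf_gt0 t1_gt0 hq).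
  apply: SmoothBase; apply: (smooth_on_ext (@oU c) (F := fun q => Psi c q 0 i)).
    by move=> q hq; rewrite Phi_invE.
  by apply: smooth_expr_on.
Qed.

(** The abstract inverse of [Phi] agrees with [Psi] on the image. *)
Lemma tauE c q : img c q -> tau f t1 t2 x0 c q = Num.sqrt (2 * S c q).
Proof. by move=> hq; rewrite /tau Phi_invE // last_coE vq_pt. Qed.

End Foliation.

(** * Lapse, unit normal and reference metric *)

Section TimeFunctionGeometry.
Context {R : realType} (m : R) (f : 'rV[R]_(2 + 1) -> R) (sf : smooth_on_sphere f).
Variables (x0 t1 t2 eps : R).
Hypothesis t1_gt0 : 0 < t1.
Hypothesis t12 : t1 < t2.
Hypothesis hL : forall c q, 0 < xq q < x0 -> 2^-1 <= Lf f c q.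
Hypothesis eps_gt0 : 0 < eps.
Hypothesis hw : forall c q, img f x0 t1 t2 c q -> eps <= time_norm m f c q.
Implicit Types (c : bool) (q z : 'rV[R]_(2 + 2)) (a : 'I_(2 + 1)).
Local Notation fam := (bool -> 'rV[R]_(2 + 2) -> R).
Local Notation img := (img f x0 t1 t2).
Local Notation efN := (prod_frame (fun c : bool => c)).
Local Notation thN := (prod_coframe (fun c : bool => c)).
Local Notation fd := (frame_diff efN).
Local Notation adm := (admissible img efN).
Local Notation S := (Sf f).
Local Notation sA := (time_diff f).
Local Notation wS := (time_norm m f).
Local Notation gSch := (gSch m).
Local Notation gInv := (gInv m).
Local Notation tau := (tau f t1 t2 x0).
Local Notation grad_tau := (grad_tau m f t1 t2 x0).
Local Notation lapse := (lapse m f t1 t2 x0).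
Local Notation Tvec := (Tvec m f t1 t2 x0).
Local Notation omega := (omega m f t1 t2 x0).
Local Notation gRef := (gRef m f t1 t2 x0).

Let oU : forall c, open (img c) := open_img sf hL.
Let Ux : forall c q, img c q -> 0 < xq q < x0 := @img_x R f x0 t1 t2.

Let xn c q : img c q -> xq q != 0.
Proof. by move=> hq; apply: (xq_neq0 Ux hq). Qed.

Lemma gInv_sym q : (gInv q)^T = gInv q.
Proof.
apply/matrixP => i j; rewrite mxE.
rewrite -(splitK i) -(splitK j); case: (fintype.split i) => i'; case: (fintype.split j) => j' /=;
  rewrite !gInvE //; first by rewrite eq_sym.
by have [->|->] := ord2P i'; have [->|->] := ord2P j'.
Qed.

Lemma gSch_tr c q : (gSch c q)^T = gSch c q.
Proof. by apply/matrixP => i j; rewrite mxE gSch_sym. Qed.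

Lemma gInv_gSch c q : img c q -> gInv q *m gSch c q = 1%:M.
Proof. by move=> hq; rewrite -(invmx_gSch m c (xn hq)) mulVmx // gSch_unit // (xn hq). Qed.

Lemma grad_gSch c (F : 'rV[R]_(2 + 2) -> R) q : img c q ->
  grad (gSch c) F q = (\row_i pd i F q) *m gInv q.
Proof. by move=> hq; rewrite /grad invmx_gSch // (xn hq). Qed.

Lemma ip_raise c q (p p' : 'rV[R]_(2 + 2)) : img c q ->
  ip (gSch c q) (p *m gInv q) (p' *m gInv q) = (p *m gInv q *m p'^T) 0 0.
Proof.
move=> hq; rewrite /ip trmx_mul gInv_sym -!mulmxA (mulmxA (gSch c q)) .
by rewrite gSch_inverse ?(xn hq) // mul1mx.
Qed.

Definition dS c q : 'rV[R]_(2 + 2) := \row_i pd i (S c) q.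

Lemma dS_frame c q A : img c q -> \sum_i efN c A q 0 i * dS c q 0 i = sA A c q.
Proof.
move=> /img_small_x hq; rewrite -(fd_Sf sf hL) // /frame_diff.
by apply: eq_bigr => i _; rewrite mxE.
Qed.

Lemma dS_rr c q (j : 'I_2) : img c q -> xq q * dS c q 0 (rshift 2 j) = sA (inr j) c q.
Proof.
move=> hq; rewrite -(fd_Sf sf hL (inr j) c (img_small_x hq)).
by rewrite (@fd_inr R 1 bool (fun c => c) j) mxE.
Qed.

Lemma norm_dS c q : img c q -> (dS c q *m gInv q *m (dS c q)^T) 0 0 = - wS c q.
Proof.
move=> hq; rewrite (gInv_frame m c) ?(xn hq) // !dS_rr // /time_norm opprK.
under eq_bigr do rewrite !dS_frame //.
by rewrite -!addrA; congr (_ + (_ + _)); ring.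
Qed.

Lemma pd_tau i c q : img c q -> pd i (tau c) q = (Num.sqrt (2 * S c q))^-1 * pd i (S c) q.
Proof.
move=> hq; have dS : differentiable (S c) q by exact: (S_diff sf hL c (img_small_x hq)).
have S2 : 0 < 2 * S c q by rewrite mulr_gt0 // (Sf_gt0 t1_gt0 hq).
rewrite (eq_open_pd i (@oU c) (G := fun q => Num.sqrt (2 * S c q))) //; last first.
  by move=> z hz; rewrite (tauE sf t1_gt0 t12 hL).
have d2 : differentiable (fun z => 2 * S c z) q by diffs.
rewrite pd_sqrt // pdM //.
rewrite pd_cst mul0r add0r invfM; set s := Num.sqrt _; by rewrite mulrACA mulVf ?mul1r // pnatr_eq0.
Qed.

Lemma grad_tauE c q : img c q ->
  grad_tau c q = (Num.sqrt (2 * S c q))^-1 *: (dS c q *m gInv q).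
Proof.
move=> hq; rewrite /Defs.grad_tau grad_gSch // scalemxAl; congr (_ *m _).
by apply/rowP => i; rewrite !mxE pd_tau.
Qed.

Let S2_gt0 c q : img c q -> 0 < 2 * S c q.
Proof. by move=> hq; rewrite mulr_gt0 // (Sf_gt0 t1_gt0 hq). Qed.

Let w_gt0 c q : img c q -> 0 < wS c q.
Proof. by move=> /hw; exact: lt_le_trans. Qed.

Lemma ip_grad_tau c q : img c q ->
  ip (gSch c q) (grad_tau c q) (grad_tau c q) = - (wS c q / (2 * S c q)).
Proof.
move=> hq; rewrite grad_tauE // !scalemxAl ip_raise //.
rewrite linearZ /= -!scalemxAl -!scalemxAr mxE [X in _ * X]mxE norm_dS // mulrA -invfM -expr2 sqr_sqrtr ?ltW ?S2_gt0 //.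
by rewrite mulrN mulrC.
Qed.

(** The factor between [- grad S] and the unit normal [T]. *)
Definition inv_time_norm : fam := fun c q => (Num.sqrt (wS c q))^-1.

Lemma lapseE c q : img c q -> lapse c q = Num.sqrt (2 * S c q) * inv_time_norm c q.
Proof.
move=> hq; rewrite /Defs.lapse ip_grad_tau // opprK /inv_time_norm.
rewrite sqrtrM ?ltW ?w_gt0 // sqrtrV ?ltW ?S2_gt0 // invfM invrK mulrC //.
Qed.

Lemma TvecE c q : img c q -> Tvec c q = - inv_time_norm c q *: (dS c q *m gInv q).
Proof.
move=> hq; rewrite /Defs.Tvec grad_tauE // lapseE // scalerA mulNr mulrAC mulfV ?mul1r //.
by rewrite gt_eqF // sqrtr_gt0 S2_gt0.
Qed.

Lemma omegaE c q : img c q -> omega c q = - inv_time_norm c q *: dS c q.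
Proof.
by move=> hq; rewrite /Defs.omega TvecE // -scalemxAl -mulmxA gInv_gSch // mulmx1.
Qed.

Lemma Tvec_omega c q : img c q -> Tvec c q = omega c q *m gInv q.
Proof. by move=> hq; rewrite TvecE // omegaE // scalemxAl. Qed.

Lemma nu_sq c q : img c q -> inv_time_norm c q * inv_time_norm c q * wS c q = 1.
Proof.
move=> hq; rewrite /inv_time_norm -invfM -expr2 sqr_sqrtr ?ltW ?w_gt0 // mulVf //.
by rewrite gt_eqF // w_gt0.
Qed.

Lemma norm_omega c q : img c q -> omega c q *m (Tvec c q)^T = (-1)%:M.
Proof.
move=> hq; rewrite omegaE // TvecE // [(_ *: _)^T]linearZ /= trmx_mul gInv_sym.
rewrite -scalemxAl -scalemxAr scalerA mulrNN mulmxA [X in _ *: X]mx11_scalar norm_dS //.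
by rewrite scale_scalar_mx mulrN nu_sq.
Qed.

(** The reference metric differs from [g] by the reflection along [T], which is
    an involution; hence its inverse is obtained by raising both indices of it. *)
Lemma gRef_inverse c q : img c q ->
  gRef c q *m (gInv q + 2 *: ((Tvec c q)^T *m Tvec c q)) = 1%:M.
Proof.
move=> hq; have gT : gSch c q *m (Tvec c q)^T = (omega c q)^T.
  by rewrite /Defs.omega trmx_mul gSch_tr.
have e1 : (omega c q)^T *m omega c q *m ((Tvec c q)^T *m Tvec c q) =
          - ((omega c q)^T *m Tvec c q).
  rewrite -mulmxA (mulmxA (omega c q)) norm_omega // mul_scalar_mx scaleN1r mulmxN //.
have e2 : (omega c q)^T *m omega c q *m gInv q = (omega c q)^T *m Tvec c q.
  by rewrite -mulmxA -Tvec_omega.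
have e3 := gSch_inverse m c (xn hq).
rewrite /Defs.gRef; move: gT e1 e2 e3.
generalize (Tvec c q) (omega c q) (gSch c q) (gInv q) => T o g g' gT e1 e2 e3.
rewrite mulmxDl !mulmxDr e3 -!scalemxAr -!scalemxAl e1 e2 mulmxA gT.
set Z := _ *m T; apply/matrixP => i j; rewrite !mxE; ring.
Qed.

(** [<grad tau, d/dt> = d_v tau = d_v S / tau], and [x d_v S = 1 / L]. *)
Lemma past_directed c q : img c q -> past_directed_timelike m c q (grad_tau c q).
Proof.
move=> hq; split.
  by rewrite ip_grad_tau // oppr_lt0 divr_gt0 ?w_gt0 ?S2_gt0.
rewrite grad_tauE // /ip -!scalemxAl -(mulmxA (dS c q)) gInv_gSch // mulmx1 mxE.
rewrite mulr_gt0 ?invr_gt0 ?sqrtr_gt0 ?S2_gt0 // mxE big_split_ord /= big1 ?add0r => [|i _].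
  rewrite big_ord2 [X in _ * X + _]mxE [X in _ + _ * X]mxE /d_t pt_r0 pt_r1 mulr0 add0r mulr1.
  have := dS_rr 1 hq; have x_gt0 : 0 < xq q by case/andP: (Ux hq).
  rewrite /time_diff /num_diff /den_diff /= mul0r mulr0 subr0.
  move=> h; rewrite -(pmulr_rgt0 _ x_gt0) h mul1r invr_gt0.
  by apply: lt_le_trans (hL c (Ux hq)); rewrite invr_gt0.
by rewrite [X in _ * X]mxE /d_t pt_l [X in _ * X]mxE mulr0.
Qed.

Lemma adm_nu : adm inv_time_norm.
Proof.
have h : adm (fun c q => Num.sqrt (wS c q)).
  exact: (adm_sqrt oU (adm_time_norm m sf t2 t1_gt0 hL) eps_gt0 hw).
apply: (@adm_inv _ _ _ _ img efN oU _ (Num.sqrt eps) h); first by rewrite sqrtr_gt0.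
by move=> c q /hw he; rewrite ger0_norm ?sqrtr_ge0 // ler_wsqrtr.
Qed.

Let aS : adm S := adm_Sf sf t2 t1_gt0 hL.
Let asA' A : adm (sA A) := adm_time_diff sf t2 t1_gt0 hL A.

Let S2_ge c q : img c q -> t1 ^+ 2 <= 2 * S c q.
Proof.
by move=> /Sf_ge h; rewrite -(ler_pM2l (_ : 0 < 2^-1)) ?invr_gt0 // mulKf // pnatr_eq0.
Qed.

Lemma adm_tau : adm (fun c q => Num.sqrt (2 * S c q)).
Proof.
apply: (adm_sqrt oU _ (exprn_gt0 2 t1_gt0) S2_ge).
by apply: adm_mul => //; exact: adm_cst.
Qed.

Lemma adm_lapse : adm lapse.
Proof.
apply: (adm_ext oU) (fun c q hq => esym (lapseE hq)) _.
by apply: (adm_mul oU); [exact: adm_tau|exact: adm_nu].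
Qed.

Lemma adm_lapseV : adm (fun c q => (lapse c q)^-1).
Proof.
apply: (adm_ext oU (F := fun c q => (Num.sqrt (2 * S c q))^-1 * Num.sqrt (wS c q))).
  by move=> c q hq; rewrite lapseE // invfM /inv_time_norm invrK.
apply: (adm_mul oU); last exact: (adm_sqrt oU (adm_time_norm m sf t2 t1_gt0 hL) eps_gt0 hw).
apply: (@adm_inv _ _ _ _ img efN oU _ t1 adm_tau) => // c q /S2_ge h.
by rewrite ger0_norm ?sqrtr_ge0 // -(ger0_norm (ltW t1_gt0)) -sqrtr_sqr ler_wsqrtr.
Qed.

Definition T_coframe A : fam := fun c q => \sum_j thN c A q 0 j * Tvec c q 0 j.

(** [T] is [dS] with raised index, up to the factor [inv_time_norm]. *)
Lemma adm_T_coframe A : adm (T_coframe A).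
Proof.
apply: (adm_ext oU (F := fun c q => - inv_time_norm c q * \sum_B sA B c q * cogram thN gSch B A c q)).
  move=> c q hq; rewrite /T_coframe TvecE //.
  transitivity (- inv_time_norm c q * \sum_j thN c A q 0 j * (dS c q *m gInv q) 0 j); last first.
    by rewrite mulr_sumr; apply: eq_bigr => j _; rewrite [in RHS]mxE; ring.
  congr (_ * _); rewrite -(invmx_gSch m c (xn hq)) (raise_comp (complete_ef _ Ux)) //.
  by apply: eq_bigr => B _; rewrite dS_frame.
apply: (adm_mul oU); first by apply: (adm_opp oU); exact: adm_nu.
by apply: (adm_sum oU) => B; apply: (adm_mul oU) => //; exact: (adm_cogram_gSch _ oU Ux).
Qed.

Lemma adm_Tvec : adm_tensor img efN thN (fun c => of_vector (Tvec c)).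
Proof.
move=> I J; apply: (adm_ext oU (F := T_coframe (I 0))) (adm_T_coframe _).
by move=> c q hq; rewrite fcomp_vector.
Qed.

Lemma omega_frame A c q : img c q ->
  \sum_i efN c A q 0 i * omega c q 0 i = - inv_time_norm c q * sA A c q.
Proof.
move=> hq; rewrite -dS_frame // omegaE // mulr_sumr; apply: eq_bigr => i _.
by rewrite [in LHS]mxE; ring.
Qed.

Lemma sum_rank1 (v v' p p' : 'rV[R]_(2 + 2)) (G : 'M[R]_(2 + 2)) :
  \sum_i \sum_j v 0 i * (G + 2 *: (p^T *m p')) i j * v' 0 j =
  \sum_i \sum_j v 0 i * G i j * v' 0 j
  + 2 * ((\sum_i v 0 i * p 0 i) * (\sum_i v' 0 i * p' 0 i)).
Proof.
rewrite big_distrlr /= mulr_sumr -big_split; apply: eq_bigr => i _ /=.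
rewrite mulr_sumr -big_split; apply: eq_bigr => j _ /=.
by rewrite !mxE big_ord1 mxE; ring.
Qed.

Lemma adm_gram_gRef A B : adm (gram efN gRef A B).
Proof.
apply: (adm_ext oU (F := fun c q => gram efN gSch A B c q
   + 2 * ((- inv_time_norm c q * sA A c q) * (- inv_time_norm c q * sA B c q)))).
  by move=> c q hq; rewrite [RHS]sum_rank1 !omega_frame.
have h := adm_opp oU adm_nu.
apply: (adm_add oU); first exact: (adm_gram_gSch _ oU Ux).
by apply: (adm_mul oU); [exact: adm_cst|do !apply: (adm_mul oU) => //].
Qed.

Lemma adm_cogram_gRef A B : adm (cogram thN gRef A B).
Proof.
apply: (adm_ext oU (F := fun c q => cogram thN gSch A B c q + 2 * (T_coframe A c q * T_coframe B c q))).
  move=> c q hq; rewrite /cogram (invmx_eq (gRef_inverse hq)) sum_rank1.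
  by rewrite (invmx_gSch m c (xn hq)).
apply: (adm_add oU); first exact: (adm_cogram_gSch _ oU Ux).
by apply: (adm_mul oU); [exact: adm_cst|apply: (adm_mul oU); exact: adm_T_coframe].
Qed.

Lemma gRef_tnorm_bdd p r (B : bool -> tensor R (2 + 2) p r) :
  adm_tensor img efN thN B -> bdd img (fun c x => tnorm (gRef c) (B c) x).
Proof.
move=> aB; apply: (tnorm_bdd (complete_ef _ Ux)) => [A A'|A A'|I J]; apply: (@adm_bdd _ _ _ _ img efN).
- exact: adm_gram_gRef.
- exact: adm_cogram_gRef.
- exact: aB.
Qed.

(** The bound is uniform over the finitely many orders of differentiation and over
    the two charts, hence it bounds the supremum. *)
Lemma CNnorm_fin p r k (B : bool -> tensor R (2 + 2) p r) :
  adm_tensor img efN thN B -> (CNnorm m f t1 t2 x0 k B < +oo)%E.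
Proof.
move=> aB.
have [C hC] : exists C, forall l c z, (l <= k)%N -> img c z ->
    tnorm (gRef c) (icov (gSch c) (B c) l) z <= C.
  elim: k => [|k [C hC]].
    have [C hC] := gRef_tnorm_bdd aB; exists C => l c z; rewrite leqn0 => /eqP -> hz.
    by rewrite (le_trans (ler_norm _)) // hC.
  have [C' hC'] := gRef_tnorm_bdd (adm_icov_gSch m oU Ux (k := k.+1) aB).
  exists (Num.max C C') => l c z; rewrite leq_eqVlt ltnS => /orP[/eqP -> hz|lk hz].
    by rewrite le_max (le_trans (ler_norm _) (hC' _ _ hz)) orbT.
  by rewrite le_max hC.
apply: (@le_lt_trans _ _ C%:E); last exact: ltry.
apply: ub_ereal_sup => _ [l [c [z [lk Nz ->]]]]; rewrite lee_fin hC //.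
by rewrite -(N_img sf t1_gt0 t12 hL).
Qed.

Lemma nablaT_fin : (CNnorm m f t1 t2 x0 1 (nablaT m f t1 t2 x0) < +oo)%E.
Proof. exact: CNnorm_fin (adm_icov_gSch m oU Ux (k := 1) adm_Tvec). Qed.

Lemma riemann_fin k : (CNnorm m f t1 t2 x0 k (fun c => riemann (gSch c)) < +oo)%E.
Proof. exact: CNnorm_fin (adm_riemann_gSch m oU Ux). Qed.

Lemma grad_bdd (F : fam) : (forall A, adm (fd A F)) ->
  exists C : R, forall c q, N f t1 t2 x0 c q -> tnorm (gRef c) (grad_vec m F c) q <= C.
Proof.
move=> aF; have [|C hC] := @gRef_tnorm_bdd _ _ (grad_vec m F).
  by apply: (adm_grad oU (complete_ef _ Ux)) => // A B; exact: (adm_cogram_gSch _ oU Ux).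
exists C => c q; rewrite (N_img sf t1_gt0 t12 hL) => hq.
by rewrite (le_trans (ler_norm _)) // hC.
Qed.

Lemma lapse_bdd : exists C : R, forall c q, N f t1 t2 x0 c q ->
  [/\ `|lapse c q| <= C, `|(lapse c q)^-1| <= C & tnorm (gRef c) (grad_vec m lapse c) q <= C].
Proof.
have [C1 h1] := adm_bdd adm_lapse; have [C2 h2] := adm_bdd adm_lapseV.
have [C3 h3] := grad_bdd (fun A => adm_fd A adm_lapse).
exists (Num.max C1 (Num.max C2 C3)) => c q hN; have hq := hN.
rewrite (N_img sf t1_gt0 t12 hL) in hq.
by rewrite !le_max h1 // h2 // h3 // !orbT.
Qed.

(** [log r] is unbounded, but its frame derivatives are 0 and [- 1]. *)
Lemma log_r_bdd : exists C : R, forall c q, N f t1 t2 x0 c q ->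
  tnorm (gRef c) (grad_vec m log_r c) q <= C.
Proof.
apply: grad_bdd => A.
apply: (adm_ext oU (F := fun c q => match A with inl _ => 0 | inr j => - (0 == j)%:R end)); last exact: adm_cst.
move=> c q hq; have x_gt0 : 0 < xq q by case/andP: (Ux hq).
have dx : differentiable (@xq R 1) q by exact: differentiable_coord.
have dl : is_derive (xq q) 1 (@ln R) (xq q)^-1 by exact: is_derive1_ln.
rewrite (@fd_ext _ _ _ _ img efN oU A log_r (fun _ q => - ln (xq q)) _ c q hq); last first.
  by move=> c' q' hq'; rewrite /log_r xcoE lnV // posrE; case/andP: (Ux hq').
have e i : pd i (fun q => - ln (xq q)) q = - (xq q)^-1 * pd i (@xq R 1) q.
  have dll : derivable (@ln R) (xq q) 1 by exact: ex_derive.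
  have dlq : differentiable (fun q : 'rV[R]_(2 + 2) => ln (xq q)) q.
    by move/derivable1_diffP: dll => dll; exact: (differentiable_comp dx dll).
  by rewrite pdN // pd_comp1 // derive1E derive_val mulNr.
transitivity (- (xq q)^-1 * fd A (fun _ => @xq R 1) c q).
  rewrite (@fd_xq R 1 bool (fun c => c)); case: A => [a|j]; first by rewrite mulr0.
  by rewrite mulrA mulNr mulVf ?(gt_eqF x_gt0) // mulN1r.
by rewrite /frame_diff mulr_sumr; apply: eq_bigr => i _; rewrite e; ring.
Qed.

End TimeFunctionGeometry.

(** * Geometry of the level sets *)

Section LevelSets.
Context {R : realType} (m : R) (f : 'rV[R]_(2 + 1) -> R) (sf : smooth_on_sphere f).
Variables (x0 t1 t2 eps : R).
Hypothesis t1_gt0 : 0 < t1.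
Hypothesis t12 : t1 < t2.
Hypothesis hL : forall c q, 0 < xq q < x0 -> 2^-1 <= Lf f c q.
Hypothesis eps_gt0 : 0 < eps.
Hypothesis hw : forall c q, img f x0 t1 t2 c q -> eps <= time_norm m f c q.
Implicit Types (c : bool) (q : 'rV[R]_(2 + 2)) (w z : 'rV[R]_(2 + 1)).
Implicit Types (i : 'I_(2 + 1)) (j : 'I_(2 + 2)).
Local Notation fam := (bool -> 'rV[R]_(2 + 2) -> R).
Local Notation img := (img f x0 t1 t2).
Local Notation efN := (prod_frame (fun c : bool => c)).
Local Notation thN := (prod_coframe (fun c : bool => c)).
Local Notation chL := (fun l : bool * R => l.1).
Local Notation efL := (prod_frame chL).
Local Notation thL := (prod_coframe chL).
Local Notation fdN := (frame_diff efN).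
Local Notation fdL := (frame_diff efL).
Local Notation admN := (admissible img efN).
Local Notation S := (Sf f).
Local Notation sA := (time_diff f).
Local Notation wS := (time_norm m f).
Local Notation gSch := (gSch m).
Local Notation gInv := (gInv m).
Local Notation level := (Defs.level f).
Local Notation Tvec := (Tvec m f t1 t2 x0).
Local Notation omega := (omega m f t1 t2 x0).
Local Notation dS := (dS f).
Implicit Types (A : ('I_(2 + 1) + 'I_1)%type) (l : bool * R).

Definition domL l : set 'rV[R]_(2 + 1) := [set w | t1 < l.2 < t2 /\ 0 < xq w < x0].
Local Notation admL := (admissible domL efL).

Let oN : forall c, open (img c) := open_img sf hL.
Let Nx : forall c q, img c q -> 0 < xq q < x0 := @img_x R f x0 t1 t2.

Lemma open_domL l : open (domL l).
Proof.
have cx : continuous (@xq R 0) by move=> q; apply: differentiable_continuous; exact: differentiable_coord.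
have [h|h] := boolP (t1 < l.2 < t2); last first.
  by rewrite (_ : domL l = set0); [exact: open0|apply/seteqP; split => // w [h' _]; rewrite h' in h].
rewrite (_ : domL l = [set q | 0 < xq q] `&` [set q | xq q < x0]); last first.
  by apply/seteqP; split => [w [_ /andP[]]|w [/= h1 h2]] //; split => //; apply/andP.
apply: openI.
  by apply: (@open_comp _ _ (@xq R 0) [set r | 0 < r]); [move=> q _; exact: cx|exact: open_gt].
by apply: (@open_comp _ _ (@xq R 0) [set r | r < x0]); [move=> q _; exact: cx|exact: open_lt].
Qed.

Let oL := open_domL.
Let Lx l w : domL l w -> 0 < xq w < x0. Proof. by case. Qed.

(** The coordinates of a level set are the first three of the spacetime: the
    level sets are graphs over them. *)
Definition level_coord (i : 'I_(2 + 1)) : 'I_(2 + 2) :=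
  match fintype.split i with inl k => lshift 2 k | inr _ => rshift 2 0 end.

Definition lasti : 'I_(2 + 2) := rshift 2 1.

Lemma level_coord_l (k : 'I_2) : level_coord (lshift 1 k) = lshift 2 k.
Proof. by rewrite /level_coord (unsplitK (inl k)). Qed.

Lemma level_coord_r (k : 'I_1) : level_coord (rshift 2 k) = rshift 2 0.
Proof. by rewrite /level_coord (unsplitK (inr k)). Qed.

Lemma sum_level_coord (V : nmodType) (F : 'I_(2 + 2) -> V) :
  \sum_j F j = \sum_i F (level_coord i) + F lasti.
Proof.
rewrite !big_split_ord /= big_ord1 level_coord_r -addrA; congr (_ + _).
  by apply: eq_bigr => k _; rewrite level_coord_l.
by rewrite !big_ord_recl big_ord0 addr0; congr (F _ + F _); apply: val_inj.
Qed.

Lemma level_coord_ind (P : 'I_(2 + 2) -> Prop) : (forall i, P (level_coord i)) -> P lasti -> forall j, P j.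
Proof.
move=> he hl j; rewrite -(splitK j); case: (fintype.split j) => k /=.
  by rewrite -level_coord_l; exact: he.
by have [->|->] := ord2P k; [rewrite -(level_coord_r 0); exact: he|].
Qed.

Lemma level_coord_eq i i' : (level_coord i == level_coord i') = (i == i').
Proof.
apply/eqP/eqP => [|-> //]; rewrite -(splitK i) -(splitK i').
case: (fintype.split i) => k; case: (fintype.split i') => k' /=; rewrite ?level_coord_l ?level_coord_r.
- by move/lshift_inj ->.
- by move/eqP; rewrite eq_lrshift.
- by move/eqP; rewrite eq_rlshift.
- by rewrite !ord1.
Qed.

Lemma level_coord_neq_last i : (level_coord i == lasti) = false.
Proof.
rewrite -(splitK i); case: (fintype.split i) => k /=; rewrite ?level_coord_l ?level_coord_r /lasti.
- by rewrite eq_lrshift.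
- by rewrite eq_rshift.
Qed.

Definition level_index A : ('I_(2 + 1) + 'I_2)%type :=
  match A with inl a => inl a | inr _ => inr 0 end.

Lemma lxcoE w : lxco w = xq w.
Proof. by rewrite /lxco mxE. Qed.

Lemma level_emi c t w i : level c t w 0 (level_coord i) = w 0 i.
Proof.
rewrite /Defs.level /Defs.Phi -(splitK i); case: (fintype.split i) => k /=.
  by rewrite level_coord_l pt_l /ang ang_pt /lang mxE.
by rewrite level_coord_r pt_r0 xcoE xq_pt lxcoE /xq (ord1 k).
Qed.

Lemma level_last c t w : level c t w 0 lasti = - Defs.Pfun f c (lsubmx w) (xq w) t.
Proof.
by rewrite /Defs.level /Defs.Phi /lasti pt_r1 /ang ang_pt xcoE xq_pt last_coE vq_pt lxcoE.
Qed.

Lemma ang_level c t w : lsubmx (level c t w) = lsubmx w.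
Proof. by apply/rowP => k; rewrite mxE -level_coord_l level_emi mxE. Qed.

Lemma xq_level c t w : xq (level c t w) = xq w.
Proof. by rewrite /xq -(level_coord_r 0) level_emi. Qed.

Lemma differentiable_level c t w : differentiable (level c t) w.
Proof.
apply: differentiable_rV; elim/level_coord_ind => [i|].
  by under eq_fun do rewrite level_emi; exact: differentiable_coord.
have -> : (fun z => level c t z 0 lasti) = (fun z => - Defs.Pfun f c (lsubmx z) (xq z) t).
  by apply/funext => z; rewrite level_last.
under eq_fun do rewrite (PfunE sf).
have d1 := differentiable_sphf (fun c : bool => c) c w (smooth_f sf).
have d2 := differentiable_sphf (fun c : bool => c) c w (smooth_gradsq sf).
have d3 := differentiable_sphf (fun c : bool => c) c w (smooth_lap sf).
have d4 := differentiable_sphf (fun c : bool => c) c w (smooth_hess_grad sf).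
have dx : differentiable (@xq R 0) w by exact: differentiable_coord.
rewrite /sphf in d1 d2 d3 d4; under eq_fun do rewrite (expr2 (xq _)).
by diffs.
Qed.

Lemma level_img l w : domL l w -> img l.1 (level l.1 l.2 w).
Proof.
case: l => c t [ht hx]; rewrite -(N_img sf t1_gt0 t12 hL).
exists (pt (lang w) (lxco w) t) => //.
by split; rewrite ?xcoE ?last_coE ?xq_pt ?vq_pt ?lxcoE.
Qed.

Lemma Sf_level c t w : 0 < xq w < x0 -> S c (level c t w) = 2^-1 * t ^+ 2.
Proof.
by move=> hx; rewrite /Defs.level (Sf_Phi sf hL) ?vq_pt // /small_x /= xq_pt lxcoE.
Qed.

Local Notation J l w := ('J (level l.1 l.2) w).

Lemma J_emi l w i i' : J l w i (level_coord i') = (i == i')%:R.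
Proof.
rewrite jacobianE; last exact: differentiable_level.
by under eq_fun do rewrite level_emi; rewrite pd_coord eq_sym.
Qed.

Lemma pd_level (F : 'rV[R]_(2 + 2) -> R) l w i : differentiable F (level l.1 l.2 w) ->
  pd i (fun z => F (level l.1 l.2 z)) w = \sum_j J l w i j * pd j F (level l.1 l.2 w).
Proof.
move=> dF; rewrite pd_comp //; last exact: differentiable_level.
by apply: eq_bigr => j _; rewrite jacobianE //; exact: differentiable_level.
Qed.

(** [S] is constant on the level set. *)
Lemma J_dS l w : domL l w -> J l w *m (dS l.1 (level l.1 l.2 w))^T = 0.
Proof.
move=> hl; have hq := level_img hl; apply/matrixP => i k; rewrite [RHS]mxE mxE.
transitivity (pd i (fun z => S l.1 (level l.1 l.2 z)) w).
  rewrite pd_level; last exact: (S_diff sf hL _ (img_small_x hq)).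
  by apply: eq_bigr => j _; rewrite (ord1 k) !mxE.
rewrite (eq_open_pd i (@oL l) (G := fun _ => 2^-1 * l.2 ^+ 2)) ?pd_cst //.
by move=> z hz; rewrite Sf_level //; exact: Lx hz.
Qed.

Lemma dS_last c q : img c q -> dS c q 0 lasti = (xq q * Lf f c q)^-1.
Proof.
move=> hq; have x_neq0 : xq q != 0 by exact: (xq_neq0 Nx hq).
have := dS_rr sf hL 1 hq; rewrite /time_diff /num_diff /den_diff /= mul0r mulr0 subr0 mul1r => h.
by apply: (mulfI x_neq0); rewrite h invfM mulrA mulfV // mul1r.
Qed.

Lemma J_last l w i : domL l w ->
  J l w i lasti = - (dS l.1 (level l.1 l.2 w) 0 (level_coord i) * (xq w * Lf f l.1 (level l.1 l.2 w))).
Proof.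
move=> hl; have hq := level_img hl; have hn := Lf_neq0 hL l.1 (img_small_x hq).
have x_neq0 : xq w != 0 by rewrite -(xq_level l.1 l.2); exact: (xq_neq0 Nx hq).
have : \sum_j J l w i j * dS l.1 (level l.1 l.2 w) 0 j = 0.
  have /matrixP/(_ i 0) := J_dS hl; rewrite [RHS]mxE [LHS]mxE => h.
  by apply: etrans h; apply: eq_bigr => j _; rewrite [(dS _ _)^T _ _]mxE.
rewrite sum_level_coord; under eq_bigr do rewrite J_emi.
rewrite (bigD1 i) //= [X in _ + X + _]big1 ?addr0 => [|i' i'i]; last by rewrite eq_sym (negbTE i'i) mul0r.
rewrite eqxx mul1r dS_last // xq_level => /eqP; rewrite addrC addr_eq0 => /eqP h.
have X : xq w * Lf f l.1 (level l.1 l.2 w) != 0 by rewrite mulf_neq0.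
by apply: (mulIf (invr_neq0 X)); rewrite h mulNr mulfK.
Qed.

Lemma ef_emi l A w i q : lsubmx q = lsubmx w -> xq q = xq w ->
  efN l.1 (level_index A) q 0 (level_coord i) = efL l A w 0 i.
Proof.
move=> ha hx; rewrite -(splitK i); case: (fintype.split i) => k /=; rewrite ?level_coord_l ?level_coord_r.
  by case: A => [a|s] /=; rewrite !frE // ha hx.
by case: A => [a|s] /=; rewrite !frE // hx (ord1 k) (ord1 s).
Qed.

Lemma ef_last c A q : efN c (level_index A) q 0 lasti = 0.
Proof. by case: A => [a|s] /=; rewrite frE //= mulr0. Qed.

Lemma ef_v c q i : efN c (inr 1) q 0 (level_coord i) = 0.
Proof.
rewrite -(splitK i); case: (fintype.split i) => k /=; rewrite ?level_coord_l ?level_coord_r frE //.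
by rewrite mulr0.
Qed.

Lemma ef_v_last c q : efN c (inr 1) q 0 lasti = xq q.
Proof. by rewrite frE eqxx mulr1. Qed.

Lemma th_emi l A w i q : lsubmx q = lsubmx w -> xq q = xq w ->
  thN l.1 (level_index A) q 0 (level_coord i) = thL l A w 0 i.
Proof.
move=> ha hx; rewrite -(splitK i); case: (fintype.split i) => k /=; rewrite ?level_coord_l ?level_coord_r.
  by case: A => [a|s] /=; rewrite !frE // ha hx.
by case: A => [a|s] /=; rewrite !frE // hx (ord1 k) (ord1 s).
Qed.

Lemma th_last c A q : thN c (level_index A) q 0 lasti = 0.
Proof. by case: A => [a|s] /=; rewrite frE //= mulr0. Qed.

(** The component along [e_v] that makes [e_A] tangential to the level set. *)
Definition transversal A : fam := fun c q => sA (level_index A) c q * Lf f c q.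

(** The first three coordinates are unchanged, and the last one is determined by
    tangency. *)
Lemma push_frame l w A j : domL l w ->
  \sum_i efL l A w 0 i * J l w i j =
  efN l.1 (level_index A) (level l.1 l.2 w) 0 j
  - transversal A l.1 (level l.1 l.2 w) * efN l.1 (inr 1) (level l.1 l.2 w) 0 j.
Proof.
move=> hl; have hq := level_img hl; have ha := ang_level l.1 l.2 w; have hx := xq_level l.1 l.2 w.
elim/level_coord_ind: j => [i'|].
  rewrite (ef_emi l A i' ha hx) ef_v mulr0 subr0.
  under eq_bigr do rewrite J_emi.
  rewrite (bigD1 i') //= big1 ?addr0 => [|i ii]; last by rewrite (negbTE ii) mulr0.
  by rewrite eqxx mulr1.
rewrite ef_last ef_v_last sub0r hx /transversal -(dS_frame sf hL (level_index A) hq) sum_level_coord ef_last mul0r addr0.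
under eq_bigr do rewrite (J_last _ hl) -(ef_emi l _ _ ha hx).
rewrite !mulr_suml -sumrN; apply: eq_bigr => i _; ring.
Qed.

(** The chain rule, for the tangential frame. *)
Lemma fd_level A (F : fam) l w : domL l w -> differentiable (F l.1) (level l.1 l.2 w) ->
  fdL A (fun l w => F l.1 (level l.1 l.2 w)) l w =
  fdN (level_index A) F l.1 (level l.1 l.2 w)
  - transversal A l.1 (level l.1 l.2 w) * fdN (inr 1) F l.1 (level l.1 l.2 w).
Proof.
move=> hl dF; rewrite /frame_diff; under [LHS]eq_bigr do rewrite pd_level // mulr_sumr.
rewrite exchange_big /= mulr_sumr -sumrB; apply: eq_bigr => j _.
under eq_bigr do rewrite mulrA.
by rewrite -mulr_suml push_frame //; ring.
Qed.

Lemma adm_transversal A : admN (transversal A).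
Proof. by apply: (adm_mul oN); [exact: (adm_time_diff sf t2 t1_gt0 hL)|exact: (adm_Lf sf t1 t2 hL)]. Qed.

(** The restrictions of admissible functions form a class that is stable under
    the frame of the level set. *)
Lemma adm_level (F : fam) : admN F -> admL (fun l w => F l.1 (level l.1 l.2 w)).
Proof.
move=> aF; apply: (@adm_class _ _ _ _ domL efL oL (fun G => exists2 F : fam, admN F &
  G = (fun l w => F l.1 (level l.1 l.2 w)))); last by exists F.
- move=> _ [{aF}F aF ->] l w hl.
  by apply: (differentiable_comp (differentiable_level _ _ _)); exact: (adm_diff aF (level_img hl)).
- by move=> _ [{aF}F aF ->]; have [C hC] := adm_bdd aF; exists C => l w /level_img /hC.
- move=> _ A [{aF}F aF ->].
  exists (fun l w => (fun c q => fdN (level_index A) F c q - transversal A c q * fdN (inr 1) F c q) l.1 (level l.1 l.2 w)).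
    exists (fun c q => fdN (level_index A) F c q - transversal A c q * fdN (inr 1) F c q) => //.
    apply: (adm_sub oN); first exact: adm_fd.
    by apply: (adm_mul oN); [exact: adm_transversal|exact: adm_fd].
  by move=> l w hl; rewrite fd_level //; exact: (adm_diff aF (level_img hl)).
Qed.

Lemma gramE n (T : finType) (L : Type) (e : L -> T -> 'rV[R]_n -> 'rV[R]_n)
    (G : L -> 'rV[R]_n -> 'M[R]_n) (X Y : T) (l : L) x :
  gram e G X Y l x = (e l X x *m G l x *m (e l Y x)^T) 0 0.
Proof.
rewrite /gram mxE exchange_big; apply: eq_bigr => j _ /=.
by rewrite mxE [(_^T) _ _]mxE mulr_suml.
Qed.

Lemma cogramE n (T : finType) (L : Type) (e : L -> T -> 'rV[R]_n -> 'rV[R]_n)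
    (G : L -> 'rV[R]_n -> 'M[R]_n) (X Y : T) (l : L) x :
  cogram e G X Y l x = (e l X x *m invmx (G l x) *m (e l Y x)^T) 0 0.
Proof.
rewrite /cogram mxE exchange_big; apply: eq_bigr => j _ /=.
by rewrite mxE [(_^T) _ _]mxE mulr_suml.
Qed.

Lemma bilinear_sub (e1 e2 e3 : 'rV[R]_(2 + 2)) (b : 'M[R]_(2 + 2)) (k k' : R) :
  ((e1 - k *: e3) *m b *m (e2 - k' *: e3)^T) 0 0 =
  (e1 *m b *m e2^T) 0 0 - k' * (e1 *m b *m e3^T) 0 0
  - k * ((e3 *m b *m e2^T) 0 0 - k' * (e3 *m b *m e3^T) 0 0).
Proof.
have -> : (e2 - k' *: e3)^T = e2^T - k' *: e3^T by apply/matrixP => i j; rewrite !mxE.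
rewrite !mulmxBl !mulmxBr -!scalemxAl -!scalemxAr.
by rewrite !mxE; ring.
Qed.

Lemma push_row l w A : domL l w ->
  efL l A w *m J l w = efN l.1 (level_index A) (level l.1 l.2 w)
     - transversal A l.1 (level l.1 l.2 w) *: efN l.1 (inr 1) (level l.1 l.2 w).
Proof.
move=> hl; apply/rowP => j; rewrite [LHS]mxE push_frame // [RHS]mxE.
by congr (_ + _); rewrite [RHS]mxE; congr (- _); rewrite [RHS]mxE.
Qed.

Section Pullback.
Variable B : bool -> 'rV[R]_(2 + 2) -> 'M[R]_(2 + 2).
Local Notation pb := (fun l w => pullback (level l.1 l.2) (B l.1) w).

(** A pulled back bilinear form, evaluated on the tangential frame. *)
Lemma gram_pullback A A' l w : domL l w -> gram efL pb A A' l w =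
  gram efN B (level_index A) (level_index A') l.1 (level l.1 l.2 w)
  - transversal A' l.1 (level l.1 l.2 w) * gram efN B (level_index A) (inr 1) l.1 (level l.1 l.2 w)
  - transversal A l.1 (level l.1 l.2 w) * (gram efN B (inr 1) (level_index A') l.1 (level l.1 l.2 w)
     - transversal A' l.1 (level l.1 l.2 w) * gram efN B (inr 1) (inr 1) l.1 (level l.1 l.2 w)).
Proof.
move=> hl; rewrite !gramE /pullback.
have -> : efL l A w *m (J l w *m B l.1 (level l.1 l.2 w) *m (J l w)^T) *m (efL l A' w)^T =
    (efL l A w *m J l w) *m B l.1 (level l.1 l.2 w) *m (efL l A' w *m J l w)^T.
  by rewrite trmx_mul !mulmxA.
rewrite !push_row //; exact: bilinear_sub.
Qed.

Lemma adm_gram_pullback A A' : (forall X Y, admN (gram efN B X Y)) -> admL (gram efL pb A A').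
Proof.
move=> aB; apply: (adm_ext oL) (fun l w hl => esym (gram_pullback A A' hl)) _.
apply: (adm_level (F := fun c q => gram efN B (level_index A) (level_index A') c q
  - transversal A' c q * gram efN B (level_index A) (inr 1) c q
  - transversal A c q * (gram efN B (inr 1) (level_index A') c q - transversal A' c q * gram efN B (inr 1) (inr 1) c q))).
have ak := adm_transversal.
by do !first [exact: aB | exact: ak | apply: (adm_sub oN) | apply: (adm_mul oN)].
Qed.

End Pullback.

Lemma nablaT_form_gram X Y c q : img c q ->
  gram efN (nablaT_form m f t1 t2 x0) X Y c q =
  \sum_Z frame_comp efN thN (nablaT m f t1 t2 x0) [ffun=> Z] [ffun=> X] c q * gram efN gSch Z Y c q.
Proof.
move=> hq; rewrite /gram.
transitivity (\sum_(i < 2 + 2) \sum_j \sum_k efN c X q 0 i *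
   nablaT m f t1 t2 x0 c q [ffun=> k] [ffun=> i] * gSch c q k j * efN c Y q 0 j).
  apply: eq_bigr => i _; apply: eq_bigr => j _; rewrite mxE mulr_sumr mulr_suml.
  by apply: eq_bigr => k _; ring.
pose nT (k i : 'I_(2 + 2)) := nablaT m f t1 t2 x0 c q [ffun=> k] [ffun=> i].
have fE Z : frame_comp efN thN (nablaT m f t1 t2 x0) [ffun=> Z] [ffun=> X] c q =
    \sum_k \sum_(i < 2 + 2) thN c Z q 0 k * efN c X q 0 i * nT k i.
  rewrite /frame_comp sum_ffun1; apply: eq_bigr => k _; rewrite sum_ffun1; apply: eq_bigr => i _.
  by rewrite !big_ord1 !ffunE.
under [RHS]eq_bigr do rewrite fE.
transitivity (\sum_Z \sum_k \sum_(i < 2 + 2) \sum_k' \sum_j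
    (thN c Z q 0 k * efN c X q 0 i * nT k i) * (efN c Z q 0 k' * gSch c q k' j * efN c Y q 0 j)).
  transitivity (\sum_k \sum_(i < 2 + 2) \sum_k' \sum_j (k' == k)%:R *
      (efN c X q 0 i * nT k i * (gSch c q k' j * efN c Y q 0 j))).
    under [LHS]eq_bigr do rewrite exchange_big /=.
    rewrite [LHS]exchange_big /=; apply: eq_bigr => k _; apply: eq_bigr => i _.
    rewrite [RHS](bigD1 k) //= [X in _ = _ + X]big1 ?addr0 => [|k' k'k]; last first.
      by rewrite big1 // => j _; rewrite (negbTE k'k) mul0r.
    by apply: eq_bigr => j _; rewrite eqxx mul1r /nT; ring.
  rewrite [RHS]exchange_big; apply: eq_bigr => k _ /=.
  rewrite [RHS]exchange_big; apply: eq_bigr => i _ /=.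
  rewrite [RHS]exchange_big; apply: eq_bigr => k' _ /=.
  rewrite [RHS]exchange_big; apply: eq_bigr => j _ /=.
  rewrite -(complete_ef (fun c : bool => c) Nx hq k' k) mulr_suml; apply: eq_bigr => Z _.
  by ring.
apply: eq_bigr => Z _; rewrite mulr_suml; apply: eq_bigr => k _.
rewrite mulr_suml; apply: eq_bigr => i _; rewrite mulr_sumr; apply: eq_bigr => k' _.
by rewrite mulr_sumr.
Qed.

Lemma adm_nablaT_form X Y : admN (gram efN (nablaT_form m f t1 t2 x0) X Y).
Proof.
apply: (adm_ext oN) (fun c q hq => esym (nablaT_form_gram X Y hq)) _.
apply: (adm_sum oN) => Z; apply: (adm_mul oN); last exact: (adm_gram_gSch _ oN Nx).
exact: (adm_icov_gSch m oN Nx (k := 1) (adm_Tvec sf t1_gt0 t12 hL eps_gt0 hw)).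
Qed.

Local Notation h l := (hmet m f l.1 l.2).

Lemma adm_gram_h A A' : admL (gram efL (fun l => h l) A A').
Proof. by apply: (adm_gram_pullback (B := gSch)) => X Y; exact: (adm_gram_gSch _ oN Nx). Qed.

Lemma adm_sff : adm_tensor domL efL thL (fun l => sff m f t1 t2 x0 l.1 l.2).
Proof.
move=> I K; apply: (adm_ext oL (F := gram efL (fun l => Amat m f t1 t2 x0 l.1 l.2) (K 0) (K 1))).
  by move=> l w _; rewrite fcomp_bilinear.
by apply: adm_gram_pullback => X Y; exact: adm_nablaT_form.
Qed.

Definition Pi : 'M[R]_(2 + 1, 2 + 2) := \matrix_(i, j) (level_coord i == j)%:R.

(** The inverse metric of the orthogonal complement of [T]. *)
Definition Minv c q := gInv q + (Tvec c q)^T *m Tvec c q.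

(** [dS] is a multiple of the covector dual to [T], which has length [- 1]. *)
Lemma Minv_dS c q : img c q -> dS c q *m Minv c q = 0.
Proof.
move=> hq; rewrite /Minv mulmxDr mulmxA.
have e1 : dS c q *m gInv q = (- inv_time_norm m f c q)^-1 *: Tvec c q.
  rewrite (TvecE sf t1_gt0 t12 hL eps_gt0 hw) // scalerA mulVf ?scale1r //.
  rewrite oppr_eq0 invr_eq0 gt_eqF // sqrtr_gt0.
  exact: lt_le_trans (hw hq).
have e2 : dS c q *m (Tvec c q)^T = (- inv_time_norm m f c q)^-1 *: (omega c q *m (Tvec c q)^T).
  rewrite (omegaE sf t1_gt0 t12 hL eps_gt0 hw hq) -scalemxAl scalerA mulVf ?scale1r //.
  rewrite oppr_eq0 invr_eq0 gt_eqF // sqrtr_gt0.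
  exact: lt_le_trans (hw hq).
rewrite e2 (norm_omega sf t1_gt0 t12 hL eps_gt0 hw) // e1 -scalemxAl mul_scalar_mx scaleN1r.
by rewrite scalerN subrr.
Qed.

Lemma Minv_sym c q : (Minv c q)^T = Minv c q.
Proof. by rewrite /Minv [LHS]linearD /= gInv_sym trmx_mul trmxK. Qed.

(** The composite of the projection along [d/dv] with the differential of
    [level] is the projection to the tangent space of the level set along [d/dv];
    the factor [x L] is [1 / d_v S]. *)
Lemma Pi_J l w : domL l w -> Pi^T *m J l w =
  1%:M - (xq w * Lf f l.1 (level l.1 l.2 w)) *:
     ((dS l.1 (level l.1 l.2 w))^T *m (delta_mx 0 lasti : 'rV_(2 + 2))).
Proof.
move=> hl; have hq := level_img hl; have hn := Lf_neq0 hL l.1 (img_small_x hq).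
have x_neq0 : xq w != 0 by rewrite -(xq_level l.1 l.2); exact: (xq_neq0 Nx hq).
apply/matrixP => j j'; rewrite [LHS]mxE.
have -> : (1%:M - (xq w * Lf f l.1 (level l.1 l.2 w)) *:
     ((dS l.1 (level l.1 l.2 w))^T *m (delta_mx 0 lasti : 'rV_(2 + 2)))) j j' =
   (j == j')%:R - (xq w * Lf f l.1 (level l.1 l.2 w)) * (dS l.1 (level l.1 l.2 w) 0 j * (j' == lasti)%:R).
  by rewrite mxE mxE [X in _ + X]mxE [X in _ - X]mxE [X in _ - _ * X]mxE big_ord1 [in LHS]mxE [X in _ - _ * (_ * X)]mxE eqxx.
under eq_bigr do rewrite [Pi^T _ _]mxE [Pi _ _]mxE.
elim/level_coord_ind: j => [i|].
  rewrite (bigD1 i) //= [X in _ + X]big1 ?addr0 => [|i' i'i]; last by rewrite level_coord_eq (negbTE i'i) mul0r.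
  rewrite eqxx mul1r; elim/level_coord_ind: j' => [i'|].
    by rewrite J_emi level_coord_eq level_coord_neq_last !mulr0 subr0.
  by rewrite J_last // level_coord_neq_last eqxx mulr1 sub0r mulrC.
rewrite big1 => [|i _]; last by rewrite level_coord_neq_last mul0r.
rewrite dS_last // xq_level eq_sym mulrA mulfV ?mulf_neq0 // mul1r.
by rewrite subrr.
Qed.

Lemma J_Pi l w : J l w *m Pi^T = 1%:M.
Proof.
apply/matrixP => i i'; rewrite mxE; under eq_bigr do rewrite [Pi^T _ _]mxE [Pi _ _]mxE.
rewrite (bigD1 (level_coord i')) //= big1 ?addr0 => [|j jn]; last by rewrite eq_sym (negbTE jn) mulr0.
by rewrite eqxx mulr1 J_emi [RHS]mxE.
Qed.

Lemma Minv_Pi_J l w : domL l w ->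
  Minv l.1 (level l.1 l.2 w) *m Pi^T *m J l w = Minv l.1 (level l.1 l.2 w).
Proof.
move=> hl; rewrite -mulmxA Pi_J // mulmxBr mulmx1 -scalemxAr mulmxA.
have -> : Minv l.1 (level l.1 l.2 w) *m (dS l.1 (level l.1 l.2 w))^T = 0.
  by rewrite -[LHS]trmxK trmx_mul trmxK Minv_sym Minv_dS ?trmx0 //; exact: level_img.
by rewrite mul0mx scaler0 subr0.
Qed.

(** The inverse of the induced metric is the inverse metric of the complement of
    [T], restricted to the covectors of the first three coordinates. *)
Lemma h_inverse l w : domL l w ->
  h l w *m (Pi *m Minv l.1 (level l.1 l.2 w) *m Pi^T) = 1%:M.
Proof.
move=> hl; have hq := level_img hl; have x_neq0 := xq_neq0 Nx hq.
have e1 : (J l w)^T *m Pi *m Minv l.1 (level l.1 l.2 w) = Minv l.1 (level l.1 l.2 w).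
  by have /(congr1 trmx) := Minv_Pi_J hl; rewrite !trmx_mul trmxK Minv_sym mulmxA.
have e2 : J l w *m gSch l.1 (level l.1 l.2 w) *m Minv l.1 (level l.1 l.2 w) = J l w.
  rewrite -mulmxA /Minv mulmxDr gSch_inverse // mulmxDr mulmx1 !mulmxA.
  have -> : J l w *m gSch l.1 (level l.1 l.2 w) *m (Tvec l.1 (level l.1 l.2 w))^T = 0.
    have -> : J l w *m gSch l.1 (level l.1 l.2 w) *m (Tvec l.1 (level l.1 l.2 w))^T =
        J l w *m (omega l.1 (level l.1 l.2 w))^T.
      by rewrite /Defs.omega trmx_mul gSch_tr mulmxA.
    rewrite (omegaE sf t1_gt0 t12 hL eps_gt0 hw) // [X in _ *m X]linearZ /= -scalemxAr.
    by rewrite J_dS // scaler0.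
  by rewrite mul0mx addr0.
rewrite /hmet /pullback.
rewrite -!mulmxA (mulmxA (J l w)^T) (mulmxA ((J l w)^T *m Pi)) e1 !mulmxA e2.
exact: J_Pi.
Qed.

Lemma invmx_h l w : domL l w ->
  invmx (h l w) = Pi *m Minv l.1 (level l.1 l.2 w) *m Pi^T.
Proof. by move=> hl; exact: (invmx_eq (h_inverse hl)).2. Qed.

Lemma th_Pi l w A : thL l A w *m Pi = thN l.1 (level_index A) (level l.1 l.2 w).
Proof.
apply/rowP => j; rewrite mxE; under eq_bigr do rewrite [Pi _ _]mxE.
elim/level_coord_ind: j => [i|].
  rewrite (th_emi l A i (ang_level l.1 l.2 w) (xq_level l.1 l.2 w)).
  rewrite (bigD1 i) //= big1 ?addr0 => [|i' i'i]; last by rewrite level_coord_eq (negbTE i'i) mulr0.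
  by rewrite eqxx mulr1.
by rewrite th_last big1 // => i _; rewrite level_coord_neq_last mulr0.
Qed.

Lemma cogram_h A A' l w : domL l w -> cogram thL (fun l => h l) A A' l w =
  cogram thN gSch (level_index A) (level_index A') l.1 (level l.1 l.2 w) +
  T_coframe m f x0 t1 t2 (level_index A) l.1 (level l.1 l.2 w) * T_coframe m f x0 t1 t2 (level_index A') l.1 (level l.1 l.2 w).
Proof.
move=> hl; have hq := level_img hl; have x_neq0 := xq_neq0 Nx hq.
rewrite !cogramE invmx_h // invmx_gSch //.
have -> : thL l A w *m (Pi *m Minv l.1 (level l.1 l.2 w) *m Pi^T) *m (thL l A' w)^T =
   (thL l A w *m Pi) *m Minv l.1 (level l.1 l.2 w) *m (thL l A' w *m Pi)^T.
  by rewrite trmx_mul !mulmxA.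
rewrite !th_Pi /Minv mulmxDr mulmxDl [LHS]mxE; congr (_ + _).
rewrite -!mulmxA mulmxA mxE big_ord1 /T_coframe; congr (_ * _); rewrite mxE; apply: eq_bigr => j _.
  by rewrite [(_^T) _ _]mxE.
by rewrite [(_^T) _ _]mxE mulrC.
Qed.

Lemma adm_cogram_h A A' : admL (cogram thL (fun l => h l) A A').
Proof.
apply: (adm_ext oL) (fun l w hl => esym (cogram_h A A' hl)) _.
apply: (adm_level (F := fun c q => cogram thN gSch (level_index A) (level_index A') c q +
  T_coframe m f x0 t1 t2 (level_index A) c q * T_coframe m f x0 t1 t2 (level_index A') c q)).
have aT := adm_T_coframe sf t1_gt0 t12 hL eps_gt0 hw.
apply: (adm_add oN); first exact: (adm_cogram_gSch _ oN Nx).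
by apply: (adm_mul oN); exact: aT.
Qed.

Lemma h_sym l w : domL l w -> forall i i', h l w i i' = h l w i' i.
Proof.
move=> _ i i'; rewrite -[in LHS](trmxK (h l w)) mxE; congr (fun_of_matrix _ _ _).
by rewrite /hmet /pullback !trmx_mul trmxK gSch_tr mulmxA.
Qed.

Lemma differentiable_h i i' : diffU domL (fun l w => h l w i i').
Proof.
have at_ : adm_tensor domL efL thL (fun l => of_bilinear (h l)).
  move=> I K; apply: (adm_ext oL (F := gram efL (fun l => h l) (K 0) (K 1))).
    by move=> l w _; rewrite fcomp_bilinear.
  exact: adm_gram_h.
have := adm_tensor_diff oL (de_ef chL (U := domL)) (dth_thf chL Lx) (complete_ef chL Lx)
  no_index
  [ffun b : 'I_2 => if b == 0 then i else i'] at_.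
by move=> hd l w hl; have := hd l w hl; rewrite /of_bilinear !ffunE.
Qed.

Lemma adm_icov_sff k : adm_tensor domL efL thL (fun l => icov (h l) (sff m f t1 t2 x0 l.1 l.2) k).
Proof.
apply: (adm_icovE oL (de_ef chL (U := domL)) (dth_thf chL Lx) (complete_ef chL Lx) h_sym
  (fun l w hl => (invmx_eq (h_inverse hl)).1) differentiable_h (bracket_frame chL (U := domL))
  (adm_bracket_coeff chL oL Lx) adm_gram_h adm_cogram_h).
exact: adm_sff.
Qed.

Lemma sff_bdd k : exists C : R, forall c (t : R) w, t1 < t < t2 -> on_level x0 w ->
  tnorm (hmet m f c t) (icov (hmet m f c t) (sff m f t1 t2 x0 c t) k) w <= C.
Proof.
have [|||C hC] := @tnorm_bdd _ _ _ _ domL efL thL (complete_ef chL Lx) (fun l => h l) _ _ _ _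
  (fun l => icov (h l) (sff m f t1 t2 x0 l.1 l.2) k).
- by move=> A A'; apply: (@adm_bdd _ _ _ _ domL efL); exact: adm_gram_h.
- by move=> A A'; apply: (@adm_bdd _ _ _ _ domL efL); exact: adm_cogram_h.
- by move=> I K; apply: (@adm_bdd _ _ _ _ domL efL); exact: adm_icov_sff.
exists C => c t w ht hx; rewrite (le_trans (ler_norm _)) // (hC (c, t)) //.
by split => //=; rewrite -lxcoE.
Qed.

(** The trace over the level set is the trace over the spacetime against [Minv]. *)
Lemma HmeanE l w : domL l w -> Hmean m f t1 t2 x0 l.1 l.2 w =
  3^-1 * \tr (Minv l.1 (level l.1 l.2 w) *m nablaT_form m f t1 t2 x0 l.1 (level l.1 l.2 w)).
Proof.
move=> hl; rewrite /Hmean invmx_h //; congr (_ * _).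
have e1 : (J l w)^T *m Pi *m Minv l.1 (level l.1 l.2 w) = Minv l.1 (level l.1 l.2 w).
  by have /(congr1 trmx) := Minv_Pi_J hl; rewrite !trmx_mul trmxK Minv_sym mulmxA.
rewrite /Amat /pullback !mulmxA mxtrace_mulC !mulmxA e1 Minv_Pi_J //.
Qed.

End LevelSets.

(** * Divergences and unit vector fields *)

Section UnitField.
Context {R : realType} {n : nat}.
Variables (U : set 'rV[R]_n) (G : 'rV[R]_n -> 'M[R]_n) (V : 'rV[R]_n -> 'rV[R]_n).
Hypothesis oU : open U.
Hypothesis Gsym : forall x, U x -> forall i j, G x i j = G x j i.
Hypothesis Gunit : forall x, U x -> G x \in unitmx.
Implicit Types (x : 'rV[R]_n) (i j k l : 'I_n).

Definition nablaV i k x : R :=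
  pd i (fun z => V z 0 k) x + \sum_l christoffel G k i l x * V x 0 l.

Lemma cov_vectorE i k x :
  cov G (of_vector V) x [ffun=> k] [ffun=> i] = nablaV i k x.
Proof.
rewrite /cov /of_vector big_ord1 big_ord0 subr0 /nablaV; congr (_ + _).
  by rewrite !ffunE.
by apply: eq_bigr => l _; rewrite updE eqxx !ffunE.
Qed.

Hypothesis dG : forall i j x, U x -> differentiable (fun z => G z i j) x.
Hypothesis dV : forall i x, U x -> differentiable (fun z => V z 0 i) x.
Variable a : R.
Hypothesis nV : forall x, U x -> \sum_k \sum_j V x 0 k * G x k j * V x 0 j = a.

(** Metric compatibility: a vector field of constant length is orthogonal to its
    covariant derivatives. *)
Lemma nabla_norm i x : U x ->
  \sum_k nablaV i k x * (\sum_j G x k j * V x 0 j) = 0.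
Proof.
move=> Ux; pose v k := V x 0 k; pose v' k := pd i (fun z => V z 0 k) x.
pose g' k j := pd i (fun z => G z k j) x.
have d0 : 2 * (\sum_k \sum_j v' k * G x k j * v j) + \sum_k \sum_j v k * g' k j * v j = 0.
  have e : pd i (fun z => \sum_k \sum_j V z 0 k * G z k j * V z 0 j) x = 0.
    by rewrite (eq_open_pd i oU (G := fun=> a)) ?pd_cst.
  have dp k j : differentiable (fun z => V z 0 k * G z k j) x.
    by apply: differentiable_mul; [exact: dV|exact: dG].
  have dq k j : differentiable (fun z => V z 0 k * G z k j * V z 0 j) x.
    by apply: differentiable_mul; [exact: dp|exact: dV].
  rewrite pd_bigsum in e; last by move=> k; apply: differentiable_bigsum => j.
  rewrite -[RHS]e.
  transitivity (\sum_k \sum_j (v' k * G x k j * v j + v k * g' k j * v j + v k * G x k j * v' j)).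
    have sw : \sum_k \sum_j v k * G x k j * v' j = \sum_k \sum_j v' k * G x k j * v j.
      rewrite exchange_big; apply: eq_bigr => k _; apply: eq_bigr => j _ /=.
      by rewrite (Gsym Ux j k); ring.
    rewrite mulr_natl mulr2n -[in X in _ + X + _]sw.
    rewrite -!big_split; apply: eq_bigr => k _ /=; rewrite -!big_split; apply: eq_bigr => j _ /=.
    by ring.
  apply: eq_bigr => k _; rewrite pd_bigsum //; apply: eq_bigr => j _.
  rewrite pdM; [|exact: dp|exact: dV]; rewrite pdM; [|exact: dV|exact: dG].
  by rewrite -/(v' k) -/(v' j) -/(g' k j) -/(v k) -/(v j); ring.
have d1 : 2 * (\sum_k (\sum_l christoffel G k i l x * v l) * (\sum_j G x k j * v j)) =
    \sum_k \sum_j v k * g' k j * v j.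
  transitivity (2 * \sum_l \sum_j v l * v j * (\sum_k G x j k * christoffel G k i l x)).
    congr (2 * _); under eq_bigr do rewrite big_distrlr /=.
    rewrite exchange_big; apply: eq_bigr => l _ /=.
    rewrite exchange_big; apply: eq_bigr => j _ /=.
    by rewrite mulr_sumr; apply: eq_bigr => k _; rewrite (Gsym Ux j k); ring.
  under eq_bigr do under eq_bigr do rewrite (christoffel_low (L := unit) (U := fun=> U) (G := fun=> G) (fun=> Gunit) (l := tt)) //.
  rewrite mulr_sumr.
  transitivity (\sum_l \sum_j v l * g' l j * v j +
     (\sum_l \sum_j v l * v j * pd l (fun z => G z i j) x
      - \sum_l \sum_j v l * v j * pd j (fun z => G z i l) x)).
    rewrite -sumrB -big_split; apply: eq_bigr => l _ /=.
    rewrite mulr_sumr -sumrB -big_split; apply: eq_bigr => j _ /=.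
    rewrite -/(g' l j); move: (v l) (v j) (g' l j) (pd l _ x) (pd j _ x) => *; by field.
  rewrite [X in _ - X]exchange_big /=.
  rewrite [X in _ + (_ - X)](_ : _ = \sum_l \sum_j v l * v j * pd l (fun z => G z i j) x) ?subrr ?addr0 //.
  by apply: eq_bigr => l _; apply: eq_bigr => j _; rewrite (mulrC (v j)).
have d2 : \sum_k nablaV i k x * (\sum_j G x k j * v j) =
   \sum_k \sum_j v' k * G x k j * v j +
   \sum_k (\sum_l christoffel G k i l x * v l) * (\sum_j G x k j * v j).
  rewrite -big_split; apply: eq_bigr => k _ /=; rewrite /nablaV mulrDl; congr (_ + _).
  by rewrite mulr_sumr; apply: eq_bigr => j _; rewrite mulrA.
have d3 : 2 * (\sum_k nablaV i k x * (\sum_j G x k j * v j)) = 0.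
  by rewrite d2 mulrDr d1.
by move/eqP: d3; rewrite mulf_eq0 pnatr_eq0 /= => /eqP.
Qed.

(** The derivative of the logarithm of the volume element. *)
Lemma trace_christoffel l x : U x -> (forall i j, invmx (G x) i j = invmx (G x) j i) ->
  \sum_i christoffel G i i l x =
  2^-1 * \sum_i \sum_s invmx (G x) i s * pd l (fun z => G z i s) x.
Proof.
move=> Ux isym; rewrite /christoffel -mulr_sumr; congr (_ * _).
have e i s : pd s (fun z => G z i l) x = pd s (fun z => G z l i) x.
  by apply: (eq_open_pd s oU) => // z Uz; rewrite Gsym.
transitivity (\sum_i \sum_s invmx (G x) i s * pd l (fun z => G z i s) x +
  (\sum_i \sum_s invmx (G x) i s * pd i (fun z => G z l s) x
   - \sum_i \sum_s invmx (G x) i s * pd s (fun z => G z i l) x)).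
  rewrite -sumrB -big_split; apply: eq_bigr => i _ /=.
  by rewrite -sumrB -big_split; apply: eq_bigr => s _ /=; ring.
rewrite [X in _ - X]exchange_big /=.
rewrite [X in _ + (_ - X)](_ : _ = \sum_i \sum_s invmx (G x) i s * pd i (fun z => G z l s) x) ?subrr ?addr0 //.
by apply: eq_bigr => i _; apply: eq_bigr => s _; rewrite e isym.
Qed.

End UnitField.

(** * Divergences in the Schwarzschild metric *)

Section SchwarzschildDivergence.
Context {R : realType} (m : R).
Implicit Types (q : 'rV[R]_(2 + 2)) (c : bool) (a b : 'I_(2 + 1)) (i j : 'I_(2 + 2)).
Variables (U : bool -> set 'rV[R]_(2 + 2)) (x0 : R).
Hypothesis oU : forall c, open (U c).
Hypothesis Ux : forall c q, U c q -> 0 < xq q < x0.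
Local Notation efN := (prod_frame (fun c : bool => c)).
Local Notation fd := (frame_diff efN).
Local Notation fam := (bool -> 'rV[R]_(2 + 2) -> R).

(** The coordinates [y_a] are eigenfunctions of the Laplacian of the sphere for
    the eigenvalue [- 2]. *)
Lemma Dvec_div_metric c a (u : 'rV[R]_2) :
  \sum_(k < 2) pd k (fun z => Dvec c a z 0 k) u
  + (lam2 u)^-1 * \sum_(k < 2) Dvec c a u 0 k * pd k (@lam2 R) u = - (2 * stereo c u 0 a).
Proof.
have dq := differentiable_sqnorm u.
have d1 : differentiable (fun z => 1 + @sqnorm R z) u by diffs.
have dV : differentiable (fun z => (1 + @sqnorm R z)^-1) u.
  by apply: differentiable_inv; first exact: sqnorm_neq0.
have pl k : pd k (@lam2 R) u = - (lam2 u * (2 * (1 + sqnorm u)^-1) * (2 * u 0 k)).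
  rewrite /lam2 pdM ?pd_cst ?mul0r ?add0r; diffs.
  rewrite pdM; diffs; rewrite pdV ?sqnorm_neq0 // pdD; diffs; rewrite pd_cst pd_sqnorm.
  by field; exact: sqnorm_neq0.
have l0 := lam2_neq0 u; under [X in _ + _ * X]eq_bigr do rewrite pl.
have -> : (lam2 u)^-1 * (\sum_(k < 2) Dvec c a u 0 k * - (lam2 u * (2 * (1 + sqnorm u)^-1) * (2 * u 0 k)))
   = - (4 * (1 + sqnorm u)^-1 * \sum_(k < 2) Dvec c a u 0 k * u 0 k).
  rewrite !mulr_sumr -sumrN; apply: eq_bigr => k _; by field; rewrite l0 sqnorm_neq0.
have n0 := sqnorm_neq0 u; rewrite sqnorm2 in n0.
rewrite !big_ord2; elim/ord3P: a; rewrite ?pd_Dvec_l ?pd_Dvec_r ?Dvec_l ?Dvec_r ?stereo_l ?stereo_r sqnorm2 /=; by field.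
Qed.

(** Differentiate [\sum_a y_a^2 = 1]. *)
Lemma stereo_Dvec c (u : 'rV[R]_2) k : \sum_a stereo c u 0 a * Dvec c a u 0 k = 0.
Proof.
have n0 := sqnorm_neq0 u; rewrite sqnorm2 in n0.
rewrite big_ord3 !Dvec_l !Dvec_r !stereo_l !stereo_r sqnorm2.
by have [->|->] := ord2P k; case: c; rewrite ?expr1 ?expr0 /=; field.
Qed.

(** The volume element is [lam2 x^-4] in the coordinates of the chart. *)
Lemma trace_gSch c q j : U c q ->
  \sum_i christoffel (gSch m c) i i j q =
  (lam2 (lsubmx q))^-1 * pd j (fun z => lam2 (lsubmx z)) q - 4 * (xq q)^-1 * pd j (@xq R 1) q.
Proof.
move=> hq; have x_neq0 : xq q != 0 := xq_neq0 Ux hq; have l0 := lam2_neq0 (lsubmx q).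
have Gsym z : U c z -> forall i j, gSch m c z i j = gSch m c z j i by move=> _ i' j'; exact: gSch_sym.
rewrite (trace_christoffel (@oU c) Gsym) //; last first.
  by move=> i i'; rewrite invmx_gSch // -[in LHS]gInv_sym mxE.
rewrite invmx_gSch //.
have dx : differentiable (@xq R 1) q by exact: differentiable_coord.
have dl : differentiable (fun z : 'rV[R]_(2 + 2) => lam2 (lsubmx z)) q.
  by apply: differentiable_comp_lsubmx; exact: differentiable_lam2.
have d2 : differentiable (fun z : 'rV[R]_(2 + 2) => xq z * xq z) q by diffs.
have xx0 : xq q * xq q != 0 by rewrite mulf_neq0.
have dV : differentiable (fun z : 'rV[R]_(2 + 2) => (xq z * xq z)^-1) q.
  by apply: differentiable_inv.
have pV : pd j (fun z : 'rV[R]_(2 + 2) => (xq z * xq z)^-1) q = - 2 * (xq q)^-1 ^+ 3 * pd j (@xq R 1) q.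
  rewrite pdV // pdM //; move: (pd j _ q) => p; by field.
have s1 : \sum_s gInv m q (lshift 2 s) (lshift 2 s) * pd j (fun z => gSch m c z (lshift 2 s) (lshift 2 s)) q
    = 2 * (xq q ^+ 2 * pd j (fun z : 'rV[R]_(2 + 2) => (xq z * xq z)^-1) q
           + (lam2 (lsubmx q))^-1 * pd j (fun z => lam2 (lsubmx z)) q).
  under eq_bigr => s _.
    have -> : (fun z => gSch m c z (lshift 2 s) (lshift 2 s)) =
       (fun z : 'rV[R]_(2 + 2) => (xq z * xq z)^-1 * lam2 (lsubmx z)).
      by apply/funext => z; rewrite gSch_ll eqxx mulr1 expr2.
    rewrite gInv_ll eqxx mulr1 pdM // -mulrA; over.
  rewrite sumr_const card_ord -mulr_natl.
  move: (pd j _ q) (pd j _ q) => p p'; by field; rewrite l0 x_neq0.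
rewrite big_split_ord /=.
under eq_bigr => s _.
  rewrite big_split_ord /= [X in _ + X]big1 ?addr0 => [|s' _]; last by rewrite gInvE mul0r.
  rewrite (bigD1 s) //= big1 ?addr0 => [|s' s's]; last by rewrite gInvE eq_sym (negbTE s's) !(mulr0, mul0r).
  over.
under [X in _ * (_ + X)]eq_bigr => s _.
  rewrite big_split_ord /= [X in X + _]big1 ?add0r => [|s' _]; last by rewrite gInvE mul0r.
  over.
rewrite s1 !big_ord2 !gInv_rr /= mul0r addr0.
have -> : (fun z => gSch m c z (rshift 2 0) (rshift 2 0)) = fun=> 0.
  by apply/funext => z; rewrite gSch_rr.
have -> : (fun z => gSch m c z (rshift 2 0) (rshift 2 1)) = (fun z : 'rV[R]_(2 + 2) => (xq z * xq z)^-1).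
  by apply/funext => z; rewrite gSch_rr expr2.
have -> : (fun z => gSch m c z (rshift 2 1) (rshift 2 0)) = (fun z : 'rV[R]_(2 + 2) => (xq z * xq z)^-1).
  by apply/funext => z; rewrite gSch_rr expr2.
rewrite pd_cst mulr0 add0r pV.
move: (pd j _ q) (pd j _ q) => p p'; by field; rewrite l0 x_neq0.
Qed.

(** [div (x D_a) = - 2 x y_a] because the coordinates of the sphere are
    eigenfunctions of its Laplacian; the volume element [x^-4] contributes
    [- 4] to [div (x d/dx)]. *)
Lemma frame_div c A q : U c q ->
  \sum_i pd i (fun z => efN c A z 0 i) q
  + \sum_j (\sum_i christoffel (gSch m c) i i j q) * efN c A q 0 j =
  match A with
  | inl a => - (2 * (xq q * stereo c (lsubmx q) 0 a))
  | inr j => - 3 * (0 == j)%:R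
  end.
Proof.
move=> hq; have x_neq0 : xq q != 0 := xq_neq0 Ux hq; have l0 := lam2_neq0 (lsubmx q).
under [X in _ + X]eq_bigr do rewrite trace_gSch // mulrBl.
rewrite sumrB.
have -> : \sum_j (lam2 (lsubmx q))^-1 * pd j (fun z => lam2 (lsubmx z)) q * efN c A q 0 j =
   (lam2 (lsubmx q))^-1 * fd A (fun c z => lam2 (lsubmx z)) c q.
  by rewrite /frame_diff mulr_sumr; apply: eq_bigr => j _; ring.
have -> : \sum_j 4 * (xq q)^-1 * pd j (@xq R 1) q * efN c A q 0 j = 4 * (xq q)^-1 * fd A (fun c z => xq z) c q.
  by rewrite /frame_diff mulr_sumr; apply: eq_bigr => j _; ring.
rewrite fd_xq; case: A => [a|j].
  rewrite (fd_inl_sphere (fun c : bool => c) a (h := fun _ => @lam2 R)); last exact: differentiable_lam2.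
  rewrite mulr0 subr0 big_split_ord /= [X in _ + X + _]big1 ?addr0 => [|k _]; last first.
    by under eq_fun do rewrite frE; rewrite pd_cst.
  have -> : \sum_(k < 2) pd (lshift 2 k) (fun z => efN c (inl a) z 0 (lshift 2 k)) q =
      xq q * \sum_(k < 2) pd k (fun z => Dvec c a z 0 k) (lsubmx q).
    rewrite mulr_sumr; apply: eq_bigr => k _; under eq_fun do rewrite frE.
    have dD := differentiable_Dvec c a k (lsubmx q).
    rewrite pdM; [|exact: differentiable_coord|exact: (differentiable_comp_lsubmx (h := fun u => Dvec c a u 0 k))].
    by rewrite pd_coord eq_sym eq_lrshift mul0r add0r (pd_comp_lsubmx (h := fun u => Dvec c a u 0 k)).
  rewrite mulrCA -mulrDr /Dop Dvec_div_metric.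
  by ring.
rewrite (fd_inr_sphere (fun c : bool => c) j (h := fun _ => @lam2 R)); last exact: differentiable_lam2.
rewrite mulr0 sub0r mulrA mulfVK //.
have -> : \sum_i pd i (fun z => efN c (inr j) z 0 i) q = (0 == j)%:R.
  rewrite big_split_ord /= [X in X + _]big1 ?add0r => [|k _]; last first.
    by under eq_fun do rewrite frE; rewrite pd_cst.
  rewrite (bigD1 j) //= big1 ?addr0 => [|k kj].
    under eq_fun do rewrite frE eqxx mulr1.
    by rewrite pd_coord eq_rshift.
  under eq_fun do rewrite frE (negbTE kj) mulr0.
  by rewrite pd_cst.
by ring.
Qed.

(** The coefficients [v] need not be unique, the frame being overcomplete. *)
Lemma div_frame (V : bool -> 'rV[R]_(2 + 2) -> 'rV[R]_(2 + 2)) (v : 'I_(2 + 1) + 'I_2 -> fam) c q :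
  (forall A, diffU U (v A)) ->
  (forall c q, U c q -> forall i, V c q 0 i = \sum_A v A c q * efN c A q 0 i) -> U c q ->
  \sum_i nablaV (gSch m c) (V c) i i q =
  \sum_A (fd A (v A) c q + v A c q *
    match A with
    | inl a => - (2 * (xq q * stereo c (lsubmx q) 0 a))
    | inr j => - 3 * (0 == j)%:R
    end).
Proof.
move=> dv Vv hq; have de A i : differentiable (fun z => efN c A z 0 i) q by exact: de_ef hq.
have dvq A : differentiable (v A c) q by exact: dv.
rewrite /nablaV big_split /=.
have -> : \sum_i pd i (fun z => V c z 0 i) q =
   \sum_A (fd A (v A) c q + v A c q * \sum_i pd i (fun z => efN c A z 0 i) q).
  have e i : pd i (fun z => V c z 0 i) q = \sum_A (pd i (v A c) q * efN c A q 0 i + v A c q * pd i (fun z => efN c A z 0 i) q).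
    rewrite (eq_open_pd i (@oU c) (fun z hz => Vv c z hz i) hq) pd_bigsum => [|A].
      by apply: eq_bigr => A _; rewrite pdM.
    exact: differentiable_mul.
  under eq_bigr do rewrite e; rewrite exchange_big; apply: eq_bigr => A _ /=.
  by rewrite big_split /= mulr_sumr; congr (_ + _); apply: eq_bigr => i _; rewrite mulrC.
have -> : \sum_i \sum_l christoffel (gSch m c) i i l q * V c q 0 l =
   \sum_A v A c q * \sum_j (\sum_i christoffel (gSch m c) i i j q) * efN c A q 0 j.
  rewrite exchange_big /=; under eq_bigr do rewrite -mulr_suml (Vv _ _ hq) mulr_sumr.
  rewrite exchange_big; apply: eq_bigr => A _ /=; rewrite mulr_sumr.
  by apply: eq_bigr => j _; ring.
rewrite -big_split; apply: eq_bigr => A _ /=.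
by rewrite -addrA -mulrDr frame_div.
Qed.

End SchwarzschildDivergence.

(** * Mean curvature of the level sets *)

(** Here [X = x^2]; the difference [W^(-1/2) - 1 / t] is of order [X] because
    [W - t^2 = X r]. *)
Lemma mean_curvature_estimate (R : realType) (eps t1 W t X r b h Cr Cn Ck : R) :
  0 < eps -> 0 < t1 -> eps <= W -> t1 <= t -> 0 <= X -> W = t ^+ 2 + X * r ->
  `|r| <= Cr -> `|(Num.sqrt W)^-1| <= Cn -> `|3^-1 * (- b + 2^-1 * (W^-1 * h))| <= Ck ->
  `|3^-1 * ((Num.sqrt W)^-1 * (- (- 4 + X * b) + 2^-1 * W^-1 * (- (2 * W) + X * h))) - t^-1|
    <= (Cr * (Num.sqrt eps * t1 * t1)^-1 + Cn * Ck) * X.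
Proof.
move=> eps_gt0 t1_gt0 We t1t X0 e hr hn hK.
have W0 : 0 < W by exact: lt_le_trans We.
have t_gt0 : 0 < t by exact: lt_le_trans t1t.
have se : Num.sqrt eps <= Num.sqrt W by rewrite ler_wsqrtr.
have se0 : 0 < Num.sqrt eps by rewrite sqrtr_gt0.
have s_gt0 : 0 < Num.sqrt W by rewrite sqrtr_gt0.
have s2 : X * r = Num.sqrt W ^+ 2 - t ^+ 2 by rewrite sqr_sqrtr ?ltW // e addrC addKr.
move: (Num.sqrt W) s_gt0 se s2 hn => s s_gt0 se s2 hn.
have st_gt0 : 0 < s * t * (s + t) by rewrite !mulr_gt0 // addr_gt0.
have -> : 3^-1 * (s^-1 * (- (- 4 + X * b) + 2^-1 * W^-1 * (- (2 * W) + X * h))) - t^-1 =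
   - (r * (s * t * (s + t))^-1) * X + (s^-1 * (3^-1 * (- b + 2^-1 * (W^-1 * h)))) * X.
  have -> : - (r * (s * t * (s + t))^-1) * X = - (X * r) * (s * t * (s + t))^-1 by ring.
  rewrite s2; by field; rewrite !gt_eqF // addr_gt0.
rewrite -mulrDl normrM (ger0_norm X0) ler_wpM2r // (le_trans (ler_normD _ _)) // lerD //.
  rewrite normrN normrM ler_pM // normfV gtr0_norm // lef_pV2 ?posrE // ?mulr_gt0 //.
  rewrite ler_pM ?mulr_ge0 ?(ltW se0) ?(ltW t1_gt0) // ?ler_pM ?(ltW se0) ?(ltW t1_gt0) //.
  by rewrite (le_trans t1t) // lerDr ltW.
by rewrite normrM ler_pM.
Qed.

Section MeanCurvature.
Context {R : realType} (m : R) (f : 'rV[R]_(2 + 1) -> R) (sf : smooth_on_sphere f).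
Variables (x0 t1 t2 eps : R).
Hypothesis t1_gt0 : 0 < t1.
Hypothesis t12 : t1 < t2.
Hypothesis hL : forall c q, 0 < xq q < x0 -> 2^-1 <= Lf f c q.
Hypothesis eps_gt0 : 0 < eps.
Hypothesis hw : forall c q, img f x0 t1 t2 c q -> eps <= time_norm m f c q.
Implicit Types (c : bool) (q : 'rV[R]_(2 + 2)) (w : 'rV[R]_(2 + 1)) (l : bool * R).
Local Notation fam := (bool -> 'rV[R]_(2 + 2) -> R).
Local Notation img := (img f x0 t1 t2).
Local Notation efN := (prod_frame (fun c : bool => c)).
Local Notation thN := (prod_coframe (fun c : bool => c)).
Local Notation fd := (frame_diff efN).
Local Notation adm := (admissible img efN).
Local Notation sA := (time_diff f).
Local Notation wS := (time_norm m f).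
Local Notation gSch := (gSch m).
Local Notation gInv := (gInv m).
Local Notation nu := (inv_time_norm m f).
Local Notation Tvec := (Tvec m f t1 t2 x0).
Local Notation omega := (omega m f t1 t2 x0).
Local Notation dS := (dS f).
Local Notation domL := (domL x0 t1 t2).

Let oN : forall c, open (img c) := open_img sf hL.
Let Nx : forall c q, img c q -> 0 < xq q < x0 := @img_x R f x0 t1 t2.
Let adm_nu' : adm nu := adm_nu sf t1_gt0 hL eps_gt0 hw.
Let asA' A : adm (sA A) := adm_time_diff sf t2 t1_gt0 hL A.
Let awS : adm wS := adm_time_norm m sf t2 t1_gt0 hL.

(** The coefficients of [grad S] in the frame; by tightness no index has to be
    raised on the sphere. *)
Definition raised_diff (A : 'I_(2 + 1) + 'I_2) : fam := fun c q =>
  match A with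
  | inl a => sA (inl a) c q
  | inr j => if j == 0 then gm m (xq q) * sA (inr 0) c q + sA (inr 1) c q else sA (inr 0) c q
  end.

Definition T_coeff A : fam := fun c q => - nu c q * raised_diff A c q.

Lemma adm_raised_diff A : adm (raised_diff A).
Proof.
case: A => [a|j]; rewrite /raised_diff; first exact: asA'.
case: (j == 0); last exact: asA'.
by apply: (adm_add oN) => //; apply: (adm_mul oN) => //; exact: (adm_gm m oN Nx).
Qed.

Lemma adm_T_coeff A : adm (T_coeff A).
Proof. by apply: (adm_mul oN); [exact: (adm_opp oN)|exact: adm_raised_diff]. Qed.

Lemma Tvec_frame c q : img c q -> forall i, Tvec c q 0 i = \sum_A T_coeff A c q * efN c A q 0 i.
Proof.
move=> hq i; have x_neq0 := xq_neq0 Nx hq.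
rewrite (TvecE sf t1_gt0 t12 hL eps_gt0 hw) // mxE.
transitivity (- nu c q * \sum_A raised_diff A c q * efN c A q 0 i); last first.
  by rewrite mulr_sumr; apply: eq_bigr => A _; rewrite mulrA.
congr (_ * _).
have -> : (dS c q *m gInv q) 0 i = (dS c q *m gInv q *m (delta_mx 0 i : 'rV_(2 + 2))^T) 0 0.
  rewrite [RHS]mxE (bigD1 i) //= big1 ?addr0 => [|j ji]; last by rewrite !mxE (negbTE ji) andbF mulr0.
  by rewrite [X in _ * X]mxE [X in _ * X]mxE !eqxx mulr1.
rewrite (gInv_frame m c) //.
have ed (A : 'I_(2 + 1) + 'I_2) : \sum_j efN c A q 0 j * (delta_mx 0 i : 'rV[R]_(2 + 2)) 0 j = efN c A q 0 i.
  rewrite (bigD1 i) //= big1 ?addr0 => [|j ji]; last by rewrite mxE (negbTE ji) andbF mulr0.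
  by rewrite mxE !eqxx mulr1.
have er (k : 'I_2) : xq q * (delta_mx 0 i : 'rV[R]_(2 + 2)) 0 (rshift 2 k) = efN c (inr k) q 0 i.
  rewrite -(ed (inr k)) (bigD1 (rshift 2 k)) //= big1 ?addr0 => [|j].
    by rewrite frE eqxx mulr1.
  rewrite -(splitK j); case: (fintype.split j) => j' /=; first by rewrite frE mul0r.
  by rewrite eq_rshift => jk; rewrite frE (negbTE jk) mulr0 mul0r.
under eq_bigr do rewrite (dS_frame sf hL _ hq) ed.
rewrite !(dS_rr sf hL _ hq) !er big_sumType /= big_ord2 /=.
by rewrite -!addrA; congr (_ + _); ring.
Qed.

(** The field [\sum_a y_a D_a] vanishes. *)
Lemma stereo_sA c q : img c q -> \sum_a stereo c (lsubmx q) 0 a * sA (inl a) c q = 0.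
Proof.
move=> hq.
have e a : sA (inl a) c q = xq q * \sum_i Dvec c a (lsubmx q) 0 i * pd (lshift 2 i) (Sf f c) q.
  by rewrite -(fd_Sf sf hL _ c (img_small_x hq)); exact: (@fd_inl R 1 bool (fun c => c)).
under eq_bigr do rewrite e mulrCA mulr_sumr.
rewrite -mulr_sumr exchange_big /= big1 ?mulr0 // => i _.
under eq_bigr do rewrite mulrA.
by rewrite -mulr_suml stereo_Dvec mul0r.
Qed.

Lemma fd_nu A c q : img c q -> fd A nu c q = - (2^-1 * nu c q * (wS c q)^-1 * fd A wS c q).
Proof.
move=> hq; have w_gt0 : 0 < wS c q by exact: lt_le_trans (hw hq).
have dw : differentiable (wS c) q by exact: (adm_diff awS).
have ds : differentiable (fun z => Num.sqrt (wS c z)) q by exact: differentiable_sqrt.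
have s0 : Num.sqrt (wS c q) != 0 by rewrite gt_eqF // sqrtr_gt0.
rewrite /inv_time_norm (fdV efN A (F := fun c q => Num.sqrt (wS c q))) // fd_sqrt //.
have w0 : wS c q = Num.sqrt (wS c q) * Num.sqrt (wS c q) by rewrite -expr2 sqr_sqrtr // ltW.
rewrite [in X in _ = - (_ * X^-1 * _)]w0.
move: (Num.sqrt _) s0 (fd A _ c q) => s s0 d; by field.
Qed.

(** [div (- nu grad S) = - nu Box S - <d nu, dS>] with [nu = w^(-1/2)]. *)
Lemma div_Tvec c q : img c q ->
  \sum_i nablaV (gSch c) (Tvec c) i i q = nu c q * (- boxS m f c q + 2^-1 * (wS c q)^-1 * innerS m f wS c q).
Proof.
move=> hq; rewrite (div_frame m oN Nx (v := T_coeff)) //; first last.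
- exact: Tvec_frame.
- by move=> A; apply: adm_diff (adm_T_coeff A).
have dn : differentiable (nu c) q by exact: (adm_diff adm_nu').
have dnn : differentiable (fun z => - nu c z) q by exact: differentiable_opp.
have du A : differentiable (raised_diff A c) q by exact: (adm_diff (adm_raised_diff A)).
have ds A : differentiable (sA A c) q by exact: (adm_diff (asA' A)).
have dx : differentiable (@xq R 1) q by exact: differentiable_coord.
have e A : fd A (T_coeff A) c q = - (fd A nu c q * raised_diff A c q + nu c q * fd A (raised_diff A) c q).
  rewrite /T_coeff (fdM efN A (F := fun c q => - nu c q) (G := raised_diff A)) //.
  have -> : fd A (fun c q => - nu c q) c q = - fd A nu c q.
    by rewrite /frame_diff -sumrN; apply: eq_bigr => i _; rewrite pdN // mulrN.
  by ring.
rewrite big_sumType /= big_ord2 /= !e.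
have -> : \sum_a (fd (inl a) (T_coeff (inl a)) c q + T_coeff (inl a) c q * - (2 * (xq q * stereo c (lsubmx q) 0 a))) =
   - (\sum_a fd (inl a) nu c q * sA (inl a) c q + nu c q * \sum_a fd (inl a) (sA (inl a)) c q).
  transitivity (- (\sum_a fd (inl a) nu c q * sA (inl a) c q + nu c q * \sum_a fd (inl a) (sA (inl a)) c q)
     + 2 * nu c q * xq q * \sum_a stereo c (lsubmx q) 0 a * sA (inl a) c q).
    rewrite !mulr_sumr -big_split -sumrN -big_split; apply: eq_bigr => a _ /=.
    rewrite e /T_coeff /raised_diff /=; by ring.
  by rewrite stereo_sA // mulr0 addr0.
pose G : fam := fun c q => (1 - 2 * m * xq q) * sA (inr 0) c q.
have dm : differentiable (fun z : 'rV[R]_(2 + 2) => 1 - 2 * m * xq z) q by diffs.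
have dG : differentiable (G c) q by exact: differentiable_mul.
have dxx : differentiable (fun z => xq z * xq z * G c z) q by diffs.
have e0 : fd (inr 0) (raised_diff (inr 0)) c q =
    xq q ^+ 2 * fd (inr 0) G c q + 2 * xq q ^+ 2 * G c q + fd (inr 0) (sA (inr 1)) c q.
  have -> : raised_diff (inr 0) = fun c q => xq q * xq q * G c q + sA (inr 1) c q.
    by apply/funext => c'; apply/funext => q'; rewrite /raised_diff /G /gm /=; ring.
  have dxq : differentiable (fun z : 'rV[R]_(2 + 2) => xq z * xq z) q by diffs.
  rewrite (fdD efN _ (F := fun c q => xq q * xq q * G c q) (G := sA (inr 1))) //.
  rewrite (fdM efN _ (F := fun c q => xq q * xq q) (G := G)) //.
  rewrite (fdM efN _ (F := fun c q => xq q) (G := fun c q => xq q)) // fd_xq eqxx.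
  by move: (fd _ _ c q) (fd _ _ c q) => z1 z2; rewrite /=; ring.
have e1 : fd (inr 1) (raised_diff (inr 1)) c q = fd (inr 1) (sA (inr 0)) c q by [].
rewrite e0 e1 /boxS /innerS.
rewrite -/G !fd_nu //.
have -> : \sum_a fd (inl a) nu c q * sA (inl a) c q =
   - (2^-1 * nu c q * (wS c q)^-1) * \sum_a fd (inl a) wS c q * sA (inl a) c q.
  rewrite mulr_sumr; apply: eq_bigr => a _; rewrite fd_nu //; ring.
rewrite /T_coeff /raised_diff /gm /G /=.
generalize (nu c q) (wS c q)^-1 (xq q) (sA (inr 0) c q) (sA (inr 1) c q) (fd (inr 0) wS c q) (fd (inr 1) wS c q)
  (\sum_a fd (inl a) wS c q * sA (inl a) c q) (\sum_a fd (inl a) (sA (inl a)) c q)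
  (fd (inr 0) (sA (inr 1)) c q) (fd (inr 1) (sA (inr 0)) c q)
  (fd (inr 0) (fun (c0 : bool) (q0 : 'rV[R]_(2 + 2)) => (1 - 2 * m * xq q0) * time_diff f (inr 0) c0 q0) c q).
by move=> *; field.
Qed.

Lemma differentiable_Tvec c q i : img c q -> differentiable (fun z => Tvec c z 0 i) q.
Proof.
move=> hq; apply: (eq_open_differentiable (@oN c) (F := fun z => \sum_A T_coeff A c z * efN c A z 0 i)) => //.
  by move=> z hz; rewrite Tvec_frame.
apply: differentiable_bigsum => A; apply: differentiable_mul; first exact: (adm_diff (adm_T_coeff A)).
exact: (de_ef (fun c : bool => c) (U := img)).
Qed.

(** The part of [Minv] along [T] contributes [<nabla_T T, T> = 0]. *)
Lemma trace_nablaT c q : img c q ->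
  \tr (Minv m f x0 t1 t2 c q *m nablaT_form m f t1 t2 x0 c q) = \sum_i nablaV (gSch c) (Tvec c) i i q.
Proof.
move=> hq; have x_neq0 := xq_neq0 Nx hq.
pose D : 'M[R]_(2 + 2) := \matrix_(i, k) nablaV (gSch c) (Tvec c) i k q.
have -> : nablaT_form m f t1 t2 x0 c q = D *m gSch c q.
  apply/matrixP => i j; rewrite [LHS]mxE [RHS]mxE; apply: eq_bigr => k _.
  by rewrite /nablaT cov_vectorE [D _ _]mxE.
have D0 : D *m (omega c q)^T = 0.
  apply/matrixP => i j; rewrite [RHS]mxE [LHS]mxE.
  apply: etrans (nabla_norm (@oN c) (G := gSch c) (V := Tvec c) (a := -1) _ _ _ _ _ i hq).
  - apply: eq_bigr => k _; rewrite [D _ _]mxE; congr (_ * _).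
    rewrite mxE /Defs.omega mxE; apply: eq_bigr => l _; rewrite (ord1 j).
    by rewrite gSch_sym mulrC.
  - by move=> z _ i' j'; exact: gSch_sym.
  - by move=> z hz; apply: gSch_unit; exact: (xq_neq0 Nx hz).
  - by move=> i' j' z hz; apply: differentiable_gSch; exact: (xq_neq0 Nx hz).
  - by move=> i' z hz; exact: differentiable_Tvec.
  - move=> z hz; have /matrixP/(_ 0 0) := norm_omega sf t1_gt0 t12 hL eps_gt0 hw hz.
    rewrite [RHS]mxE eqxx => h; apply: etrans h.
    rewrite /Defs.omega mxE exchange_big; apply: eq_bigr => k _ /=.
    by rewrite [(_^T) _ _]mxE [(_ *m _) _ _]mxE mulr_suml.
rewrite mulmxA mxtrace_mulC mulmxA /Minv mulmxDr gSch_inverse // mulmxDl mul1mx mxtraceD.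
have -> : gSch c q *m ((Tvec c q)^T *m Tvec c q) *m D = (omega c q)^T *m (Tvec c q *m D).
  by rewrite mulmxA /Defs.omega trmx_mul gSch_tr !mulmxA.
rewrite (mxtrace_mulC (omega c q)^T) -mulmxA D0 mulmx0 mxtrace0 addr0.
by apply: eq_bigr => i _; rewrite mxE.
Qed.

Lemma Hmean_bound : exists C : R, forall c (t : R) w, t1 < t < t2 -> on_level x0 w ->
  `|Hmean m f t1 t2 x0 c t w - t^-1| <= C * lxco w ^+ 2.
Proof.
pose K : fam := fun c q => 3^-1 * (- rb m f c q + 2^-1 * ((wS c q)^-1 * rho m f c q)).
have aK : adm K.
  have awV : adm (fun c q => (wS c q)^-1).
    apply: (@adm_inv _ _ _ _ img efN oN wS eps) => // c q hq.
    by rewrite (le_trans (hw hq)) // ler_norm.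
  have h1 := adm_rb m sf t2 t1_gt0 hL; have h2 := adm_rho m sf t2 t1_gt0 hL.
  apply: (adm_mul oN); first exact: adm_cst.
  apply: (adm_add oN); first exact: (adm_opp oN).
  by apply: (adm_mul oN); [exact: adm_cst|exact: (adm_mul oN)].
have [Ck hK] := adm_bdd aK; have [Cn hn] := adm_bdd adm_nu'.
have [Cr hr] := adm_bdd (adm_rw m sf t2 t1_gt0 hL).
exists (Cr * (Num.sqrt eps * t1 * t1)^-1 + Cn * Ck) => c t w ht hx.
have hl : domL (c, t) w by split => //=; rewrite -lxcoE.
have hq := level_img sf t1_gt0 t12 hL hl; rewrite /= in hq.
have t_gt0 : 0 < t by case/andP: ht => /(lt_trans t1_gt0).
rewrite (HmeanE sf t1_gt0 t12 hL eps_gt0 hw hl) /= (trace_nablaT hq).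
rewrite (div_Tvec hq).
rewrite (box_expand m sf t1_gt0 hL hq) (inner_expand m sf t1_gt0 hL hq).
rewrite (xq_level f c t w) lxcoE.
have e := time_norm_expand m hL c (img_small_x hq); rewrite (Sf_level sf hL) in e; last by case: hl.
rewrite (xq_level f c t w) in e.
apply: (mean_curvature_estimate eps_gt0 t1_gt0 (hw hq) _ _ _ (hr _ _ hq) (hn _ _ hq) (hK _ _ hq)).
- by case/andP: ht => /ltW.
- exact: sqr_ge0.
- by rewrite e mulrA mulfV ?mul1r ?pnatr_eq0.
Qed.

End MeanCurvature.

(** * Great circles and lengths of curves *)

(** The integral of a nonnegative function is a supremum over simple functions, so
    it is monotone for functions that are not known to be measurable. *)
Lemma le_integral_ge0 d (T : measurableType d) (R : realType) (mu : {measure set T -> \bar R})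
    (D : set T) (f g : T -> \bar R) :
  (forall x, D x -> 0 <= f x)%E -> (forall x, D x -> f x <= g x)%E ->
  (\int[mu]_(x in D) f x <= \int[mu]_(x in D) g x)%E.
Proof.
move=> f0 fg; rewrite !ge0_integralE // => [|x Dx]; last exact: le_trans (f0 x Dx) (fg x Dx).
apply: le_ereal_sup => _ [h hf <-]; exists h => // x; apply: le_trans (hf x) _.
by rewrite /patch; case: ifPn => // /set_mem; exact: fg.
Qed.

Lemma integral_unit_le (R : realType) (f : R -> R) (L : R) :
  (forall s, 0 <= s <= 1 -> 0 <= f s <= L) ->
  (\int[lebesgue_measure]_(s in `[0%R, 1%R]) (f s)%:E <= L%:E)%E.
Proof.
move=> hf.
have h s : `[0%R, 1%R]%classic s -> 0 <= f s <= L by rewrite /= in_itv; exact: hf.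
apply: (@le_trans _ _ (\int[lebesgue_measure]_(s in `[0%R, 1%R]) (cst L%:E) s)%E).
  by apply: le_integral_ge0 => s /h /andP[h1 h2]; rewrite lee_fin.
rewrite integral_cst // [X in (_ * X)%E](_ : _ = 1%E) ?mule1 //.
by apply: etrans (lebesgue_measure_itv `[0%R, 1%R]) _; rewrite /= lte_fin ltr01 sube0.
Qed.

Lemma derive1_curve (R : realType) n (g : R -> 'rV[R]_n) (F : 'rV[R]_n -> R) (s : R) :
  derivable g s 1 -> differentiable F (g s) ->
  derivable (fun r => F (g r)) s 1 /\
  derive1 (fun r => F (g r)) s = \sum_i (derive1 g s) 0 i * pd i F (g s).
Proof.
move=> /derivable1_diffP dg dF; have dc := differentiable_comp dg dF; split.
  exact/derivable1_diffP.
rewrite derive1E (deriveE _ dc) diff_comp //= differentiable_diff_sum //.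
by rewrite derive1E (deriveE _ dg).
Qed.

Lemma derive_segment (R : realType) (x b s : R) :
  derivable (fun r : R => x + r * (b - x)) s 1 /\ derive1 (fun r : R => x + r * (b - x)) s = b - x.
Proof.
have d : is_derive s 1 (fun r : R => x + r * (b - x)) (b - x).
  by apply: is_derive_eq; rewrite /GRing.scale /= ?mulr0 ?add0r ?mulr1; ring.
by split; [exact: ex_derive|rewrite derive1E derive_val].
Qed.

Section GreatCircle.
Context {R : realType}.
Implicit Types (y z e : 'rV[R]_(2 + 1)).

Definition sdot y z := \sum_i y 0 i * z 0 i.

Lemma on_sphere_dot y : on_sphere y <-> sdot y y = 1.
Proof. by []. Qed.

Lemma perp_normalized y z : sdot y y = 1 -> sdot z z = 1 -> sdot y z ^+ 2 < 1 ->
  let e := (Num.sqrt (1 - sdot y z ^+ 2))^-1 *: (z - sdot y z *: y) in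
  sdot e e = 1 /\ sdot y e = 0.
Proof.
move=> yy zz; have [p pE] : {p | sdot y z = p} by exists (sdot y z).
rewrite !pE => p1 e; pose r := Num.sqrt (1 - p ^+ 2).
have r2 : r ^+ 2 = 1 - p ^+ 2 by rewrite sqr_sqrtr // subr_ge0 ltW.
have r0 : r != 0 by rewrite gt_eqF // sqrtr_gt0 subr_gt0.
have eE i : e 0 i = r^-1 * (z 0 i - p * y 0 i) by rewrite !mxE.
split.
  have -> : sdot e e = r ^- 2 * (sdot z z - 2 * p * sdot y z + p ^+ 2 * sdot y y).
    rewrite /sdot; under eq_bigr do rewrite eE.
    rewrite !mulr_sumr -sumrB -big_split mulr_sumr; apply: eq_bigr => i _ /=.
    by rewrite -exprVn; ring.
  rewrite zz yy pE r2 (_ : 1 - 2 * p * p + p ^+ 2 * 1 = 1 - p ^+ 2); last by ring.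
  by rewrite mulVf // -r2 expf_neq0.
have -> : sdot y e = r^-1 * (sdot y z - p * sdot y y).
  rewrite /sdot; under eq_bigr do rewrite eE.
  by rewrite !mulr_sumr -sumrB mulr_sumr; apply: eq_bigr => i _ /=; ring.
by rewrite yy pE mulr1 subrr mulr0.
Qed.

(** Some coordinate satisfies [y_i^2 < 1]; project the basis vector of index [i]. *)
Lemma exists_perp y : sdot y y = 1 -> exists2 e, sdot e e = 1 & sdot y e = 0.
Proof.
move=> yy.
have [i hi] : exists i, y 0 i ^+ 2 < 1.
  apply: contrapT => /forallNP h.
  have h1 i : 1 <= y 0 i * y 0 i by rewrite -expr2 leNgt; apply/negP; exact: h.
  (* Otherwise the squares of the three coordinates would add up to at least 3. *)
  have : 1 + 1 + 1 <= sdot y y by rewrite /sdot big_ord3 !lerD.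
  by rewrite yy; lra.
have dd : sdot (delta_mx 0 i) (delta_mx 0 i) = 1.
  rewrite /sdot (bigD1 i) //= big1 => [|j ji]; last by rewrite !mxE (negbTE ji) andbF mulr0.
  by rewrite !mxE !eqxx mulr1 addr0.
have yd : sdot y (delta_mx 0 i) = y 0 i.
  rewrite /sdot (bigD1 i) //= big1 => [|j ji]; last by rewrite !mxE (negbTE ji) andbF mulr0.
  by rewrite !mxE !eqxx mulr1 addr0.
rewrite -yd in hi; have [e1 e2] := perp_normalized yy dd hi.
by exists ((Num.sqrt (1 - sdot y (delta_mx 0 i) ^+ 2))^-1 *: (delta_mx 0 i - sdot y (delta_mx 0 i) *: y)).
Qed.

(** Two points [y], [z] lie on a great circle: its second direction is the
    normalized projection of [z] orthogonal to [y], or any unit vector orthogonal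
    to [y] when [z] is [y] or [- y]. *)
Lemma great_circle y z : sdot y y = 1 -> sdot z z = 1 ->
  exists e th, [/\ 0 <= th <= pi, sdot e e = 1, sdot y e = 0 & z = cos th *: y + sin th *: e].
Proof.
move=> yy zz; have [p pE] : {p | sdot y z = p} by exists (sdot y z).
have dE : sdot (z - p *: y) (z - p *: y) = 1 - p ^+ 2.
  transitivity (sdot z z - 2 * p * sdot y z + p ^+ 2 * sdot y y).
    rewrite /sdot !mulr_sumr -sumrB -big_split; apply: eq_bigr => i _ /=.
    by rewrite !mxE; ring.
  by rewrite zz yy pE; ring.
have dn v : 0 <= sdot v v by apply: sumr_ge0 => i _; rewrite -expr2 sqr_ge0.
have p1 : p ^+ 2 <= 1 by rewrite -subr_ge0 -dE.
have p11 : -1 <= p <= 1 by rewrite -ler_norml -(@ler_pXn2r _ 2) ?nnegrE // real_normK ?num_real // expr1n.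
have hth : 0 <= acos p <= pi by rewrite acos_ge0 // acos_lepi.
have hc : cos (acos p) = p by rewrite acosK // in_itv.
have hs := sin_acos p11.
have [pl|pl] := ltP (p ^+ 2) 1.
  have := perp_normalized yy zz; rewrite pE => /(_ pl) [e1 e2].
  exists ((Num.sqrt (1 - p ^+ 2))^-1 *: (z - p *: y)), (acos p); split => //.
  have r0 : Num.sqrt (1 - p ^+ 2) != 0 by rewrite gt_eqF // sqrtr_gt0 subr_gt0.
  by rewrite hc hs scalerA (mulfV r0) scale1r addrC subrK.
have pe : 1 - p ^+ 2 = 0 by apply/eqP; rewrite subr_eq0 eq_le p1 pl.
have [e e1 e2] := exists_perp yy.
exists e, (acos p); split => //.
rewrite hc hs pe sqrtr0 scale0r addr0.
have : \sum_i (z - p *: y) 0 i ^+ 2 = 0 by rewrite -[RHS]pe -dE; apply: eq_bigr => i _; rewrite expr2.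
move/eqP; rewrite psumr_eq0 => [/allP h|i _]; last exact: sqr_ge0.
apply/rowP => i; have := h i (mem_index_enum _); rewrite /= sqrf_eq0.
by rewrite mxE [X in _ + X]mxE subr_eq0 => /eqP.
Qed.

(** The class of these curves is closed under differentiation; this makes
    them continuously differentiable. *)
Definition circ_arc y e (th s : R) := cos (th * s) *: y + sin (th * s) *: e.

Lemma arc_derive y e th s : derivable (circ_arc y e th) s 1 /\
  derive1 (circ_arc y e th) s = circ_arc (th *: e) (- th *: y) th s.
Proof.
have dc i : is_derive s 1 (fun r => circ_arc y e th r 0 i) (circ_arc (th *: e) (- th *: y) th s 0 i).
  rewrite (_ : (fun r => _) = (fun r => cos (th * r) * y 0 i + sin (th * r) * e 0 i)); last first.
    by apply/funext => r; rewrite !mxE.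
  have d1 : is_derive s 1 (fun r : R => th * r) th.
    by apply: is_derive_eq; rewrite ?scaler1 ?scale0r ?addr0 // /GRing.scale /= mulr1.
  have d2 := is_derive1_comp (f := @cos R) (g := fun r => th * r) (is_derive_cos (th * s)) d1.
  have d3 := is_derive1_comp (f := @sin R) (g := fun r => th * r) (is_derive_sin (th * s)) d1.
  apply: is_derive_eq; rewrite /GRing.scale /= !mxE; ring.
have df : differentiable (circ_arc y e th) s.
  by apply: differentiable_rV => i; apply/derivable1_diffP; exact: ex_derive.
split; first exact/derivable1_diffP.
apply/rowP => i; rewrite derive1E -derive_rV //; exact: derive_val.
Qed.

Lemma arc_derive1 y e th : derive1 (circ_arc y e th) = circ_arc (th *: e) (- th *: y) th.
Proof. by apply/funext => s; have [] := arc_derive y e th s. Qed.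

Lemma continuous_arc y e th : continuous (circ_arc y e th).
Proof.
move=> s; apply: differentiable_continuous; apply/derivable1_diffP.
by have [] := arc_derive y e th s.
Qed.

Lemma arc_on_sphere y e th s : sdot y y = 1 -> sdot e e = 1 -> sdot y e = 0 ->
  on_sphere (circ_arc y e th s).
Proof.
move=> yy ee ye; apply/on_sphere_dot.
have -> : sdot (circ_arc y e th s) (circ_arc y e th s) = cos (th * s) ^+ 2 * sdot y y
    + 2 * (cos (th * s) * sin (th * s)) * sdot y e + sin (th * s) ^+ 2 * sdot e e.
  rewrite /sdot !mulr_sumr -!big_split; apply: eq_bigr => i _ /=.
  by rewrite /circ_arc !mxE; ring.
by rewrite yy ee ye mulr0 addr0 !mulr1 cos2Dsin2.
Qed.

Lemma sphere_coord_le1 y i : sdot y y = 1 -> `|y 0 i| <= 1.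
Proof.
move=> yy; rewrite -(@ler_pXn2r _ 2) ?nnegrE // real_normK ?num_real // expr1n -yy /sdot (bigD1 i) //= -expr2.
by rewrite lerDl; apply: sumr_ge0 => j _; rewrite -expr2 sqr_ge0.
Qed.

Lemma arc_speed y e th s i : sdot y y = 1 -> sdot e e = 1 -> 0 <= th ->
  `|derive1 (circ_arc y e th) s 0 i| <= 2 * th.
Proof.
move=> yy ee th0; rewrite arc_derive1 /circ_arc 5!mxE (le_trans (ler_normD _ _)) // mulr_natl mulr2n lerD //.
  rewrite !normrM -[leRHS]mul1r ler_pM ?mulr_ge0 //; first by rewrite ler_norml cos_geN1 cos_le1.
  by rewrite ger0_norm // -[leRHS]mulr1 ler_wpM2l // sphere_coord_le1.
rewrite !normrM normrN -[leRHS]mul1r ler_pM ?mulr_ge0 //; first by rewrite ler_norml sin_geN1 sin_le1.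
by rewrite (ger0_norm th0) ler_piMr //; exact: sphere_coord_le1.
Qed.

End GreatCircle.

(** * Velocities in the coframe *)

Section FrameLength.
Context {R : realType} {n : nat} {M : finType} {L : Type}.
Variables (e th : L -> M -> 'rV[R]_n -> 'rV[R]_n) (l : L) (x : 'rV[R]_n).
Hypothesis complete : forall i j, \sum_A e l A x 0 i * th l A x 0 j = (i == j)%:R.

(** Expand both vectors in the frame. *)
Lemma ip_frame (G : L -> 'rV[R]_n -> 'M[R]_n) (v v' : 'rV[R]_n) :
  ip (G l x) v v' = \sum_A \sum_B (\sum_i th l A x 0 i * v 0 i) *
     (\sum_i th l B x 0 i * v' 0 i) * gram e G A B l x.
Proof.
have vE (u : 'rV[R]_n) : u = \sum_A (\sum_i th l A x 0 i * u 0 i) *: e l A x.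
  apply/rowP => k; rewrite summxE; under eq_bigr do rewrite mxE mulr_suml.
  rewrite exchange_big (bigD1 k) //= [X in _ + X]big1 ?addr0 => [|i ik].
    transitivity ((\sum_A e l A x 0 k * th l A x 0 k) * u 0 k); first by rewrite complete eqxx mul1r.
    by rewrite mulr_suml; apply: eq_bigr => A _; ring.
  transitivity ((\sum_A e l A x 0 k * th l A x 0 i) * u 0 i).
    by rewrite mulr_suml; apply: eq_bigr => A _; ring.
  by rewrite complete eq_sym (negbTE ik) mul0r.
rewrite {1}(vE v) {1}(vE v') /ip linear_sum /= mulmx_sumr summxE exchange_big /=.
under [RHS]eq_bigr do idtac.
apply: eq_bigr => B _; rewrite !mulmx_suml summxE; apply: eq_bigr => A _.
have -> : ((\sum_i th l B x 0 i * v' 0 i) *: e l B x)^T = (\sum_i th l B x 0 i * v' 0 i) *: (e l B x)^T.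
  by apply/matrixP => i j; rewrite !mxE.
by rewrite -!scalemxAl -scalemxAr scalerA mxE [in RHS]gramE.
Qed.

End FrameLength.

Section CurveSpeed.
Context {R : realType}.
Variables (y : R -> 'rV[R]_(2 + 1)) (x : R -> R) (s : R).
Hypothesis dy : derivable y s 1.
Hypothesis dx : derivable x s 1.
Hypothesis sy : forall r, on_sphere (y r).
Let c := chart_at (y s).
Let u r := stereo_proj c (y r).
Let w r : 'rV[R]_(2 + 1) := row_mx (u r) ((x r)%:M : 'M[R]_1).

Let den (z : 'rV[R]_(2 + 1)) := 1 - (-1) ^+ c * z 0 (rshift 2 0).

Let den_neq0 : den (y s) != 0.
Proof.
rewrite /den /c /chart_at mxE; case: leP => h; rewrite ?expr1 ?expr0.
  by rewrite mulN1r opprK gt_eqF // ltr_pwDl.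
by rewrite mul1r gt_eqF // subr_gt0 (lt_trans h).
Qed.

Let uE r i : u r 0 i = (den (y r))^-1 * y r 0 (lshift 1 i).
Proof. by rewrite /u /stereo_proj /den !mxE. Qed.

Let diff_den : differentiable den (y s).
Proof. by rewrite /den; diffs. Qed.

Let du i : derivable (fun r => u r 0 i) s 1.
Proof.
under eq_fun do rewrite uE.
have dF : differentiable (fun z => (den z)^-1 * z 0 (lshift 1 i)) (y s).
  by apply: differentiable_mul; [exact: differentiable_inv|exact: differentiable_coord].
by have [] := derive1_curve dy dF.
Qed.

Let diff_u : differentiable u s.
Proof. by apply: differentiable_rV => i; apply/derivable1_diffP; exact: du. Qed.

Let w_l r i : w r 0 (lshift 1 i) = u r 0 i.
Proof. by rewrite row_mxEl. Qed.

Let w_r r i : w r 0 (rshift 2 i) = x r.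
Proof. by rewrite row_mxEr mxE (ord1 i) eqxx. Qed.

Let diff_w : differentiable w s.
Proof.
apply: differentiable_rV => j; rewrite -(splitK j); case: (fintype.split j) => i /=.
  by under eq_fun do rewrite w_l; apply/derivable1_diffP; exact: du.
by under eq_fun do rewrite w_r; apply/derivable1_diffP.
Qed.

Let w'E j : derive1 w s 0 j = derive1 (fun r => w r 0 j) s.
Proof. by rewrite !derive1E derive_rV. Qed.

Lemma curve_coframe_r T (ch : T -> bool) l (k : 'I_1) :
  \sum_i prod_coframe ch l (inr k) (w s) 0 i * derive1 w s 0 i = (x s)^-1 * derive1 x s.
Proof.
rewrite big_split_ord /= big1 ?add0r => [|i _]; last by rewrite frE mul0r.
rewrite big_ord1 frE w'E (ord1 k) eqxx mulr1 /xq w_r; congr (_ * _).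
by rewrite (_ : (fun r => w r 0 (rshift 2 0)) = x) //; apply/funext => r; rewrite w_r.
Qed.

(** In the chart of projection the component [th^a] of the velocity is
    [y_a' / x], because [th^a = d y_a / x] and the chart is a section of the
    projection. *)
Lemma curve_coframe_l T (ch : T -> bool) l a : ch l = c ->
  \sum_i prod_coframe ch l (inl a) (w s) 0 i * derive1 w s 0 i = (x s)^-1 * derive1 y s 0 a.
Proof.
move=> hc; rewrite big_split_ord /= [X in _ + X]big1 ?addr0 => [|i _]; last by rewrite frE mul0r.
have lw : lsubmx (w s) = u s by rewrite row_mxKl.
have xw : xq (w s) = x s by rewrite /xq w_r.
transitivity ((x s)^-1 * \sum_i derive1 u s 0 i * pd i (fun z => stereo c z 0 a) (u s)).
  rewrite mulr_sumr; apply: eq_bigr => i _; rewrite frE hc lw xw pd_stereo w'E.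
  have -> : derive1 (fun r => w r 0 (lshift 1 i)) s = derive1 u s 0 i.
    by rewrite !derive1E -derive_rV //; congr ('D_1 _ s); apply/funext => r; rewrite w_l.
  by ring.
have du' : derivable u s 1 by apply/derivable1_diffP.
have [_ <-] := derive1_curve du' (differentiable_stereo_coord c a (u s)).
congr (_ * _).
have dy' : differentiable y s by apply/derivable1_diffP.
rewrite derive1E [in RHS]derive1E -derive_rV //; apply: near_eq_derive.
have cd : {for s, continuous (fun r => den (y r))}.
  apply: differentiable_continuous; exact: (differentiable_comp dy' diff_den).
have : \forall r \near s, den (y r) != 0 by exact: (cvgr_neq0 _ cd den_neq0).
by apply: filterS => r hr; rewrite stereoK.
Qed.

End CurveSpeed.

(** * Distances in a level set *)

Section Distance.
Context {R : realType} (m : R) (f : 'rV[R]_(2 + 1) -> R) (sf : smooth_on_sphere f).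
Variables (x0 t1 t2 eps : R).
Hypothesis t1_gt0 : 0 < t1.
Hypothesis t12 : t1 < t2.
Hypothesis hL : forall c q, 0 < xq q < x0 -> 2^-1 <= Lf f c q.
Hypothesis eps_gt0 : 0 < eps.
Hypothesis hw : forall c q, img f x0 t1 t2 c q -> eps <= time_norm m f c q.
Implicit Types (c : bool) (q : 'rV[R]_(2 + 2)) (w : 'rV[R]_(2 + 1)) (l : bool * R).
Local Notation img := (img f x0 t1 t2).
Local Notation efN := (prod_frame (fun c : bool => c)).
Local Notation domL := (domL x0 t1 t2).

Local Notation chL := (fun l : bool * R => l.1).
Local Notation efL := (prod_frame chL).
Local Notation thL := (prod_coframe chL).
Local Notation h := (fun l : bool * R => hmet m f l.1 l.2).

Let Lx l w : domL l w -> 0 < xq w < x0. Proof. by case. Qed.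

(** The height stays above its final value [b], so the coframe components of the
    velocity are bounded by a multiple of [1 / b]. *)
Lemma speed_bound : exists D : R, forall t (y e : 'rV[R]_(2 + 1)) th (x b s : R),
  t1 < t < t2 -> sdot y y = 1 -> sdot e e = 1 -> sdot y e = 0 -> 0 <= th <= pi ->
  0 < b <= x -> x < x0 -> 0 <= s <= 1 ->
  speed m f t (circ_arc y e th) (fun r => x + r * (b - x)) s <= (2 * pi + x0) * Num.sqrt D * b^-1.
Proof.
have [D hD] : bdd domL (fun l w => \sum_A \sum_B `|gram efL h A B l w|).
  apply: bdd_sum => A; apply: bdd_sum => B.
  have [C hC] := adm_bdd (adm_gram_h m sf t1_gt0 t12 hL A B).
  by exists C => l w hl; rewrite normr_id hC.
exists D => t y e th x b s ht yy ee ye /andP[th0 thpi] /andP[b0 bx] xx0 /andP[s0 s1].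
set Y := circ_arc y e th; set X := fun r => _.
have dY r : derivable Y r 1 by have [] := arc_derive y e th r.
have [dX X'] := derive_segment x b s; rewrite -/X in dX X'.
have Xb : b <= X s.
  have -> : X s = b + (1 - s) * (x - b) by rewrite /X; ring.
  by rewrite lerDl mulr_ge0 ?subr_ge0.
have Xx : X s <= x.
  have -> : X s = x - s * (x - b) by rewrite /X; ring.
  by rewrite gerBl mulr_ge0 ?subr_ge0.
have X0 : 0 < X s by exact: lt_le_trans Xb.
have x_gt0 : 0 < x by exact: lt_le_trans bx.
have sY r : on_sphere (Y r) by exact: arc_on_sphere.
rewrite /speed -/Y; set c := chart_at (Y s); set w := fun r => _.
have xw : xq (w s) = X s by rewrite /xq row_mxEr mxE eqxx.
have hl : domL (c, t) (w s) by split => //; rewrite xw X0 (le_lt_trans Xx).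
set K := 2 * pi + x0.
have K0 : 0 <= K by rewrite addr_ge0 ?mulr_ge0 ?pi_ge0 // ltW // (lt_trans x_gt0).
have bV : (X s)^-1 <= b^-1 by rewrite lef_pV2 ?posrE.
have XV0 : 0 <= (X s)^-1 by rewrite invr_ge0 ltW.
have hth A : `|\sum_i thL (c, t) A (w s) 0 i * derive1 w s 0 i| <= b^-1 * K.
  case: A => [a|k].
    rewrite (curve_coframe_l (dY s) dX sY) // normrM ger0_norm // ler_pM //.
    rewrite (le_trans (arc_speed _ _ yy ee th0)) // /K (le_trans (_ : _ <= 2 * pi)) ?ler_wpM2l //.
    by rewrite lerDl ltW // (lt_trans x_gt0).
  rewrite (curve_coframe_r (dY s) dX) // normrM ger0_norm // ler_pM // X' ler0_norm ?subr_le0 // opprB.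
  have h1 : x - b <= x by rewrite gerBl ltW.
  have h2 : x0 <= K by rewrite /K lerDr mulr_ge0 // pi_ge0.
  exact: le_trans h1 (le_trans (ltW xx0) h2).
have bK : 0 <= b^-1 * K by rewrite mulr_ge0 // invr_ge0 ltW.
have sq : Num.sqrt ((b^-1 * K) ^+ 2 * D) = K * Num.sqrt D * b^-1.
  by rewrite sqrtrM ?sqr_ge0 // sqrtr_sqr (ger0_norm bK) [RHS]mulrC mulrA.
rewrite -sq.
rewrite ler_wsqrtr // (ip_frame (complete_ef chL Lx hl) h) (le_trans (ler_norm _)) //.
rewrite (le_trans (ler_norm_sum _ _ _)) // (le_trans (_ : _ <= (b^-1 * K) ^+ 2 * \sum_A \sum_B `|gram efL h A B (c, t) (w s)|)) //.
  rewrite mulr_sumr ler_sum // => A _; rewrite (le_trans (ler_norm_sum _ _ _)) //.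
  rewrite mulr_sumr ler_sum // => B _; rewrite normrM ler_wpM2r // expr2 normrM ler_pM //.
by rewrite ler_wpM2l ?sqr_ge0 // (le_trans (ler_norm _)) // hD.
Qed.

Lemma level_dist_bound : exists2 L : R, 0 <= L & forall t (y z : 'rV[R]_(2 + 1)) (x b : R),
  t1 < t < t2 -> on_sphere y -> on_sphere z -> 0 < b <= x -> x < x0 ->
  (level_dist m f x0 t (y, x) (z, b) <= (L * b^-1)%:E)%E.
Proof.
have [D hD] := speed_bound.
have [x0_le|x0_gt0] := leP x0 0.
  exists 0 => // t y z x b _ _ _ /andP[b0 bx] xx0.
  by have := lt_trans (lt_le_trans b0 bx) xx0; rewrite ltNge x0_le.
exists ((2 * pi + x0) * Num.sqrt D).
  by rewrite mulr_ge0 ?sqrtr_ge0 // addr_ge0 ?mulr_ge0 ?pi_ge0 // ltW.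
move=> t y z x b ht yy zz hb xx0.
have [e [th [hth ee ye zE]]] := great_circle yy zz.
pose X r := x + r * (b - x).
apply: (@le_trans _ _ (curve_length m f t (circ_arc y e th) X)); last first.
  by apply: integral_unit_le => s hs; rewrite sqrtr_ge0 hD.
apply: ereal_inf_lbound; exists (circ_arc y e th), X; split => //.
- have X' : derive1 X = fun=> b - x by apply/funext => s; have [] := derive_segment x b s.
  split.
  + by move=> s; have [] := arc_derive y e th s.
  + by rewrite arc_derive1; exact: continuous_arc.
  + by move=> s; case: (derive_segment x b s).
  + by rewrite X'; exact: cst_continuous.
  + move=> s /andP[s0 s1]; split; first exact: arc_on_sphere.
    case/andP: hb => b0 bx.
    have e1 : X s = b + (1 - s) * (x - b) by rewrite /X; ring.
    have e2 : X s = x - s * (x - b) by rewrite /X; ring.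
    rewrite {1}e1 e2 (lt_le_trans b0) ?lerDl ?mulr_ge0 ?subr_ge0 //=.
    by rewrite (le_lt_trans _ xx0) // gerBl mulr_ge0 ?subr_ge0.
- by rewrite /circ_arc /X !mulr0 cos0 sin0 scale1r scale0r mul0r !addr0.
- by rewrite /circ_arc /X !mulr1 -zE mul1r addrC subrK.
Qed.

(** The distance is [O(1 / e)] and [H - 1 / t] is [O(e^2)]. *)
Lemma level_dist_mean_curvature (t : R) (y : 'rV[R]_(2 + 1)) (x : R) :
  t1 < t < t2 -> on_sphere y -> 0 < x < x0 ->
  forall del : R, 0 < del ->
  \forall e \near 0^'+, forall c w, lxco w = e ->
    (level_dist m f x0 t (y, x) (stereo c (lang w), lxco w)
       * `|Hmean m f t1 t2 x0 c t w - t^-1|%:E < del%:E)%E.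
Proof.
move=> ht yy /andP[x_gt0 xx0] del del0.
have [L L0 hd] := level_dist_bound; have [C hC] := Hmean_bound sf t1_gt0 t12 hL eps_gt0 hw.
have e0 : 0 < del / (`|L * C| + 1) by rewrite divr_gt0 // ltr_wpDl.
near=> e => c w we.
have e_gt0 : 0 < e by near: e; exact: nbhs_right_gt.
have ex : e < x by near: e; exact: nbhs_right_lt.
have ed : e < del / (`|L * C| + 1) by near: e; exact: nbhs_right_lt.
have hx : on_level x0 w by rewrite /on_level we e_gt0 (lt_trans ex).
have := hC c t w ht hx; rewrite we => hH.
have hdist : (level_dist m f x0 t (y, x) (stereo c (lang w), e) <= (L * e^-1)%:E)%E.
  by apply: hd => //; [exact: stereo_on_sphere|rewrite e_gt0 ltW].
apply: (le_lt_trans (lee_wpmul2r _ hdist)); first by rewrite lee_fin.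
rewrite -EFinM lte_fin.
apply: (@le_lt_trans _ _ (L * e^-1 * (C * e ^+ 2))).
  by rewrite ler_wpM2l // mulr_ge0 // invr_ge0 ltW.
have -> : L * e^-1 * (C * e ^+ 2) = L * C * e by field; rewrite gt_eqF.
rewrite ltr_pdivlMr ?ltr_wpDl // in ed.
apply: le_lt_trans ed; rewrite mulrC ler_wpM2l ?(ltW e_gt0) //.
by rewrite (le_trans (ler_norm _)) // lerDl.
Unshelve. all: by end_near. Qed.

End Distance.

(** * Choice of the domain *)

Section Choice.
Context {R : realType} (m : R) (f : 'rV[R]_(2 + 1) -> R) (t1 t2 : R).
Hypothesis m_gt0 : 0 < m.
Hypothesis sf : smooth_on_sphere f.
Hypothesis t1_gt0 : 0 < t1.

(** The first bound on [x0] keeps [L] away from 0.  It makes the remainder of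
    [time_norm_expand] bounded, and the second one makes it smaller than half of
    the leading term. *)
Lemma small_domain : exists x0 : R, [/\ 0 < x0 <= (2 * m)^-1,
  forall c q, 0 < xq q < x0 -> 2^-1 <= Lf f c q &
  forall c q, img f x0 t1 t2 c q -> 2^-1 * t1 ^+ 2 <= time_norm m f c q].
Proof.
have [x1 x1_gt0 h1] := Lf_bound sf.
pose xa := Num.min x1 (2 * m)^-1.
have xa_gt0 : 0 < xa by rewrite lt_min x1_gt0 invr_gt0 mulr_gt0.
have hL c q : 0 < xq q < xa -> 2^-1 <= Lf f c q.
  by move=> /andP[h0 hx]; apply: h1; rewrite h0 (lt_le_trans hx) // ge_min lexx.
have [C hC] := adm_bdd (adm_rw m sf t2 t1_gt0 hL).
(* For [x <= 1] one has [x^2 |r| <= x |r|], so that a bound on [x] suffices. *)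
pose x2 := 2^-1 * t1 ^+ 2 / (`|C| + 1).
have C1 : 0 < `|C| + 1 by rewrite ltr_wpDl.
have x2_gt0 : 0 < x2 by rewrite divr_gt0 // mulr_gt0 ?invr_gt0 // exprn_gt0.
exists (Num.min xa (Num.min 1 x2)); split.
- rewrite lt_min xa_gt0 lt_min ltr01 x2_gt0 /=.
  by rewrite ge_min; apply/orP; left; rewrite ge_min lexx orbT.
- by move=> c q /andP[h0]; rewrite (lt_min (xq q)) => /andP[hx _]; apply: hL; rewrite h0.
move=> c q [/andP[h0]]; rewrite (lt_min (xq q)) (lt_min (xq q) 1) => /and3P[hxa hx1 hx2] hS.
have hq : img f xa t1 t2 c q by split => //; rewrite h0.
rewrite (time_norm_expand m hL c (img_small_x hq)).
have S_ge : t1 ^+ 2 <= 2 * Sf f c q.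
  by have := Sf_ge hq; rewrite -(ler_pM2l (_ : 0 < 2)) // mulrA mulfV ?mul1r // pnatr_eq0.
have r_le : `|rw m f c q| <= `|C| by rewrite (le_trans (hC _ _ hq)) // ler_norm.
have xr : xq q ^+ 2 * `|rw m f c q| <= 2^-1 * t1 ^+ 2.
  have e : x2 * (`|C| + 1) = 2^-1 * t1 ^+ 2 by rewrite /x2 mulfVK // gt_eqF.
  rewrite -e ler_pM ?sqr_ge0 //; last by rewrite (le_trans r_le) // lerDl.
  by rewrite expr2 (le_trans _ (ltW hx2)) // ler_piMl // ltW.
have := ler_norm (- (xq q ^+ 2 * rw m f c q)); rewrite normrN normrM (ger0_norm (sqr_ge0 _)).
move=> hn; have hn' := le_trans hn xr.
have -> : 2^-1 * t1 ^+ 2 = t1 ^+ 2 - 2^-1 * t1 ^+ 2 by field.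
by rewrite lerD // lerNl.
Qed.

End Choice.

Theorem proposition5p2 (R : realType) (m : R) (f : 'rV[R]_(2 + 1) -> R)
    (tau1 tau2 : R) (m_gt0 : 0 < m) (f_smooth : smooth_on_sphere f)
    (tau1_gt0 : 0 < tau1) (tau12 : tau1 < tau2) :
  exists x0 : R, 0 < x0 <= (2 * m)^-1 /\
  let N := N f tau1 tau2 x0 in
  let gSch := gSch m in
  let gRef := gRef m f tau1 tau2 x0 in
  let normN p q k B := @CNnorm R m f tau1 tau2 x0 p q k B in
  let alpha := lapse m f tau1 tau2 x0 in
  let h := hmet m f in
  let A := sff m f tau1 tau2 x0 in
  let H := Hmean m f tau1 tau2 x0 in
  (* the setting: Phi is a diffeomorphism onto N and tau is a time function *)
  (Phi_diffeo f tau1 tau2 x0 /\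
   forall c q, N c q ->
     past_directed_timelike m c q (grad_tau m f tau1 tau2 x0 c q)) /\
  (* (i) *)
  (normN _ _ 1%N (nablaT m f tau1 tau2 x0) < +oo)%E /\
  (* (ii) *)
  (exists C : R, forall c q, N c q ->
     [/\ `|alpha c q| <= C, `|(alpha c q)^-1| <= C
       & tnorm (gRef c) (grad_vec m alpha c) q <= C]) /\
  (* (iii) *)
  (exists C : R, forall c q, N c q ->
     tnorm (gRef c) (grad_vec m log_r c) q <= C) /\
  (* (iv) *)
  (forall k : nat, exists C : R, forall c (t : R) w,
     tau1 < t < tau2 -> on_level x0 w ->
     tnorm (h c t) (icov (h c t) (A c t) k) w <= C) /\
  (* (v) *)
  (forall k : nat, (normN _ _ k (fun c => riemann (gSch c)) < +oo)%E) /\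
  (* (vi) *)
  (exists C : R, forall c (t : R) w,
     tau1 < t < tau2 -> on_level x0 w ->
     `|H c t w - t^-1| <= C * lxco w ^+ 2) /\
  (forall (t : R) (y : 'rV[R]_(2 + 1)) (x : R),
     tau1 < t < tau2 -> on_sphere y -> 0 < x < x0 ->
     forall eps : R, 0 < eps ->
     \forall e \near 0^'+, forall c w, lxco w = e ->
       (level_dist m f x0 t (y, x) (stereo c (lang w), lxco w)
          * `|H c t w - t^-1|%:E < eps%:E)%E).
Proof.
have [x0 [hx0 hL hw]] := small_domain tau2 m_gt0 f_smooth tau1_gt0.
have eps_gt0 : 0 < 2^-1 * tau1 ^+ 2 by rewrite mulr_gt0 ?invr_gt0 // exprn_gt0.
exists x0; split; first exact: hx0.
split; last split; last split; last split; last split; last split; last split.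
- split; first exact: (Phi_diffeoP f_smooth tau1_gt0 tau12 hL).
  move=> c q; rewrite (N_img f_smooth tau1_gt0 tau12 hL).
  exact: (past_directed f_smooth tau1_gt0 tau12 hL eps_gt0 hw).
- exact: (nablaT_fin f_smooth tau1_gt0 tau12 hL eps_gt0 hw).
- exact: (lapse_bdd f_smooth tau1_gt0 tau12 hL eps_gt0 hw).
- exact: (log_r_bdd f_smooth tau1_gt0 tau12 hL eps_gt0 hw).
- exact: (sff_bdd f_smooth tau1_gt0 tau12 hL eps_gt0 hw).
- exact: (riemann_fin f_smooth tau1_gt0 tau12 hL eps_gt0 hw).
- exact: (Hmean_bound f_smooth tau1_gt0 tau12 hL eps_gt0 hw).
- exact: (level_dist_mean_curvature f_smooth tau1_gt0 tau12 hL eps_gt0 hw).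
Qed.
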